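(* The Steenrod operations $$\mathfrak{sq}^i\colon H^n(X_\bullet;\mathbb{F}_2)\to H^{n+i}(X_\bullet;\mathbb{F}_2),\qquad \mathfrak{sq}^i([\alpha])=[\alpha\smile_{n-i}\alpha],\qquad i\ge 0,$$ associated to the stable symmetric multiplication $\{\smile_i\}$ of an ordered augmented semi-simplicial object in the Burnside category $X_\bullet$ are natural with respect to maps of augmented semi-simplicial objects in the Burnside category: if $f\colon X_\bullet\to Y_\bullet$ is any map of augmented semi-simplicial objects in the Burnside category and both $X_\bullet$ and $Y_\bullet$ are ordered (with no compatibility required between $f$ and the orders), then $f^*\mathfrak{sq}^i=\mathfrak{sq}^i f^*$ for all $i\ge 0$. In particular, the operations $\mathfrak{sq}^i$ on $H^*(X_\bullet;\mathbb{F}_2)$ do not depend on the chosen order on $X_\bullet$.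
   Context: **Burnside category.** A locally finite span from a set $X$ to a set $Y$ is a set $Q$ with maps $\mathrm{source}\colon Q\to X$, $\mathrm{target}\colon Q\to Y$ such that $\mathrm{source}^{-1}(x)$ is finite for every $x$. A fibrewise bijection between two spans from $X$ to $Y$ is a bijection commuting with source and target. The composite of a span $Q$ from $X$ to $Y$ and a span $Q'$ from $Y$ to $Z$ is $Q'\circ Q=Q\times_Y Q'$; the identity span is $X=X=X$ (associativity and unit isomorphisms are suppressed). The Burnside $2$-category has sets as objects, locally finite spans as $1$-morphisms, fibrewise bijections as $2$-morphisms. For a commutative ring $R$, a span $Q$ induces $\mathcal{A}_R(Q)\colon R\langle X\rangle\to R\langle Y\rangle$, $x\mapsto\sum_{e\in \mathrm{source}^{-1}(x)}\mathrm{target}(e)$. **Objects.** $P_q(n)$ is the set of strictly increasing sequences of $q$ elements of $\{0,\ldots,n\}$ (i.e. $q$-element subsets). For disjoint $V,U\subset\{0,\dots,n\}$, $\psi_V(U)=\{u-|\{v\in V: v<u\}| : u\in U\}\subset\{0,\ldots,n-|V|\}$. An augmented semi-simplicial object in the Burnside category $X_\bullet$ consists of: a set $X_n$ for each $n\ge -1$; for each $n\geq -1$ and $U\in P_q(n)$ a locally finite span $\partial^n_U$ from $X_n$ to $X_{n-q}$ (the same symbol denotes its underlying set); for each partition $U=V_1\sqcup V_2$ with $V_1\in P_{q_1}(n)$ a fibrewise bijection $\mu^n_{V_1,V_2}\colon\partial^n_U\to\partial^{n-q_1}_{\psi_{V_1}(V_2)}\circ\partial^n_{V_1}$; such that $\partial^n_\emptyset$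 is the identity span, $\mu_{\emptyset,V}$ and $\mu_{V,\emptyset}$ are identities, and for $U=V_1\sqcup V_2\sqcup V_3$ one has $(\mathrm{Id}\times\mu_{\psi_{V_1}(V_2),\psi_{V_1}(V_3)})\circ\mu_{V_1,V_2\cup V_3}=(\mu_{V_1,V_2}\times\mathrm{Id})\circ\mu_{V_1\cup V_2,V_3}$; this composite is denoted $\mu_{V_1,V_2,V_3}\colon\partial_U\to\partial_{\psi_{V_1\cup V_2}(V_3)}\circ\partial_{\psi_{V_1}(V_2)}\circ\partial_{V_1}$. It is ordered if each set $\partial^n_U$ is equipped with a total order. $C_*(X_\bullet;R)$ is the chain complex with $C_n=R\langle X_n\rangle$, $n\ge -1$, and $d_n=\sum_{i=0}^n(-1)^i\mathcal{A}_R(\partial^n_{\{i\}})$; $C^*(X_\bullet;R)$ is its dual and $H^*(X_\bullet;R)$ the cohomology of $C^*(X_\bullet;R)$. **Maps.** A map $f\colon X_\bullet\to Y_\bullet$ (structure of $Y_\bullet$ denoted $\bar\partial,\bar\mu$) consists of locally finite spans $f_n$ from $X_n$ to $Y_n$ and fibrewise bijections $f^n_U\colon f_{n-q}\circ\partial^n_U\to\bar\partial^n_U\circ f_n$ for $U\in P_q(n)$, with $f^n_\emptyset$ the identity and, for $U=V_1\sqcup V_2$, $\bar\mu_{V_1,V_2}\circ f_U=f_{V_1}\circ f^{n-|V_1|}_{\psi_{V_1}(V_2)}\circ\mu_{V_1,V_2}$ (suppressing identity factors). It induces chain maps $\mathcal{A}_R(f_n)$, cochain maps and maps $f^*$ on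 cohomology. **Sequences with repetitions.** $\mathcal{P}_q(n)$ is the set of non-decreasing sequences of length $q$ in $\{0,\ldots,n\}$ in which each number appears at most twice. For $U\in\mathcal{P}_q(n)$, $\ddot U$ is the set of repeated entries. If $\bar u_1<\dots<\bar u_m$ are the distinct entries of $U$, the index of a non-repeated entry $\bar u_i$ is $\bar u_i+i$. Then $U^+$ (resp. $U^-$) is the set consisting of $\ddot U$ and the non-repeated entries of even (resp. odd) index. So $U^+\cap U^-=\ddot U$. **Good pairs and chains.** For $V_1\subset U$, $\lambda_{V_1}\colon\partial_U\to\partial_{V_1}$ is $\mu_{V_1,U\smallsetminus V_1}$ followed by projection. For disjoint $V_1,V_2\subset U$, $\lambda_{V_1,V_2}\colon\partial^n_U\to\partial^{n-|V_1|}_{\psi_{V_1}(V_2)}$ is $\mu_{V_1,V_2,U\smallsetminus(V_1\cup V_2)}$ followed by projection to the middle factor. Let $U,V\subset\{0,\ldots,n\}$, $(s,t)\in\partial_U\times\partial_V$. A pair $(W^\parallel,W^\circ)$ of disjoint subsets of $U\cap V$ is $(s,t)$-good if $\lambda_{W^\parallel}(s)=\lambda_{W^\parallel}(t)$ and $\lambda_{W^\parallel,W^\circ}(s)\ne\lambda_{W^\parallel,W^\circ}(t)$. A good pair is positive if either $n+|U|+|V|$ is even and $\lambda_{W^\parallel,W^\circ}(s)<\lambda_{W^\parallel,W^\circ}(t)$, or $n+|U|+|V|$ is odd and $\lambda_{W^\parallel,W^\circ}(s)>\lambda_{W^\parallel,W^\circ}(t)$. Write $(W_0^\parallel,W_0^\circ)\prec(W_1^\parallel,W_1^\circ)$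 if $W_1^\circ=W_0^\circ\sqcup\{w\}$ for some $w$ and $W_1^\parallel=W_0^\parallel\smallsetminus\{w\}$. $\mathcal{O}_{s,t}(U\cap V)^+$ is the set of chains $(W_1^\parallel,W_1^\circ)\prec\dots\prec(W_r^\parallel,W_r^\circ)$ of positive $(s,t)$-good pairs of length $r=|U\cap V|$ (if $U\cap V=\emptyset$ there is exactly one, empty, chain). **Multiplication.** For $X_\bullet$ ordered, $\nabla_k\colon C_*(X_\bullet;\mathbb{F}_2)\to C_*(X_\bullet;\mathbb{F}_2)\otimes C_*(X_\bullet;\mathbb{F}_2)$ is the degree $k$ homomorphism given on $x\in X_n$ by $$\nabla_k(x)=\sum_{U\in\mathcal{P}_{n-k}(n)}\ \sum_{\substack{(s,t)\in\partial_{U^-}\times\partial_{U^+}\\ \mathrm{source}(s)=\mathrm{source}(t)=x}}|\mathcal{O}_{s,t}(\ddot U)^+|\cdot\mathrm{target}(s)\otimes\mathrm{target}(t),$$ and $(\alpha\smile_i\beta)(\sigma)=(\alpha\otimes\beta)(\nabla_i(\sigma))$ for $\alpha\in C^p(X_\bullet;\mathbb F_2)$, $\beta\in C^q(X_\bullet;\mathbb F_2)$, which lies in $C^{p+q-i}(X_\bullet;\mathbb F_2)$. These satisfy $d(\alpha\smile_i\beta)=d\alpha\smile_i\beta+\alpha\smile_i d\beta+\alpha\smile_{i-1}\beta+\beta\smile_{i-1}\alpha$, so that $\mathfrak{sq}^i$ is well defined on cohomology. *)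

(* Defs.v *)
(* MathComp, with mathcomp-classical for finite sets and classical choice.
   A set is a choiceType (classically every type carries such a structure).
   Degrees are shifted by one: level m : nat stands for degree m - 1 >= -1, so
   that the vertex set {0, ..., m - 1} of a simplex of level m is 'I_m. *)
From HB Require Import structures.
From mathcomp Require Import all_boot all_algebra.
From mathcomp Require Import finmap.
From mathcomp Require Import boolp classical_sets functions cardinality fsbigop.
From mathcomp Require Import freeg.

Set Implicit Arguments.
Unset Strict Implicit.
Unset Printing Implicit Defensive.

Import GRing.Theory.
Local Open Scope classical_set_scope.
Local Open Scope ring_scope.

(** * Locally finite spans *)

Record span (X Y : choiceType) := Span {
  span_carrier :> choiceType;
  source : span_carrier -> X;
  target : span_carrier -> Y;
  _ : forall x, finite_set (source @^-1` [set x]) }.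

Definition fibre (X Y : choiceType) (Q : span X Y) (x : X) : set Q :=
  @source X Y Q @^-1` [set x].
Arguments fibre {X Y} Q x.

Lemma fibre_finite (X Y : choiceType) (Q : span X Y) x : finite_set (fibre Q x).
Proof. by case: Q => ? ? ? fin; exact: fin. Qed.

Lemma span_id_finite (X : choiceType) (x : X) :
  finite_set ((@id X) @^-1` [set x]).
Proof. exact: (finite_set1 x). Qed.

Definition span_id (X : choiceType) : span X X := Span id (@span_id_finite X).

Section Composition.
Variables (X Y Z : choiceType) (Q' : span Y Z) (Q : span X Y).

Definition fibprod : choiceType := {p : Q * Q' | target p.1 == source p.2}.

Lemma fibprod_finite (x : X) :
  finite_set ((fun p : fibprod => source (val p).1) @^-1` [set x]).
Proof.
have fin : finite_set (\bigcup_(e in fibre Q x)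
    [set p : Q * Q' | p.1 = e /\ fibre Q' (target e) p.2]).
  apply: bigcup_finite (fibre_finite _ _) _ => e _.
  apply: sub_finite_set (finite_image (pair e) (fibre_finite Q' (target e))).
  by move=> [a b] /= [-> hb]; exists b.
apply: sub_finite_set
  (finite_preimage (f := fun p : fibprod => val p) _ fin); last first.
  by move=> p q _ _; apply: val_inj.
move=> [[a b] /= hab] <-; exists a => //; split=> //=.
exact/esym/eqP.
Qed.

(* Q' \o Q, the fibre product of Q and Q' over Y. *)
Definition span_comp : span X Z :=
  Span (fun p : fibprod => target (val p).2) fibprod_finite.

Definition fst_leg (p : span_comp) : Q := (val p).1.
Definition snd_leg (p : span_comp) : Q' := (val p).2.

End Composition.

(* Fibrewise bijections. *)
Record span_iso (X Y : choiceType) (Q Q' : span X Y) := SpanIso {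
  iso_fun :> Q -> Q';
  _ : bijective iso_fun;
  _ : forall e, source (iso_fun e) = source e;
  _ : forall e, target (iso_fun e) = target e }.

(* Equality with the identity span, the unit isomorphisms being suppressed.
   The bijection below is unique: its inverse has to be the source map. *)
Definition is_span_id (X : choiceType) (Q : span X X) : Prop :=
  inhabited (span_iso (span_id X) Q).

(** * Faces *)

(* The subsets U of 'I_n with n - |U| = k. *)
Record face (n k : nat) := Face {
  face_set :> {set 'I_n};
  _ : (#|face_set| + k == n)%N }.

Lemma face0_subproof n : (#|(finset.set0 : {set 'I_n})| + n == n)%N.
Proof. by rewrite cards0. Qed.
Definition face0 n : face n n := Face (face0_subproof n).

Lemma face1_subproof n (i : 'I_n.+1) : (#|[set i]%SET| + n == n.+1)%N.
Proof. by rewrite cards1. Qed.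
Definition face1 n (i : 'I_n.+1) : face n.+1 n := Face (face1_subproof i).

Lemma set_face_subproof n (U : {set 'I_n}) : (#|U| + (n - #|U|) == n)%N.
Proof. by rewrite subnKC // -[leqRHS]card_ord max_card. Qed.
Definition set_face n (U : {set 'I_n}) : face n (n - #|U|) :=
  Face (set_face_subproof U).

(* psi_V(U), where k stands for n - |V|. *)
Definition psi n k (V U : {set 'I_n}) : {set 'I_k} :=
  [set j : 'I_k |
    [exists u in U, j == u - #|[set v in V | (v < u)%N]| :> nat]%N]%SET.
Arguments psi {n} k V U.

Section CutFace.
Variables (n k1 k2 : nat) (U : face n k2) (V : face n k1).

Let g (u : 'I_n) : nat := (u - #|[set v in V | (v < u)%N]%SET|)%N.

Let gE (u : 'I_n) : g u = #|[set v in ~: V | (v < u)%N]%SET|.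
Proof.
have hu : #|[set v : 'I_n | (v < u)%N]%SET| = u.
  rewrite -sum1_card (eq_bigl (fun v : 'I_n => (v < u)%N)); last first.
    by move=> v; rewrite inE.
  by rewrite (big_ord_narrow (ltnW (ltn_ord u))) sum1_card card_ord.
rewrite /g -[X in (X - _)%N]hu -(cardsID V [set v : 'I_n | (v < u)%N]%SET).
rewrite (_ : [set v in V | _] = [set v : 'I_n | (v < u)%N] :&: V)%SET; last first.
  by apply/setP=> v; rewrite !inE andbC.
by rewrite addKn; apply: eq_card => v; rewrite !inE.
Qed.

Let g_lt (u u' : 'I_n) : u \notin (V : {set _}) -> (u < u')%N -> (g u < g u')%N.
Proof.
move=> uV uu'; rewrite !gE; apply/proper_card/fintype.properP; split.
  by apply/fintype.subsetP=> v; rewrite !inE => /andP[-> /ltn_trans]; apply.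
by exists u; rewrite !inE ?uV //= ltnn.
Qed.

Let g_ltk (u : 'I_n) : u \notin (V : {set _}) -> (g u < k1)%N.
Proof.
move=> uV; have -> : k1 = #|~: V|.
  have := cardsC V; rewrite card_ord; case: V => W /= /eqP hW.
  by rewrite -[RHS]hW => /addnI.
rewrite gE; apply/proper_card/fintype.properP; split.
  by apply/fintype.subsetP=> v; rewrite !inE => /andP[].
by exists u; rewrite !inE ?uV //= ltnn.
Qed.

Lemma card_cut : V \subset U -> (#|psi k1 V (U :\: V)| + k2 == k1)%N.
Proof.
move=> sVU.
have injg : {in (U :\: V)%SET &, injective g}.
  move=> u u'; rewrite !inE => /andP[uV _] /andP[u'V _] e; apply/val_inj.
  by case: (ltngtP u u') => // [/(g_lt uV)|/(g_lt u'V)]; rewrite e ltnn.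
have -> : #|psi k1 V (U :\: V)| = #|U :\: V|.
  rewrite !cardE -(size_map val) -[RHS](size_map g); apply: perm_size.
  apply: uniq_perm; first by rewrite map_inj_uniq ?enum_uniq //; apply: val_inj.
    rewrite map_inj_in_uniq ?enum_uniq // => u u'.
    by rewrite !mem_enum; apply: injg.
  move=> j; apply/mapP/mapP => -[].
    move=> i; rewrite mem_enum inE => /existsP[u /andP[uU /eqP e]] ->.
    by exists u => //; rewrite mem_enum.
  move=> u; rewrite mem_enum => uU ->.
  have gu : (g u < k1)%N by apply: g_ltk; move: uU; rewrite inE => /andP[].
  exists (Ordinal gu) => //; rewrite mem_enum inE; apply/existsP; exists u.
  by rewrite uU /=.
rewrite cardsD (finset.setIidPr sVU).
have cVU := subset_leq_card sVU.
case: U V cVU => A /= /eqP hA [B /= /eqP hB] hBA.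
by apply/eqP; apply: (@addnI #|B|); rewrite addnA subnKC // hA hB.
Qed.

(* psi_V(U \ V) as a face, for V included in U. *)
Definition cut_face (sVU : V \subset U) : face k1 k2 := Face (card_cut sVU).

End CutFace.

(* U is the disjoint union of V1 and V2, and W = psi_{V1}(V2). *)
Definition cuts n k1 k2 (U : face n k2) (V1 : face n k1) (V2 : {set 'I_n})
    (W : face k1 k2) : bool :=
  [&& [disjoint V1 & V2], V1 :|: V2 == U & psi k1 V1 V2 == W]%SET.

Lemma cuts_cut_face n k1 k2 (U : face n k2) (V : face n k1) (h : V \subset U) :
  cuts U V (U :\: V)%SET (cut_face h).
Proof.
apply/and3P; split=> //.
  by rewrite -setI_eq0; apply/eqP/setP=> v; rewrite !inE; case: (v \in _).
by apply/eqP/setP=> v; rewrite !inE; case: (boolP (v \in _)) => // /(fintype.subsetP h) ->.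
Qed.

(** * Augmented semi-simplicial objects in the Burnside category *)

(* [mu] is indexed by W = psi_{V1}(V2) besides U, V1 and V2: as W is determined
   by V1 and V2 this adds no data, and it avoids transports along
   psi_{psi_{V1}(V2)}(psi_{V1}(V3)) = psi_{V1 u V2}(V3) in [mu_assoc]. *)
Record burnside_sset := BurnsideSSet {
  simp : nat -> choiceType;
  bd : forall n k, face n k -> span (simp n) (simp k);
  mu : forall n k1 k2 (U : face n k2) (V1 : face n k1) (V2 : {set 'I_n})
    (W : face k1 k2),
    cuts U V1 V2 W -> span_iso (bd U) (span_comp (bd W) (bd V1));
  bd_empty : forall n, is_span_id (bd (face0 n));
  mu_empty_l : forall n k (V : face n k) (h : cuts V (face0 n) V V) (s : bd V),
    snd_leg (mu h s) = s;
  mu_empty_r : forall n k (V : face n k) (h : cuts V V finset.set0 (face0 k))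
    (s : bd V), fst_leg (mu h s) = s;
  (* With V12 = V1 u V2, W2 = psi_{V1}(V2), W23 = psi_{V1}(V2 u V3) and
     W3 = psi_{V1 u V2}(V3), both composites have values in
     bd W3 \o bd W2 \o bd V1. *)
  mu_assoc : forall n k1 k2 k3 (U : face n k3) (V1 : face n k1)
    (V12 : face n k2) (V2 V3 : {set 'I_n})
    (W2 : face k1 k2) (W23 : face k1 k3) (W3 : face k2 k3)
    (h1_23 : cuts U V1 (V2 :|: V3)%SET W23)
    (h2_3 : cuts W23 W2 (psi k1 V1 V3) W3)
    (h12_3 : cuts U V12 V3 W3)
    (h1_2 : cuts V12 V1 V2 W2) (s : bd U),
    let a := mu h1_23 s in let a' := mu h2_3 (snd_leg a) in
    let b := mu h12_3 s in let b' := mu h1_2 (fst_leg b) in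
    [/\ fst_leg a = fst_leg b', fst_leg a' = snd_leg b' &
        snd_leg a' = snd_leg b] }.

Arguments mu {X n k1 k2 U V1 V2 W} h : rename.

Record ordering (X : burnside_sset) := Ordering {
  ord_le : forall n k (U : face n k), bd X U -> bd X U -> Prop;
  ord_refl : forall n k (U : face n k) (s : bd X U), ord_le s s;
  ord_anti : forall n k (U : face n k) (s t : bd X U),
    ord_le s t -> ord_le t s -> s = t;
  ord_trans : forall n k (U : face n k) (s t u : bd X U),
    ord_le s t -> ord_le t u -> ord_le s u;
  ord_total : forall n k (U : face n k) (s t : bd X U),
    ord_le s t \/ ord_le t s }.

Definition ord_lt (X : burnside_sset) (o : ordering X) n k (U : face n k)
  (s t : bd X U) : Prop := ord_le o s t /\ s <> t.

(* In [map_mu], x = (s, a) is sent by Id x mu to (v1, w, a), then by f_W to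
   (v1, b, w'), then by f_{V1} to (c, v1', w'), which has to be the image of x
   under f_U followed by bar mu x Id; y = (w, a) and z = (v1, b) name the
   arguments of f_W and f_{V1} as elements of the fibre products. *)
Record burnside_map (X Y : burnside_sset) := BurnsideMap {
  map_span : forall n, span (simp X n) (simp Y n);
  map_bd : forall n k (U : face n k),
    span_iso (span_comp (map_span k) (bd X U))
             (span_comp (bd Y U) (map_span n));
  map_empty : forall n (x : span_comp (map_span n) (bd X (face0 n))),
    fst_leg (map_bd (face0 n) x) = snd_leg x;
  map_mu : forall n k1 k2 (U : face n k2) (V1 : face n k1) (V2 : {set 'I_n})
    (W : face k1 k2) (h : cuts U V1 V2 W)
    (x : span_comp (map_span k2) (bd X U))
    (y : span_comp (map_span k2) (bd X W))
    (z : span_comp (map_span k1) (bd X V1)),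
    fst_leg y = snd_leg (mu h (fst_leg x)) -> snd_leg y = snd_leg x ->
    fst_leg z = fst_leg (mu h (fst_leg x)) ->
    snd_leg z = fst_leg (map_bd W y) ->
    [/\ fst_leg (map_bd U x) = fst_leg (map_bd V1 z),
        fst_leg (mu h (snd_leg (map_bd U x))) = snd_leg (map_bd V1 z) &
        snd_leg (mu h (snd_leg (map_bd U x))) = snd_leg (map_bd W y)] }.

Arguments map_span {X Y} f n : rename.
Arguments map_bd {X Y} f {n k} U : rename.

(** * Chains and cochains *)

(* The map A_R(Q) : R<X> -> R<Y>. *)
Definition span_lin (R : comNzRingType) (X Y : choiceType) (Q : span X Y) :
    {freeg X / R} -> {freeg Y / R} :=
  fglift (fun x => \sum_(e \in fibre Q x) (<< target e >> : {freeg Y / R})).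
Arguments span_lin R {X Y} Q _.

Definition chain (R : comNzRingType) (X : burnside_sset) (m : nat) :=
  {freeg (simp X m) / R}.

Definition boundary (R : comNzRingType) (X : burnside_sset) (m : nat)
    (c : chain R X m.+1) : chain R X m :=
  \sum_(i < m.+1) (-1) ^+ i *: span_lin R (bd X (face1 i)) c.

(* The evaluation R<T> -> R of the linear form given on the basis by a. *)
Definition eval (R : comNzRingType) (T : choiceType) (a : T -> R)
  (c : {freeg T / R}) : R := fglift (a : T -> R^o) c.

(* The dual of R<X_m>, a linear form being given by its values on the basis. *)
Definition cochain (R : comNzRingType) (X : burnside_sset) (m : nat) : zmodType :=
  simp X m -> R.

Definition coboundary (R : comNzRingType) (X : burnside_sset) (m : nat)
    (a : cochain R X m) : cochain R X m.+1 :=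
  fun x => eval a (boundary << x >>).

Definition pullback (R : comNzRingType) (X Y : burnside_sset)
    (f : burnside_map X Y) (m : nat) (a : cochain R Y m) : cochain R X m :=
  fun x => eval a (span_lin R (map_span f m) << x >>).

Section Functoriality.
Variable R : comNzRingType.

Lemma fgliftD (T : choiceType) (M : lmodType R) (h : T -> M) :
  {morph fglift h : c d / c + d}.
Proof.
have hB := lift_is_additive h; have h0 : fglift h 0 = 0.
  by rewrite -(subrr 0) hB subrr.
move=> c d; have hN : fglift h (- d) = - fglift h d by rewrite -sub0r hB h0 sub0r.
by rewrite -[d in LHS]opprK hB hN opprK.
Qed.

Lemma fglift0 (T : choiceType) (M : lmodType R) (h : T -> M) : fglift h 0 = 0.
Proof. by apply: (addrI (fglift h 0)); rewrite -fgliftD !addr0. Qed.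

Lemma fgliftE (T : choiceType) (M : lmodType R) (h : T -> M) c :
  fglift h c = \sum_(z <- dom c) coeff z c *: h z.
Proof.
rewrite -{1}[c]freeg_sumE (big_morph _ (fgliftD h) (fglift0 h)).
by apply: eq_bigr => z _; rewrite liftU.
Qed.

Lemma fglift1 (T : choiceType) (M : lmodType R) (h : T -> M) x :
  fglift h << x >> = h x.
Proof. by rewrite liftU scale1r. Qed.

Lemma scale_fgU (T : choiceType) (k l : R) (x : T) :
  k *: << l *g x >> = << k * l *g x >>.
Proof. by apply/eqP/freeg_eqP => y; rewrite coeff_fgscale !coeffU mulrA. Qed.

Lemma fgliftZ (T : choiceType) (M : lmodType R) (h : T -> M) k c :
  fglift h (k *: c) = k *: fglift h c.
Proof.
rewrite -[c in LHS]freeg_sumE scaler_sumr (big_morph _ (fgliftD h) (fglift0 h)).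
rewrite fgliftE scaler_sumr; apply: eq_bigr => z _.
by rewrite scale_fgU liftU scalerA.
Qed.

Definition star (X Y : choiceType) (Q : span X Y) (a : Y -> R) (x : X) : R :=
  \sum_(e \in fibre Q x) a (target e).

Lemma starE (X Y : choiceType) (Q : span X Y) (a : Y -> R) x :
  star Q a x = \sum_(e <- fset_set (fibre Q x)) a (target e).
Proof. by rewrite /star fsbig_finite //; apply: fibre_finite. Qed.

Lemma eval_span_lin (X Y : choiceType) (Q : span X Y) (a : Y -> R) x :
  eval a (span_lin R Q << x >>) = star Q a x.
Proof.
rewrite /span_lin fglift1 starE fsbig_finite; last exact: fibre_finite.
rewrite /eval (big_morph _ (fgliftD _) (fglift0 _)).
by apply: eq_bigr => e _; rewrite fglift1.
Qed.

Lemma star_iso (X Y : choiceType) (Q Q' : span X Y) (a : Y -> R) x :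
  span_iso Q Q' -> star Q a x = star Q' a x.
Proof.
case=> h bij_h src tgt; rewrite /star.
rewrite (@reindex_fsbig _ _ _ _ _ h (fibre Q x) (fibre Q' x)).
  by apply: eq_fsbigr => e _; rewrite tgt.
split=> [e|e e' _ _|e'].
- by rewrite /fibre /= src.
- exact: (bij_inj bij_h).
- case: bij_h => g hg gh; rewrite /fibre /= => <-; exists (g e') => //=.
  by rewrite -src gh.
Qed.

Lemma star_comp (X Y Z : choiceType) (Q' : span Y Z) (Q : span X Y)
  (a : Z -> R) x : star (span_comp Q' Q) a x = star Q (star Q' a) x.
Proof.
rewrite !starE; under [RHS]eq_bigr do rewrite starE.
transitivity (\sum_(p <- [seq ((e, e') : (Q * Q')%type) |
    e <- fset_set (fibre Q x), e' <- fset_set (fibre Q' (target e))])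
    a (target p.2)); last by rewrite big_allpairs_dep.
rewrite -(big_map val xpredT (fun p : Q * Q' => a (target p.2))).
apply: perm_big; apply: uniq_perm.
- by rewrite map_inj_uniq ?fset_uniq //; apply: val_inj.
- by apply: allpairs_uniq_dep => [|e _|[e e'] [d d'] _ _ [-> ->]] //=.
have inF (S T : choiceType) (P : span S T) y e :
    (e \in enum_fset (fset_set (fibre P y))) = (source e == y).
  rewrite -[LHS]/(e \in fset_set (fibre P y)) in_fset_set; last exact: fibre_finite.
  by apply/idP/eqP; rewrite inE.
move=> [e e']; apply/mapP/allpairsPdep.
  move=> [p pin].
  have : @source _ _ (span_comp Q' Q) p == x by rewrite -inF; exact: pin.
  case: p {pin} => [[d d'] /= dd'] hin [-> ->].
  by exists d, d'; split=> //; rewrite inF // eq_sym.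
move=> [d [d' []]]; rewrite !inF => hd hd' [-> ->].
rewrite eq_sym in hd'; exists (exist _ (d, d') hd') => //.
have : @source _ _ (span_comp Q' Q) (exist _ (d, d') hd') == x by [].
by rewrite -inF.
Qed.

Lemma starD (X Y : choiceType) (Q : span X Y) (a b : Y -> R) x :
  star Q (a + b) x = star Q a x + star Q b x.
Proof. by rewrite !starE -big_split. Qed.

Lemma star_sum (X Y : choiceType) (Q : span X Y) n (k : 'I_n -> R)
  (a : 'I_n -> Y -> R) x :
  star Q (fun y => \sum_i k i * a i y) x = \sum_i k i * star Q (a i) x.
Proof.
rewrite starE exchange_big /=; apply: eq_bigr => i _.
by rewrite starE mulr_sumr.
Qed.

Lemma coboundaryE (X : burnside_sset) m (a : cochain R X m) x :
  coboundary a x = \sum_(i < m.+1) (-1) ^+ i * star (bd X (face1 i)) a x.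
Proof.
rewrite /coboundary /boundary /eval (big_morph _ (fgliftD _) (fglift0 _)).
by apply: eq_bigr => i _; rewrite fgliftZ -eval_span_lin.
Qed.

Lemma coboundaryB (X : burnside_sset) m :
  {morph @coboundary R X m : a b / a - b}.
Proof.
move=> a b; apply/funext => x; rewrite /= -[LHS](addrK (coboundary b x)).
congr (_ - _); rewrite !coboundaryE -big_split; apply: eq_bigr => i _ /=.
by rewrite -mulrDr -starD subrK.
Qed.

(* A_R(f) is a chain map. *)
Lemma pullback_coboundary (X Y : burnside_sset) (f : burnside_map X Y) m
  (a : cochain R Y m) : pullback f (coboundary a) = coboundary (pullback f a).
Proof.
apply/funext => x; rewrite /pullback eval_span_lin coboundaryE.
rewrite (_ : coboundary a = fun y =>
  \sum_(i < m.+1) (-1) ^+ i * star (bd Y (face1 i)) a y); last first.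
  by apply/funext => y; rewrite coboundaryE.
rewrite star_sum; apply: eq_bigr => i _; congr (_ * _).
rewrite -star_comp -(star_iso _ _ (map_bd f (face1 i))) star_comp.
by congr star; apply/funext => y; rewrite eval_span_lin.
Qed.

Lemma pullbackB (X Y : burnside_sset) (f : burnside_map X Y) m :
  {morph @pullback R X Y f m : a b / a - b}.
Proof.
move=> a b; apply/funext => x; rewrite /= -[LHS](addrK (pullback f b x)).
by congr (_ - _); rewrite /pullback !eval_span_lin -starD subrK.
Qed.

End Functoriality.

(** * Cohomology *)

Section Cohomology.
Variables (R : comNzRingType) (X : burnside_sset) (m : nat).

Definition cocycles : {pred cochain R X m} :=
  fun a => coboundary a == 0 :> cochain R X m.+1.

Lemma cocycles_closed : zmod_closed cocycles.
Proof.
have B := @coboundaryB R X m; split=> [|a b].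
  by rewrite /in_mem /= /cocycles -(subrr (0 : cochain R X m)) B subrr.
by rewrite /in_mem /= /cocycles B => /eqP -> /eqP ->; rewrite subrr.
Qed.
HB.instance Definition _ :=
  GRing.isZmodClosed.Build (cochain R X m) cocycles cocycles_closed.

Record cocycle := Cocycle { cocycle_val : cochain R X m;
                            _ : cocycle_val \in cocycles }.
HB.instance Definition _ := [isSub for cocycle_val].
HB.instance Definition _ := [Choice of cocycle by <:].
HB.instance Definition _ := [SubChoice_isSubZmodule of cocycle by <:].

End Cohomology.
Arguments cocycles {R X m}.

(* There is nothing below level 0 (degree -1), where only 0 is a coboundary. *)
Definition is_coboundary (R : comNzRingType) (X : burnside_sset) (m : nat) :
    cochain R X m -> Prop :=
  match m with
  | 0 => fun a => a = 0
  | m'.+1 => fun a => exists b : cochain R X m', a = coboundary b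
  end.

Section Cohomology.
Variables (R : comNzRingType) (X : burnside_sset) (m : nat).

Definition coboundaries : {pred cocycle R X m} :=
  fun a => `[< is_coboundary (val a) >].

Lemma coboundaries_closed : zmod_closed coboundaries.
Proof.
rewrite /coboundaries; case: m => [|m']; split=> [|a b]; rewrite /in_mem /=.
- exact/asboolP.
- by move=> /asboolP /= a0 /asboolP /= b0; apply/asboolP; rewrite /= a0 b0 subrr.
- by apply/asboolP; exists 0; rewrite -(subrr (0 : cochain R X m')) coboundaryB subrr.
move=> /asboolP [a' /= ha] /asboolP [b' /= hb]; apply/asboolP; exists (a' - b').
by rewrite coboundaryB -ha -hb.
Qed.
HB.instance Definition _ :=
  GRing.isZmodClosed.Build (cocycle R X m) coboundaries coboundaries_closed.

Definition cohomology : zmodType := Quotient.quot coboundaries.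

Definition cohom_class (a : cocycle R X m) : cohomology := (\pi_cohomology a)%qT.

End Cohomology.

Lemma cohom_class_eq (R : comNzRingType) (X : burnside_sset) (m : nat)
    (a b : cocycle R X m) :
  cohom_class a = cohom_class b <-> is_coboundary (val a - val b).
Proof.
split=> [|h]; first by move/eqP; rewrite -Quotient.idealrBE => /asboolP.
apply/eqP; rewrite -Quotient.idealrBE; exact/asboolP.
Qed.

Section Pullback.
Variables (R : comNzRingType) (X Y : burnside_sset) (f : burnside_map X Y).
Variable m : nat.

Lemma pullback_cocycle (a : cocycle R Y m) : pullback f (val a) \in cocycles.
Proof.
case: a => a /= /eqP ha; apply/eqP; rewrite -pullback_coboundary ha.
have B := @pullbackB R X Y f m.+1.
by rewrite -(subrr (0 : cochain R Y m.+1)) B subrr.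
Qed.

Definition cocycle_pullback (a : cocycle R Y m) : cocycle R X m :=
  Cocycle (pullback_cocycle a).

(* f^* on cohomology; see cohom_pullbackE for the independence of the chosen
   representative. *)
Definition cohom_pullback (c : cohomology R Y m) : cohomology R X m :=
  cohom_class (cocycle_pullback (repr c)).

End Pullback.

Lemma is_coboundary_pullback (R : comNzRingType) (X Y : burnside_sset)
    (f : burnside_map X Y) (m : nat) (a : cochain R Y m) :
  is_coboundary a -> is_coboundary (pullback f a).
Proof.
case: m a => [|m] a /=; last first.
  by move=> [b ->]; exists (pullback f b); rewrite pullback_coboundary.
have B := @pullbackB R X Y f 0.
by move=> ->; rewrite -(subrr (0 : cochain R Y 0)) B subrr.
Qed.

Lemma cohom_pullbackE (R : comNzRingType) (X Y : burnside_sset)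
    (f : burnside_map X Y) (m : nat) (a : cocycle R Y m) :
  cohom_pullback f (cohom_class a) = cohom_class (cocycle_pullback f a).
Proof.
apply/cohom_class_eq => /=; rewrite -pullbackB; apply: is_coboundary_pullback.
by apply/cohom_class_eq; rewrite /cohom_class reprK.
Qed.

(** * Sequences with repetitions *)

(* The membership condition defining calP_q(n) inside the q-tuples. *)
Definition is_rep_seq (m : nat) (U : seq 'I_m) : bool :=
  sorted leq (map val U) && [forall u, count_mem u U <= 2]%N.

Definition rep_index (m : nat) (U : seq 'I_m) (u : 'I_m) : nat :=
  (u + #|[set v in U | (v <= u)%N]%SET|)%N.

Definition rep_plus (m : nat) (U : seq 'I_m) : {set 'I_m} :=
  [set u | (count_mem u U == 2)%N ||
           (count_mem u U == 1)%N && ~~ odd (rep_index U u)]%SET.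

Definition rep_minus (m : nat) (U : seq 'I_m) : {set 'I_m} :=
  [set u | (count_mem u U == 2)%N ||
           (count_mem u U == 1)%N && odd (rep_index U u)]%SET.

(** * Good pairs and chains *)

Section GoodPairs.
Variables (X : burnside_sset) (o : ordering X) (n : nat).

(* lambda_{V1} : bd U -> bd V1. *)
Definition lam1 k k1 (U : face n k) (V1 : face n k1) (h : V1 \subset U)
  (s : bd X U) : bd X V1 := fst_leg (mu (cuts_cut_face h) s).

(* lambda_{V1,V2} : bd U -> bd psi_{V1}(V2), with V12 = V1 u V2. *)
Definition lam2 k k1 k2 (U : face n k) (V1 : face n k1) (V12 : face n k2)
  (h : V1 \subset V12) (h' : V12 \subset U) (s : bd X U) :
  bd X (cut_face h) := snd_leg (mu (cuts_cut_face h) (lam1 h' s)).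

Variables (kU kV : nat) (U : face n kU) (V : face n kV).
Variables (s : bd X U) (t : bd X V).

(* W = (W^par, W^circ) is a positive (s,t)-good pair.  As n = level = degree + 1
   here, "degree + |U| + |V| is even" reads "n + |U| + |V| is odd". *)
Definition positive_good (W : {set 'I_n} * {set 'I_n}) : Prop :=
  let Wpar := set_face W.1 in let Wboth := set_face (W.1 :|: W.2)%SET in
  exists (hU : Wboth \subset U) (hV : Wboth \subset V),
    let hW : Wpar \subset Wboth := finset.subsetUl W.1 W.2 in
    let s2 := lam2 hW hU s in let t2 := lam2 hW hV t in
    [/\ [disjoint W.1 & W.2]%bool,
        lam1 (fintype.subset_trans hW hU) s = lam1 (fintype.subset_trans hW hV) t,
        s2 <> t2 &
        if odd (n + #|U| + #|V|) then ord_lt o s2 t2 else ord_lt o t2 s2].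

(* W0^par :\ w is a set difference: w need not lie in W0^par.  Requiring it
   would break the coboundary formula for the products cup_i below. *)
Definition pair_prec (W0 W1 : {set 'I_n} * {set 'I_n}) : bool :=
  [exists w, [&& w \notin W0.2, W1.2 == w |: W0.2 & W1.1 == W0.1 :\ w]]%SET.

(* O_{s,t}(U n V)^+. *)
Definition positive_chains :
    {set #|U :&: V|.-tuple ({set 'I_n} * {set 'I_n})%type} :=
  [set c | `[< forall i, positive_good (tnth c i) >] && sorted pair_prec c]%SET.

End GoodPairs.

(** * The multiplication and the Steenrod squares *)

Definition simplex (X : burnside_sset) : choiceType := {m : nat & simp X m}.

(* nabla_k on a simplex of level m; C_* tensor C_* is the free module on the
   pairs of simplices. *)
Definition nabla (X : burnside_sset) (o : ordering X) (k : int) (m : nat)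
    (x : simp X m) : {freeg (simplex X * simplex X)%type / 'F_2} :=
  match m%:Z - 1 - k with
  | Posz q =>
      \sum_(U : q.-tuple 'I_m | is_rep_seq U)
        \sum_(p \in fibre (bd X (set_face (rep_minus U))) x `*`
                     fibre (bd X (set_face (rep_plus U))) x)
          (#|positive_chains o p.1 p.2|)%:R *:
            (<< (Tagged (simp X) (target p.1), Tagged (simp X) (target p.2)) >>
              : {freeg (simplex X * simplex X)%type / 'F_2})
  | Negz _ => 0
  end.

(* A cochain as a linear form on C_*, zero outside its level. *)
Definition extend (X : burnside_sset) (m : nat) (a : cochain 'F_2 X m)
  (x : simplex X) : 'F_2 := untag 0 (a : simp X m -> 'F_2) x.

(* alpha cup_k beta, at any level r; it vanishes unless r - 1 is the degree
   (p - 1) + (q - 1) - k. *)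
Definition cup (X : burnside_sset) (o : ordering X) (k : int) (p q r : nat)
    (a : cochain 'F_2 X p) (b : cochain 'F_2 X q) : cochain 'F_2 X r :=
  fun x => eval (fun y : simplex X * simplex X => extend a y.1 * extend b y.2)
                (nabla o k x).
Arguments cup {X} o k {p q} r a b.

(* a cup_{deg a - i} a, for a of degree m - 1. *)
Definition steenrod_cochain (X : burnside_sset) (o : ordering X) (i m : nat)
    (a : cochain 'F_2 X m) : cochain 'F_2 X (m + i)%N :=
  cup o (m%:Z - 1 - i%:Z) (m + i)%N a a.
Arguments steenrod_cochain {X} o i {m} a.

(* sq^i, computed on a chosen representative.  The default 0 of insubd is only
   there for typing: the coboundary formula for the products cup_i makes the
   cochain a cocycle, whose class does not depend on the representative. *)
Definition sq (X : burnside_sset) (o : ordering X) (i m : nat)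
    (c : cohomology 'F_2 X m) : cohomology 'F_2 X (m + i)%N :=
  cohom_class (insubd 0 (steenrod_cochain o i (val (repr c)))).
Arguments sq {X} o i {m} c.

(* Main.v *)
Require Import Defs.
From HB Require Import structures.
From mathcomp Require Import all_boot all_algebra.
From mathcomp Require Import finmap zify.
From mathcomp Require Import boolp classical_sets functions cardinality fsbigop.
From mathcomp Require Import freeg.

Set Implicit Arguments.
Unset Strict Implicit.
Unset Printing Implicit Defensive.

Import GRing.Theory.
Local Open Scope fset_scope.
Local Open Scope ring_scope.

(** The theorem rests on the coboundary formula

      d(a cup_k b) = da cup_k b + a cup_k db + a cup_(k-1) b + b cup_(k-1) a

    for the products of any ordered object (coboundary_cup).  It makes
    a cup_k a a cocycle when a is one, and it makes the class of a cup_k a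
    depend only on the class of a (steenrod_cocycle, steenrod_class).

    Naturality follows formally by applying the formula to the mapping cone of
    f : X -> Y.  This is a Burnside object with the simplices of Y and, for each
    simplex x of X, a simplex of one dimension more, with a last vertex added,
    the apex: removing vertices of x only is what it is in X, and removing the
    apex as well is what the composites of f with the faces of X do.  Let a be a
    cocycle of Y, extended by zero to the cone.  Then da is f^* a, carried by
    the simplices of X, and the formula for a cup_k a and for a cup_(k+1) da
    gives

      d(a cup_k a + a cup_(k+1) da) = da cup_(k+1) da.

    On a simplex of X, the left-hand side is f^*(a cup_k a) plus a coboundary of
    X, and the right-hand side is f^* a cup_k f^* a: the shift of k makes up for
    the apex, and reversing the order of X in the cone makes up for the change
    of parity of the dimension.  The order on the faces through the apex is
    arbitrary, so f and the orders need not be related; the independence of the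
    order is the case where f is the identity.

    The formula is proved in a setting that covers objects and cones and that
    has no dependent types.  The elements of all the spans are the morphisms of
    a category whose objects are the simplices; a morphism is labelled by the
    set of vertices that it removes, and the bijections mu say that it factors
    uniquely through any subset of its label (ufcat).  In such a category the
    formula can be checked for one pair of morphisms s and t out of the same
    simplex at a time, comparing the coefficients of tgt s (x) tgt t
    (coef_boundary).  Two facts enter.  The first is about the sequences with
    repetitions, that is, the admissible pairs of labels: removing a vertex from
    one of the labels in all ways telescopes (admissible_remove).  The second is
    a recursion modulo 2 for the number of chains of positive good pairs
    (chains_complement); its terms are the products of index k - 1, the
    boundaries of the two factors, and the boundary of the simplex. *)

(** * Sums modulo 2 over finite sets of natural numbers *)

Lemma F2_addxx (x : 'F_2) : x + x = 0.
Proof. by case: x => [[|[|//]] ?]; apply/val_inj. Qed.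

Lemma F2_add_eq0 (x y : 'F_2) : x = y -> x + y = 0.
Proof. by move->; exact: F2_addxx. Qed.

Lemma F2_negb (b : bool) : (~~ b)%:R = 1 + b%:R :> 'F_2.
Proof. by case: b; apply/val_inj. Qed.

Lemma F2_if_and (a b : bool) (x : 'F_2) :
  (if a && b then x else 0) = b%:R * (a%:R * x).
Proof. by case: a; case: b; rewrite ?mul1r ?mul0r ?mulr0. Qed.

Section FsetSums.
Variable K : choiceType.
Implicit Types (A B D P : {fset K}) (v w : K).

Lemma big_fset_cond (T : nmodType) A B (Q : pred K) (F : K -> T) :
  (forall x, (x \in B) = (x \in A) && Q x) ->
  \sum_(x <- B) F x = \sum_(x <- A | Q x) F x.
Proof.
move=> h; rewrite -[RHS]big_filter; apply/perm_big/uniq_perm.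
- exact: fset_uniq.
- by rewrite filter_uniq // fset_uniq.
- by move=> x; rewrite mem_filter andbC h.
Qed.

Lemma big_fpowersetD1 (T : nmodType) D v (F : {fset K} -> T) : v \in D ->
  \sum_(P <- fpowerset D) F P =
  \sum_(P <- fpowerset (D `\ v)) (F P + F (v |` P)).
Proof.
move=> vD; rewrite big_split /= -(big_map (fun P => v |` P) xpredT F) -big_cat.
apply/perm_big/uniq_perm; first exact: fset_uniq.
  rewrite cat_uniq fset_uniq /=; apply/andP; split.
    apply/hasPn => _ /mapP[P _ ->]; apply/negP => /=.
    rewrite fpowersetE => /fsubsetP/(_ v); rewrite !inE eqxx => h.
    by have := h isT.
  rewrite map_inj_in_uniq ?fset_uniq // => P Q.
  rewrite !fpowersetE => /fsubsetP hP /fsubsetP hQ e.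
  apply/fsetP => x; have := congr1 (fun X => x \in X) e; rewrite !inE.
  case: eqP => // -> _.
  have /negbTE -> : v \notin P by apply/negP => /hP; rewrite !inE eqxx.
  by have /negbTE -> : v \notin Q by apply/negP => /hQ; rewrite !inE eqxx.
move=> P; rewrite mem_cat; apply/idP/orP.
  rewrite fpowersetE => /fsubsetP hP; case: (boolP (v \in P)) => vP.
    right; apply/mapP; exists (P `\ v).
      by rewrite fpowersetE; apply/fsubsetP => x; rewrite !inE => /andP[->] /hP.
    by rewrite fsetD1K.
  left; rewrite fpowersetE; apply/fsubsetP => x xP; rewrite !inE hP // andbT.
  by apply: contraNneq vP => <-.
case=> [|/mapP[Q]]; rewrite !fpowersetE; first by move/fsubset_trans; apply;
  apply: fsubD1set.
move=> /fsubset_trans hQ ->; rewrite fsubUset fsub1set vD /=.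
by apply: hQ; apply: fsubD1set.
Qed.

End FsetSums.

(** The symmetry pairs off the terms: this is the source of nearly all the
    cancellations below. *)
Lemma sum_symmetric (S : {fset nat}) (F : nat -> nat -> 'F_2) :
  (forall v w, v \in S -> w \in S -> v != w -> F v w = F w v) ->
  \sum_(v <- S) \sum_(w <- S `\ v) F v w = 0.
Proof.
move=> symF.
have -> : \sum_(v <- S) \sum_(w <- S `\ v) F v w =
    \sum_(v <- S) \sum_(w <- S | (w < v)%N) F v w +
    \sum_(v <- S) \sum_(w <- S | (v < w)%N) F v w.
  rewrite -big_split; apply: eq_bigr => v _ /=.
  rewrite (big_fset_cond (A := S) (Q := fun w => w != v)); last first.
    by move=> x; rewrite !inE andbC.
  rewrite (bigID (fun w => (w < v)%N)) /=; congr (_ + _); apply: eq_bigl => w;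
  by case: ltngtP.
rewrite [X in _ + X](exchange_big_dep xpredT) //=; apply: F2_add_eq0.
apply: eq_big_seq => v vS; rewrite big_seq_cond [RHS]big_seq_cond.
by apply: eq_bigr => w /andP[wS wv]; apply: symF => //; rewrite neq_ltn wv orbT.
Qed.

(** * Counting chains of good pairs *)

Section Chains.
Implicit Types (D P C : {fset nat}) (E : {fset nat} -> bool)
  (p q : {fset nat} -> {fset nat} -> bool) (phi : {fset nat} -> {fset nat} -> 'F_2).

(** The pairs (P \ v, v + C) are the successors of the pair (P, C) for the
    relation between the consecutive members of a chain, whether or not v is
    in P. *)
Definition moves D phi P C : 'F_2 := \sum_(v <- D `\` C) phi (P `\ v) (v |` C).

(** The number modulo 2 of sequences of j + 1 pairs that start with (P, C), move
    inside D, satisfy p until the last one and q there.  The separate condition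
    q is needed when only the last pair is released from being positive. *)
Fixpoint walks p q D j P C : 'F_2 :=
  if j is j'.+1 then (p P C)%:R * moves D (walks p q D j') P C else (q P C)%:R.

(** A chain of #|D| good pairs adds one element of D at a time to the second
    component, which cannot be empty: so it starts with a singleton. *)
Definition starts D phi : 'F_2 :=
  \sum_(P <- fpowerset D) \sum_(w <- D) phi P [fset w].

Definition chains p D : 'F_2 :=
  if #|` D| is r.+1 then starts D (walks p p D r) else 1.

(** E P stands for the agreement of the two elements on P.  Given that, they
    differ on C after P exactly when they do not agree on the union. *)
Definition good E D P C : bool :=
  [&& fdisjoint P C, P `|` C `<=` D, E P & ~~ E (P `|` C)].

Lemma eq_moves D phi psi P C : (forall v, v \in D -> v \notin C ->
  phi (P `\ v) (v |` C) = psi (P `\ v) (v |` C)) ->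
  moves D phi P C = moves D psi P C.
Proof.
by move=> h; apply: eq_big_seq => v; rewrite !inE => /andP[vC vD]; exact: h.
Qed.

Lemma eq_walks p p' q q' D j P C :
  (forall P' C', P' `<=` P -> P' `|` C' `<=` D -> p P' C' = p' P' C') ->
  (forall P' C', P' `<=` P -> P' `|` C' `<=` D -> q P' C' = q' P' C') ->
  P `|` C `<=` D ->
  walks p q D j P C = walks p' q' D j P C.
Proof.
elim: j P C => [|j IH] P C hp hq hPC /=; first by rewrite hq.
rewrite hp //; congr (_ * _); apply: eq_moves => v vD vC.
have sPv : P `\ v `<=` P by apply: fsubD1set.
apply: IH => [P' C' s|P' C' s|]; first by apply: hp; apply: fsubset_trans sPv.
  by apply: hq; apply: fsubset_trans sPv.
move: hPC; rewrite !fsubUset fsub1set vD /= => /andP[h ->]; rewrite andbT.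
exact: fsubset_trans h.
Qed.

Lemma eq_chains p p' D :
  (forall P C, P `|` C `<=` D -> p P C = p' P C) -> chains p D = chains p' D.
Proof.
move=> h; rewrite /chains; case: #|` D| => // r.
rewrite /starts; apply: eq_big_seq => P; rewrite fpowersetE => sP.
apply: eq_big_seq => w wD; apply: eq_walks => [*|*|]; [exact: h|exact: h|].
by rewrite fsubUset sP fsub1set.
Qed.

Section Complement.
Variables (E : {fset nat} -> bool) (D : {fset nat}).
Variables (p n : {fset nat} -> {fset nat} -> bool).
Hypothesis E0 : E fset0.
Hypothesis E_down : forall P Q, P `<=` Q -> Q `<=` D -> E Q -> E P.
Hypothesis p_good : forall P C, p P C -> good E D P C.
Hypothesis nE : forall P C, n P C = good E D P C && ~~ p P C.

Let g := good E D.

Let supp phi := forall P C, phi P C = (g P C)%:R * phi P C.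

(** Since E is closed under subsets, an intermediate pair is good as soon as the
    two pairs around it are.  So in a chain of good pairs, a missing inner
    member can be filled in exactly two ways. *)
Lemma good_between P C v w : g P C -> g (P `\ v `\ w) (w |` (v |` C)) ->
  v \in D -> g (P `\ v) (v |` C).
Proof.
move=> /and4P[dPC sPC EP nE1] /and4P[_ s2 E2 nE2] vD; apply/and4P; split.
- rewrite fdisjointXU (fdisjointWl (fsubD1set _ _) dPC) andbT fdisjointX1.
  by rewrite !inE eqxx.
- move: sPC; rewrite !fsubUset fsub1set vD /= => /andP[sP ->]; rewrite andbT.
  exact: fsubset_trans (fsubD1set _ _) sP.
- apply: E_down EP; first exact: fsubD1set.
  by move: sPC; rewrite fsubUset => /andP[].
apply: contra nE1; apply: E_down.
  apply/fsubsetP => x; rewrite !inE; by case: eqP => _; rewrite ?orbT.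
move: sPC; rewrite !fsubUset fsub1set vD /= => /andP[sP ->]; rewrite andbT.
exact: fsubset_trans (fsubD1set _ _) sP.
Qed.

(** The two ways to fill in a missing inner member cancel. *)
Lemma moves2_eq0 phi P C : supp phi -> g P C ->
  moves D (fun P' C' => (g P' C')%:R * moves D phi P' C') P C = 0.
Proof.
move=> sphi gPC.
rewrite -[RHS](sum_symmetric (S := D `\` C)
  (F := fun v w => phi (P `\ v `\ w) (w |` (v |` C)))).
  apply: eq_big_seq => v; rewrite inE => /andP[vC vD].
  rewrite /moves mulr_sumr.
  have -> : D `\` (v |` C) = D `\` C `\ v.
    by apply/fsetP => x; rewrite !inE negb_or andbA.
  apply: eq_big_seq => w; rewrite !inE => /and3P[wv wC wD].
  rewrite sphi; case: (boolP (g (P `\ v `\ w) _)) => [gW|]; last first.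
    by rewrite !mul0r mulr0.
  by rewrite (good_between gPC gW vD) mul1r.
move=> v w _ _ _; congr phi; apply/fsetP => x; rewrite !inE;
  by [rewrite andbCA|rewrite orbCA].
Qed.

(** A missing first member can also be filled in an even number of ways.  Let
    (P, {v, w}) be good; its good predecessors are (P, {w}) unless E (P + w),
    (P + v, {w}) if E (P + v), and the same with v and w exchanged. *)
Lemma starts_moves_eq0 phi : supp phi ->
  starts D (fun P C => (g P C)%:R * moves D phi P C) = 0.
Proof.
move=> sphi.
rewrite /starts exchange_big /=.
rewrite -[RHS](sum_symmetric (S := D)
  (F := fun w v => \sum_(P <- fpowerset (D `\ v))
    ((g P [fset w])%:R + (g (v |` P) [fset w])%:R) * phi P (v |` [fset w]))).
  apply: eq_big_seq => w wD; rewrite /moves.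
  under eq_bigr do rewrite mulr_sumr.
  rewrite exchange_big /=; apply: eq_big_seq => v; rewrite !inE => /andP[vw vD].
  rewrite (big_fpowersetD1 _ vD); apply: eq_big_seq => P.
  rewrite fpowersetE => /fsubsetP sP.
  have vP : v \notin P by apply/negP => /sP; rewrite !inE eqxx.
  have -> : P `\ v = P by apply: mem_fsetD1.
  by rewrite fsetU1K // mulrDl.
move=> v w vD wD vw.
have key : forall v w, v \in D -> w \in D -> v != w ->
  \sum_(P <- fpowerset (D `\ v)) ((g P [fset w])%:R + (g (v |` P) [fset w])%:R)
     * phi P (v |` [fset w]) =
  \sum_(P <- fpowerset (D `\ v `\ w))
    (1 + (E (v |` P))%:R + (E (w |` P))%:R) * phi P (v |` [fset w]).
  move=> {vw wD vD w v} v w vD wD vw.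
  have wDv : w \in D `\ v by rewrite !inE eq_sym vw.
  rewrite (big_fpowersetD1 _ wDv); apply: eq_big_seq => P.
  rewrite fpowersetE => /fsubsetP sP.
  have [vP wP] : v \notin P /\ w \notin P.
    by split; apply/negP => /sP; rewrite !inE eqxx ?andbF.
  have sPD : P `<=` D by apply/fsubsetP => x /sP; rewrite !inE => /and3P[].
  have -> : phi (w |` P) (v |` [fset w]) = 0.
    rewrite sphi /g /good; case: fdisjointP => [/(_ w)|_]; last by rewrite mul0r.
    by rewrite !inE eqxx orbT => /(_ isT).
  rewrite mulr0 addr0.
  rewrite sphi; case: (boolP (g P (v |` _))) => [/and4P[_ _ EP nEPC]|_];
    last by rewrite mul0r !mulr0.
  congr (_ * _); rewrite /g /good.
  have -> : fdisjoint P [fset w] by rewrite fdisjointX1.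
  have -> : fdisjoint (v |` P) [fset w].
    by rewrite fdisjointX1 !inE negb_or eq_sym vw.
  rewrite !fsubUset sPD !fsub1set vD wD EP /=.
  have -> : (v |` P) `|` [fset w] = P `|` (v |` [fset w]).
    by apply/fsetP => x; rewrite !inE orbCA orbA.
  by rewrite nEPC andbT fsetUC F2_negb -addrA [X in _ + X]addrC addrA.
rewrite [LHS]key // 1?eq_sym // [RHS]key //.
have -> : D `\ w `\ v = D `\ v `\ w by apply/fsetP => x; rewrite !inE andbCA.
apply: eq_bigr => P _.
have -> : w |` [fset v] = v |` [fset w] by apply/fsetP => x; rewrite !inE orbC.
by congr (_ * _); rewrite -!addrA; congr (_ + _); exact: addrC.
Qed.

Lemma walks_supp j : supp (walks n n D j).
Proof.
move=> P C; have gn : (n P C)%:R = (g P C)%:R * (n P C)%:R :> 'F_2.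
  by rewrite nE /g; case: good; rewrite ?mul1r ?mul0r.
by case: j => [|j] /=; rewrite gn // !mulrA -expr2; case: (g P C);
  rewrite ?expr1n ?expr0n.
Qed.

Let rest j P C : 'F_2 :=
  if j is j'.+1 then (g P C)%:R * moves D (walks n n D j') P C else 0.

(** Expand the chains of negative pairs with n = p + g: the terms in which an
    inner member is only required to be good vanish, so that either none is
    released, or only the last one, or the first one (this is rest). *)
Lemma walks_split j P C :
  walks n n D j P C = walks p p D j P C + walks p g D j P C + rest j P C.
Proof.
have nF P' C' : (n P' C')%:R = (p P' C')%:R + (g P' C')%:R :> 'F_2.
  rewrite nE -/(g P' C'); have := @p_good P' C'; rewrite -/(g _ _).
  by case: (p _ _) => [-> //|_]; case: (g _ _) => //; apply/val_inj.
elim: j P C => [|j IH] P C /=; first by rewrite addr0 nF.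
rewrite {1}nF mulrDl; congr (_ + _).
rewrite -mulrDr; case: (boolP (p P C)) => [pPC|_]; last by rewrite !mul0r.
rewrite !mul1r -[RHS]addr0.
have : moves D (rest j) P C = 0.
  case: j {IH} => [|j]; first by apply: big1.
  exact: moves2_eq0 (walks_supp j) (p_good pPC).
move<-; rewrite /moves -!big_split /=; apply: eq_bigr => v _.
exact: IH.
Qed.

Lemma starts_split j :
  starts D (walks p p D j) + starts D (walks n n D j) = starts D (walks p g D j).
Proof.
have startsD phi psi : starts D phi + starts D psi =
    starts D (fun P C => phi P C + psi P C).
  by rewrite /starts -big_split /=; apply: eq_bigr => P _; rewrite -big_split.
rewrite startsD.
transitivity (starts D (fun P C => walks p g D j P C + rest j P C)).
  apply: eq_bigr => P _; apply: eq_bigr => w _.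
  by rewrite walks_split !addrA F2_addxx add0r.
rewrite -startsD -[RHS]addr0; congr (_ + _).
case: j => [|j]; first by apply: big1 => P _; apply: big1.
exact: starts_moves_eq0 (walks_supp j).
Qed.

Let link w P C := p (w |` P) C.

(** The positive chains with a free last member.  That member is forced, and is
    automatically good, so what is counted are chains that miss one element w
    of D: either w is in none of the sets P, or it stays in all of them and the
    chain lives in the link of w. *)
Lemma walks_last j P C : P `<=` D -> C `<=` D -> #|` D `\` C| = j.+1 ->
  walks p g D j.+1 P C =
  \sum_(w <- D `\` C)
    (if w \in P then walks (link w) (link w) (D `\ w) j (P `\ w) C
     else walks p p (D `\ w) j P C).
Proof.
elim: j P C => [|j IH] P C sP sC cardDC.
  have [u DCu] : exists u, D `\` C = [fset u] by apply/cardfs1P; rewrite cardDC.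
  rewrite /= /moves DCu !big_seq_fset1 /link.
  have -> : (if u \in P then (p (u |` (P `\ u)) C)%:R else (p P C)%:R) =
      (p P C)%:R :> 'F_2.
    by case: ifP => // uP; rewrite fsetD1K.
  case: (boolP (p P C)) => [pPC|_]; last by rewrite mul0r.
  have : g (P `\ u) (u |` C); last by move=> ->; rewrite mulr1.
  have /and4P[dPC sPC EP nEPC] := p_good pPC.
  have uDC : u \in D `\` C by rewrite DCu !inE.
  move: uDC; rewrite inE => /andP[uC uD].
  apply/and4P; split.
  - rewrite fdisjointXU (fdisjointWl (fsubD1set _ _) dPC) andbT fdisjointX1.
    by rewrite !inE eqxx.
  - rewrite !fsubUset fsub1set uD sC !andbT.
    exact: fsubset_trans (fsubD1set _ _) sP.
  - exact: E_down (fsubD1set _ _) sP EP.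
  apply: contra nEPC; apply: E_down.
    by apply/fsubsetP => x; rewrite !inE; case: (x == u); rewrite ?orbT.
  rewrite !fsubUset fsub1set uD sC !andbT.
  exact: fsubset_trans (fsubD1set _ _) sP.
have DCE v : D `\` (v |` C) = D `\` C `\ v.
  by apply/fsetP => x; rewrite !inE negb_or andbA.
have DCE' w : D `\ w `\` C = D `\` C `\ w.
  by apply/fsetP => x; rewrite !inE andbCA.
transitivity (\sum_(v <- D `\` C) \sum_(w <- D `\` C | w != v)
   (p P C)%:R * (if w \in P
    then walks (link w) (link w) (D `\ w) j (P `\ v `\ w) (v |` C)
    else walks p p (D `\ w) j (P `\ v) (v |` C))).
  rewrite -[LHS]/((p P C)%:R * moves D (walks p g D j.+1) P C) mulr_sumr;
    apply: eq_big_seq => v; rewrite inE => /andP[vC vD].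
  rewrite IH; first last.
  - rewrite DCE; apply/eqP; rewrite -eqSS -cardDC [X in _ == X](cardfsD1 v).
    by rewrite !inE vC vD.
  - by rewrite fsubUset fsub1set vD.
  - exact: fsubset_trans (fsubD1set _ _) sP.
  rewrite (big_fset_cond (A := D `\` C) (Q := fun w => w != v)); last first.
    by move=> x; rewrite DCE !inE andbC.
  by rewrite mulr_sumr; apply: eq_bigr => w wv; rewrite !inE wv.
rewrite (exchange_big_dep xpredT) //=; apply: eq_big_seq => w.
rewrite inE => /andP[wC wD].
rewrite -big_distrr /=; case: (boolP (w \in P)) => wP.
  rewrite /link fsetD1K // -/(link w); congr (_ * _); rewrite /moves DCE'.
  rewrite (big_fset_cond (A := D `\` C) (Q := fun v => v != w)); last first.
    by move=> x; rewrite !inE andbC.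
  apply: eq_big => v; first by rewrite eq_sym.
  move=> _; have -> : P `\ v `\ w = P `\ w `\ v by apply/fsetP => x; rewrite !inE andbCA.
  by [].
congr (_ * _); rewrite /moves DCE'.
rewrite (big_fset_cond (A := D `\` C) (Q := fun v => v != w)); last first.
  by move=> x; rewrite !inE andbC.
by apply: eq_bigl => v; rewrite eq_sym.
Qed.

(** The count of chains changes from the positive pairs to the negative ones by
    the counts over the facets D \ w and over the links of the w in E. *)
Lemma chains_complement :
  chains p D + chains n D =
  \sum_(w <- D) (chains p (D `\ w) + (E [fset w])%:R * chains (link w) (D `\ w)).
Proof.
case DE : #|` D| => [|[|r]].
- have -> : D = fset0 by apply/cardfs0_eq.
  by rewrite big_seq_fset0 /chains cardfs0 F2_addxx.
- have /cardfs1P[u Du] : #|` D| == 1%N by rewrite DE.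
  rewrite /chains DE starts_split Du big_seq_fset1 fsetDv cardfs0 mulr1.
  rewrite /starts (big_fpowersetD1 _ (v := u)) ?inE // fsetDv fpowerset0.
  rewrite big_seq_fset1 !big_seq_fset1 /= /g /good Du !fdisjointX1 !inE eqxx /=.
  by rewrite fset0U fsubset_refl E0 /= addr0 F2_negb.
rewrite {1 2}/chains DE starts_split.
transitivity (\sum_(P <- fpowerset D) \sum_(u <- D) \sum_(w <- D | w != u)
    (if w \in P then walks (link w) (link w) (D `\ w) r (P `\ w) [fset u]
     else walks p p (D `\ w) r P [fset u])).
  apply: eq_big_seq => P; rewrite fpowersetE => sP; apply: eq_big_seq => u uD.
  rewrite walks_last ?fsub1set //; last first.
    by apply/eqP; rewrite -eqSS -DE [X in _ == X](cardfsD1 u) uD.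
  by apply: big_fset_cond => x; rewrite !inE andbC.
under eq_bigr do rewrite (exchange_big_dep xpredT) //=.
rewrite exchange_big /=; apply: eq_big_seq => w wD.
have cw : #|` D `\ w| = r.+1.
  by apply/eqP; rewrite -eqSS -DE [X in _ == X](cardfsD1 w) wD.
rewrite /chains cw (big_fpowersetD1 _ wD) big_split /=.
have sE (F : nat -> 'F_2) : \sum_(u <- D | w != u) F u = \sum_(u <- D `\ w) F u.
  by apply/esym/big_fset_cond => x; rewrite !inE andbC eq_sym.
have wP P : P \in fpowerset (D `\ w) -> w \notin P.
  by rewrite fpowersetE => /fsubsetP s; apply/negP => /s; rewrite !inE eqxx.
congr (_ + _).
  by apply: eq_big_seq => P /wP/negbTE h; rewrite h sE.
transitivity (starts (D `\ w) (walks (link w) (link w) (D `\ w) r)).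
  by apply: eq_big_seq => P /wP h; rewrite !inE eqxx /= fsetU1K // sE.
case: (boolP (E [fset w])) => [_|nEw]; first by rewrite mul1r.
rewrite mul0r; apply: big1_seq => P /andP[_]; rewrite fpowersetE => sP.
apply: big1_seq => u _.
have h : link w P [fset u] = false.
  apply/negbTE/negP => /p_good /and4P[_ s Ew _]; case/negP: nEw.
  apply: E_down Ew; first by rewrite fsub1set !inE eqxx.
  by move: s; rewrite fsubUset => /andP[].
by case: r {DE cw} => [|r] /=; rewrite h ?mul0r.
Qed.

End Complement.
End Chains.

(** * Admissible pairs of vertex sets *)

Definition gap (U : {fset nat}) (u : nat) : nat :=
  count (fun v => v \notin U) (iota 0 u).

Definition symdiff (A B : {fset nat}) : {fset nat} := (A `\` B) `|` (B `\` A).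

(** In terms of the vertices outside both labels, the index of a non-repeated
    entry u is, up to parity, one more than the size of the gap below u. *)
Definition in_place (A B : {fset nat}) (u : nat) : bool :=
  (u \in A) == ~~ odd (gap (A `|` B) u).

(** The pairs (U^-, U^+) for U a sequence with repetitions; A and B meet in the
    repeated entries. *)
Definition admissible (A B : {fset nat}) : bool :=
  all (in_place A B) (symdiff A B).

Lemma eq_gap (U U' : {fset nat}) u : (forall v, (v < u)%N -> (v \in U) = (v \in U')) ->
  gap U u = gap U' u.
Proof. by move=> h; apply: eq_in_count => v; rewrite mem_iota => /h ->. Qed.

Lemma gap_remove (U : {fset nat}) j u : j \in U ->
  gap (U `\ j) u = (gap U u + (j < u))%N.
Proof.
move=> jU; rewrite /gap.
have -> : nat_of_bool (j < u)%N = count (pred1 j) (iota 0 u).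
  by rewrite count_uniq_mem ?iota_uniq // mem_iota.
rewrite -count_predUI [X in (_ = _ + X)%N](_ : _ = 0)%N ?addn0.
  by apply: eq_count => v; rewrite /= !inE negb_and negbK orbC.
apply/eqP; rewrite -leqn0 leqNgt -has_count; apply/hasPn => v _ /=.
by case: eqP => [->|]; rewrite ?jU ?andbF.
Qed.

(** An entry that stays in one of the two labels only is in place in exactly one
    of them. *)
Lemma admissible_remove_common (A B : {fset nat}) j : j \in A -> j \in B ->
  (admissible (A `\ j) B)%:R + (admissible A (B `\ j))%:R =
  (admissible A B)%:R :> 'F_2.
Proof.
move=> jA jB.
have gapl u : gap (A `\ j `|` B) u = gap (A `|` B) u.
  by apply: eq_gap => v _; rewrite !inE; case: eqP => // ->; rewrite jB !orbT.
have gapr u : gap (A `|` B `\ j) u = gap (A `|` B) u.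
  by apply: eq_gap => v _; rewrite !inE; case: eqP => // ->; rewrite jA.
have l : admissible (A `\ j) B = admissible A B && odd (gap (A `|` B) j).
  apply/allP/andP => [h|[/allP h oj] u].
    split; last first.
      by have := h j; rewrite /in_place /symdiff gapl !inE eqxx jB /= eq_sym eqbF_neg
        negbK; apply.
    apply/allP => u uS; have := h u; rewrite /in_place gapl !inE.
    case: eqP uS => [->|_]; first by rewrite /symdiff !inE jA jB.
    by rewrite /symdiff !inE /= => h1; apply.
  rewrite /symdiff /in_place gapl !inE; case: eqP => [-> _|_ uS] /=; first by rewrite oj.
  by apply: h; rewrite /symdiff !inE.
have r : admissible A (B `\ j) = admissible A B && ~~ odd (gap (A `|` B) j).
  apply/allP/andP => [h|[/allP h oj] u].
    split; last first.
      by have := h j; rewrite /in_place /symdiff gapr !inE eqxx jA /= => /(_ isT) /eqP <-.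
    apply/allP => u uS; have := h u; rewrite /in_place gapr !inE.
    case: eqP uS => [->|_]; first by rewrite /symdiff !inE jA jB.
    by rewrite /symdiff !inE /= => h1; apply.
  rewrite /symdiff /in_place gapr !inE; case: eqP => [-> _|_ uS] /=.
    by rewrite jA oj.
  by apply: h; rewrite /symdiff !inE.
rewrite l r; case: (admissible A B); case: (odd _); exact/val_inj.
Qed.

Lemma symdiffC A B : symdiff A B = symdiff B A.
Proof. by rewrite /symdiff fsetUC. Qed.

Lemma in_placeC (A B : {fset nat}) u : u \in symdiff A B ->
  in_place B A u = ~~ in_place A B u.
Proof.
rewrite /in_place fsetUC /symdiff !inE.
by case: (u \in A); case: (u \in B) => //=; case: odd.
Qed.

(** Removing j from both labels flips the status of the later vertices.  Hence
    the pair becomes admissible exactly when the other vertices are in place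
    below j and out of place above j.  The sum over j telescopes, and all the
    vertices are out of place for (A, B) exactly when (B, A) is admissible. *)
Lemma admissible_remove (A B : {fset nat}) :
  \sum_(j <- A `\` B) (admissible (A `\ j) B)%:R +
  \sum_(j <- B `\` A) (admissible A (B `\ j))%:R =
  (admissible A B)%:R + (admissible B A)%:R :> 'F_2.
Proof.
pose S := symdiff A B; pose ok := in_place A B.
pose T m := all (fun u => if (u < m)%N then ok u else ~~ ok u) S.
pose R m := all (fun u => if (u < m)%N then ok u else ~~ ok u) (S `\ m).
pose N := (\max_(u <- S) u).+1.
have leN u : u \in S -> (u < N)%N.
  by move=> uS; rewrite /N ltnS (big_fsetD1 u) //= leq_maxl.
have TN : T N = admissible A B.
  by apply: eq_in_all => u uS; rewrite leN.
have T0 : T 0%N = admissible B A.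
  rewrite /T /admissible symdiffC; apply: eq_in_all => u uS.
  by rewrite /= in_placeC.
have step m : (T m.+1)%:R - (T m)%:R = (m \in S)%:R * (R m)%:R :> 'F_2.
  have oppE (x : 'F_2) : - x = x.
    by apply/eqP; rewrite eq_sym -addr_eq0 F2_addxx.
  rewrite oppE; case: (boolP (m \in S)) => mS; last first.
    rewrite mul0r; apply: F2_add_eq0; congr (_%:R); congr nat_of_bool.
    apply: eq_in_all => u uS; rewrite ltnS leq_eqVlt; case: eqP => // um.
    by rewrite -um uS in mS.
  (* T depends on the threshold only through the vertex at it. *)
have split m' : T m' = (if (m < m')%N then ok m else ~~ ok m) &&
      all (fun u => if (u < m')%N then ok u else ~~ ok u) (S `\ m).
    apply/allP/andP => [h|[h1 /allP h2] u uS].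
      by split; [exact: h|apply/allP => u; rewrite inE => /andP[_]; exact: h].
    have [->|um] := eqVneq u m; first exact: h1.
    by apply: h2; rewrite in_fsetD1 um.
  rewrite !split leqnn ltnn.
  rewrite (_ : all _ (S `\ m) = R m); last first.
    apply: eq_in_all => u; rewrite !inE => /andP[um _].
    by rewrite ltnS leq_eqVlt (negbTE um).
  rewrite -/(R m) mul1r; case: (ok m); rewrite /= ?addr0 ?add0r //.
rewrite -TN -T0 -[RHS](_ : (T N)%:R - (T 0%N)%:R = _); last first.
  by congr (_ + _); apply/eqP; rewrite eq_sym -addr_eq0 F2_addxx.
rewrite -(telescope_sumr (fun m => (T m)%:R) (leq0n N)).
under [RHS]eq_bigr do rewrite step.
transitivity (\sum_(j <- S) (R j)%:R : 'F_2).
  have -> : \sum_(j <- S) (R j)%:R =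
      \sum_(j <- A `\` B) (R j)%:R + \sum_(j <- B `\` A) (R j)%:R :> 'F_2.
    rewrite (bigID (fun j => j \in A)) /=; congr (_ + _);
    by apply/esym/big_fset_cond => j; rewrite /S /symdiff !inE; case: (j \in A);
      case: (j \in B).
  congr (_ + _); apply: eq_big_seq => j; rewrite inE => /andP[j1 j2]; congr (_%:R);
    congr nat_of_bool.
  - rewrite /R /admissible.
    have -> : symdiff (A `\ j) B = S `\ j.
      apply/fsetP => u; rewrite /S /symdiff !inE; case: eqP => // ->.
      by rewrite (negbTE j1).
    apply: eq_in_all => u; rewrite !inE => /andP[uj _]; rewrite /ok /in_place.
    have -> : A `\ j `|` B = (A `|` B) `\ j.
      by apply/fsetP => v; rewrite !inE; case: eqP => // ->; rewrite (negbTE j1).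
    rewrite gap_remove ?inE ?j2 // oddD uj /=.
    by case: ltngtP uj => // _ _; case: odd; case: (u \in A).
  - rewrite /R /admissible.
    have -> : symdiff A (B `\ j) = S `\ j.
      apply/fsetP => u; rewrite /S /symdiff !inE; case: eqP => // ->.
      by rewrite (negbTE j1).
    apply: eq_in_all => u; rewrite !inE => /andP[uj _]; rewrite /ok /in_place.
    have -> : A `|` B `\ j = (A `|` B) `\ j.
      by apply/fsetP => v; rewrite !inE; case: eqP => // ->; rewrite (negbTE j1).
    rewrite gap_remove ?inE ?j2 ?orbT // oddD /=.
    by case: ltngtP uj => // _ _; case: odd; case: (u \in A).
have -> : \sum_(j <- S) (R j)%:R = \sum_(0 <= j < N | j \in S) (R j)%:R :> 'F_2.
  rewrite -[RHS]big_filter; apply/perm_big/uniq_perm; first exact: fset_uniq.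
    by rewrite filter_uniq // iota_uniq.
  move=> j; rewrite mem_filter mem_index_iota /=.
  by case: (boolP (j \in S)) => //= /leN ->.
rewrite big_mkcond; apply: eq_bigr => j _.
by case: ifP => _; rewrite ?mul1r ?mul0r.
Qed.

(** * Chains under relabelling *)

Section Relabel.
Variables (h : nat -> nat) (inj_h : injective h).

Let imD (A B : {fset nat}) : h @` A `\` h @` B = h @` (A `\` B).
Proof.
apply/fsetP => x; rewrite inE; apply/andP/imfsetP => [[xB /imfsetP[y /= yA e]]|[y /=]].
  exists y => //=; rewrite inE yA andbT; apply: contra xB => yB.
  by apply/imfsetP; exists y.
rewrite inE => /andP[yB yA] ->; split; last by apply/imfsetP; exists y.
by apply: contra yB => /imfsetP[z /= zB /inj_h ->].
Qed.

Lemma walks_image p q p' q' (D P C : {fset nat}) j :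
  (forall P C, P `|` C `<=` D -> p (h @` P) (h @` C) = p' P C) ->
  (forall P C, P `|` C `<=` D -> q (h @` P) (h @` C) = q' P C) ->
  P `|` C `<=` D ->
  walks p q (h @` D) j (h @` P) (h @` C) = walks p' q' D j P C.
Proof.
move=> hp hq; elim: j P C => [|j IH] P C sPC /=; first by rewrite hq.
rewrite hp //; congr (_ * _); rewrite /moves imD big_imfset /=; last first.
  by move=> ? ? _ _ /inj_h.
apply: eq_big_seq => v; rewrite inE => /andP[vC vD].
have -> : h @` P `\ h v = h @` (P `\ v) by rewrite -imD imfset_fset1.
have -> : h v |` h @` C = h @` (v |` C) by rewrite imfsetU imfset_fset1.
apply: IH; move: sPC; rewrite !fsubUset fsub1set vD /= => /andP[s ->].
by rewrite andbT; apply: fsubset_trans s; apply: fsubD1set.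
Qed.

Lemma chains_image p p' (D : {fset nat}) :
  (forall P C, P `|` C `<=` D -> p (h @` P) (h @` C) = p' P C) ->
  chains p (h @` D) = chains p' D.
Proof.
move=> hp; rewrite /chains card_imfset //; case: #|` D| => // r.
rewrite /starts.
have -> : fpowerset (h @` D) = (fun P : {fset nat} => h @` P) @` fpowerset D.
  apply/fsetP => P; rewrite fpowersetE.
  apply/fsubsetP/imfsetP => [sP|[Q /=]]; last first.
    rewrite fpowersetE => /fsubsetP sQ -> _ /imfsetP[x /= xQ ->].
    by apply/imfsetP; exists x => //=; apply: sQ.
  exists [fset x in D | h x \in P] => /=.
    by rewrite fpowersetE; apply/fsubsetP => x; rewrite !inE => /andP[].
  apply/fsetP => x; apply/idP/imfsetP => [xP|[y /=]];
    last by rewrite !inE => /andP[_ ? ->].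
  by have /imfsetP[y /= yD xy] := sP _ xP; exists y => //=; rewrite !inE yD -xy.
rewrite big_imfset /=; last first.
  move=> P Q _ _ e; apply/fsetP => x.
  have := congr1 (fun X : {fset nat} => h x \in X) e.
  by rewrite !mem_imfset.
apply: eq_big_seq => P; rewrite fpowersetE => sP.
rewrite big_imfset /=; last by move=> ? ? _ _ /inj_h.
apply: eq_big_seq => w wD; rewrite -imfset_fset1; apply: walks_image => //.
by rewrite fsubUset sP fsub1set.
Qed.

End Relabel.

(** * Categories with unique factorisations *)

(** The renumbering of the vertices that defines psi, on natural numbers. *)
Definition squeeze (V : {fset nat}) (u : nat) : nat :=
  (u - #|` [fset v in V | (v < u)%N]|)%N.

Lemma squeeze1 (i u : nat) : squeeze [fset i] u = (u - (i < u))%N.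
Proof.
congr (_ - _)%N.
have -> : [fset v in [fset i] | (v < u)%N] = if (i < u)%N then [fset i] else fset0.
  apply/fsetP => v; case: ifP => iu; rewrite !inE /=.
    by case: eqP => // ->.
  by case: eqP => // ->.
by case: ifP => _; rewrite ?cardfs1 ?cardfs0.
Qed.

Lemma bump_squeeze (i u : nat) : u != i -> bump i (squeeze [fset i] u) = u.
Proof. by rewrite squeeze1 /bump; lia. Qed.

Lemma squeeze_bump i u : squeeze [fset i] (bump i u) = u.
Proof. by rewrite squeeze1 /bump; lia. Qed.

Lemma bump_inj i : injective (bump i).
Proof. exact: can_inj (squeeze_bump i). Qed.


(** * Removing a common vertex *)

Lemma gapS (U : {fset nat}) u : gap U u.+1 = (gap U u + (u \notin U))%N.
Proof. by rewrite /gap -addn1 iotaD count_cat /= addn0 add0n. Qed.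

Lemma mem_bump i (U : {fset nat}) u : (bump i u \in i |` bump i @` U) = (u \in U).
Proof.
rewrite !inE mem_imfset /=; last exact: bump_inj.
by rewrite eq_sym (negbTE (neq_bump _ _)).
Qed.

Lemma gap_bump i (U : {fset nat}) u : gap (i |` bump i @` U) (bump i u) = gap U u.
Proof.
elim: u => [|u IH]; last first.
  rewrite gapS -IH -[in RHS](mem_bump i); have [ui|ui|ui] := ltngtP u.+1 i.
  - rewrite /bump [(i <= u.+1)%N]leqNgt ui [(i <= u)%N]leqNgt (ltnW ui) !add0n.
    exact: gapS.
  - rewrite /bump (ltnW ui) -ltnS ui !add1n; exact: gapS.
  rewrite /bump ui leqnn -ui ltnn add0n add1n !gapS -addnA; congr (_ + _)%N.
  by rewrite !inE eqxx addn0.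
rewrite /bump; case: i => [|i] //=.
by rewrite /gap /= !inE eqxx.
Qed.

(** Repeated entries do not count in the gaps, and neither do absent ones, so
    removing a repeated entry altogether changes nothing. *)
Lemma admissible_bump i (A B : {fset nat}) :
  admissible (i |` bump i @` A) (i |` bump i @` B) = admissible A B.
Proof.
have U : (i |` bump i @` A) `|` (i |` bump i @` B) = i |` bump i @` (A `|` B).
  rewrite imfsetU; apply/fsetP => u; rewrite !in_fsetU in_fset1.
  by case: (u == i); rewrite ?orbT.
have place u : in_place (i |` bump i @` A) (i |` bump i @` B) (bump i u) = in_place A B u.
  by rewrite /in_place mem_bump U gap_bump.
apply/allP/allP => h u uS.
  rewrite -place; apply: h; move: uS.
  by rewrite /symdiff !in_fsetU !in_fsetD !mem_bump.
have ui : u != i by move: uS; rewrite /symdiff !inE; case: eqP.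
rewrite -(bump_squeeze ui) place; apply: h; move: uS.
by rewrite -{1}(bump_squeeze ui) /symdiff !in_fsetU !in_fsetD !mem_bump.
Qed.

(** Untyped form of a Burnside object: a category over the opposite of the
    augmented semi-simplex category with unique lifts of factorisations.  The
    morphisms removing the vertices lab s from src s have a first part, head P s,
    removing P, and a second part, tail P s.  Composition is only present
    through fact_inj and fact_ex; head and tail are constrained only for P
    included in lab s.  Only finitely many morphisms leave an object. *)
Record ufcat := UfCat {
  ob : eqType;
  mor : eqType;
  dim : ob -> nat;
  src : mor -> ob;
  tgt : mor -> ob;
  lab : mor -> {fset nat};
  out : ob -> seq mor;
  head : {fset nat} -> mor -> mor;
  tail : {fset nat} -> mor -> mor;
  lt : rel mor;
  out_uniq : forall x, uniq (out x);
  mem_out : forall x s, (s \in out x) = (src s == x);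
  dim_tgt : forall s, (dim (tgt s) + #|` lab s| = dim (src s))%N;
  head_src : forall P s, P `<=` lab s -> src (head P s) = src s;
  head_lab : forall P s, P `<=` lab s -> lab (head P s) = P;
  tail_src : forall P s, P `<=` lab s -> src (tail P s) = tgt (head P s);
  tail_tgt : forall P s, P `<=` lab s -> tgt (tail P s) = tgt s;
  tail_lab : forall P s, P `<=` lab s ->
    lab (tail P s) = [fset squeeze P u | u in lab s `\` P];
  fact_inj : forall P s t, P `<=` lab s -> P `<=` lab t ->
    head P s = head P t -> tail P s = tail P t -> s = t;
  fact_ex : forall u v, tgt u = src v -> exists s,
    [/\ lab u `<=` lab s, head (lab u) s = u & tail (lab u) s = v];
  head_head : forall P Q s, P `<=` Q -> Q `<=` lab s ->
    head P (head Q s) = head P s;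
  tail_head : forall P Q s, P `<=` Q -> Q `<=` lab s ->
    tail P (head Q s) = head [fset squeeze P u | u in Q `\` P] (tail P s);
  tail_tail : forall P Q s, P `<=` Q -> Q `<=` lab s ->
    tail [fset squeeze P u | u in Q `\` P] (tail P s) = tail Q s;
  lab0_eq : forall s t, src s = src t -> lab s = fset0 -> lab t = fset0 -> s = t;
  lt_total : forall s t, src s = src t -> lab s = lab t -> s != t ->
    lt s t = ~~ lt t s }.

Section Formula.
Variable F : ufcat.
Implicit Types (s t u e : mor F) (x y : ob F) (P C Q D : {fset nat}).

(** This is the element called lambda_(P, C)(s) in the definition of good
    pairs. *)
Definition mid P C s := tail P (head (P `|` C) s).

Definition agree s t P : bool := head P s == head P t.

Definition positive (b : bool) s t P C : bool :=
  good (agree s t) (lab s `&` lab t) P C &&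
  (if b then lt (mid P C s) (mid P C t) else lt (mid P C t) (mid P C s)).

Definition mult b s t : 'F_2 := chains (positive b s t) (lab s `&` lab t).

(** The coefficient of tgt s (x) tgt t in nabla_k.  Objects are graded by
    dim = degree + 1, hence the term 1. *)
Definition coef (k : int) s t : 'F_2 :=
  if admissible (lab s) (lab t) &&
     ((#|` lab s| + #|` lab t|)%:Z + k + 1 == (dim (src s))%:Z)
  then mult (odd (dim (src s) + #|` lab s| + #|` lab t|)) s t else 0.

Definition product k (phi chi : ob F -> 'F_2) x : 'F_2 :=
  \sum_(s <- out x) \sum_(t <- out x) coef k s t * phi (tgt s) * chi (tgt t).

Definition cobound (phi : ob F -> 'F_2) x : 'F_2 :=
  \sum_(e <- out x | #|` lab e| == 1%N) phi (tgt e).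

Lemma agree0 s t : src s = src t -> agree s t fset0.
Proof.
move=> st; apply/eqP/lab0_eq; rewrite ?head_lab ?fsub0set //.
by rewrite !head_src ?fsub0set.
Qed.

Lemma agree_down s t P Q : P `<=` Q -> Q `<=` lab s `&` lab t ->
  agree s t Q -> agree s t P.
Proof.
move=> PQ; rewrite fsubsetI => /andP[Qs Qt] /eqP e; apply/eqP.
by rewrite -(head_head PQ Qs) e head_head.
Qed.

(** Exactly one of two distinct elements is the smaller one, and the middle parts
    of s and t can be compared because they have the same source. *)
Lemma positiveN b s t P C : src s = src t ->
  positive (~~ b) s t P C =
  good (agree s t) (lab s `&` lab t) P C && ~~ positive b s t P C.
Proof.
move=> st; rewrite /positive.
case: (boolP (good _ _ _ _)) => //= /and4P[dPC].
rewrite fsubsetI => /andP[sPs sPt] /eqP eP neP.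
have PP : P `<=` P `|` C by apply: fsubsetUl.
have Ps := fsubset_trans PP sPs; have Pt := fsubset_trans PP sPt.
have Plab r : P `|` C `<=` lab r -> P `<=` lab (head (P `|` C) r).
  by move=> h; rewrite head_lab.
(* Equal middle parts would give equal cuts at the union, by fact_inj. *)
have nm : mid P C s != mid P C t.
  apply: contra neP => /eqP em; apply/eqP/(@fact_inj _ P); rewrite ?Plab //.
  by rewrite !head_head.
have sm : src (mid P C s) = src (mid P C t).
  by rewrite !tail_src ?Plab // !head_head // eP.
have lm : lab (mid P C s) = lab (mid P C t).
  by rewrite !tail_lab ?Plab // !head_lab.
have := lt_total sm lm nm.
by case: b => /= ->; rewrite ?negbK.
Qed.

Lemma good_of_positive b s t P C : positive b s t P C ->
  good (agree s t) (lab s `&` lab t) P C.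
Proof. by case/andP. Qed.

Lemma mult_swap b s t : mult b t s = mult (~~ b) s t.
Proof.
rewrite /mult fsetIC; apply: eq_chains => P C sPC.
rewrite /positive; congr (_ && _); last by case: b.
by rewrite /good fsetIC /agree eq_sym; congr [&& _, _, _ & ~~ _]; rewrite eq_sym.
Qed.

Lemma positive_headl b s t Q P C : Q `<=` lab s -> P `|` C `<=` Q `&` lab t ->
  positive b (head Q s) t P C = positive b s t P C.
Proof.
move=> Qs sPC; move: (sPC); rewrite fsubsetI => /andP[sQ sT].
have PQ : P `<=` Q by apply: fsubset_trans sQ; apply: fsubsetUl.
rewrite /positive /good /agree head_lab // /mid !head_head //.
congr [&& [&& _, _, _ & _] & _].
by rewrite sPC fsubsetI sT (fsubset_trans sQ Qs).
Qed.

(** Pairs of subsets of Q cannot tell s from its first part. *)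
Lemma mult_headl b s t Q : Q `<=` lab s ->
  mult b (head Q s) t = chains (positive b s t) (Q `&` lab t).
Proof.
move=> Qs; rewrite /mult head_lab //; apply: eq_chains => P C sPC.
exact: positive_headl.
Qed.

Lemma mult_headr b s t Q : Q `<=` lab t ->
  mult b s (head Q t) = chains (positive b s t) (lab s `&` Q).
Proof.
move=> Qt; rewrite -[b]negbK -mult_swap mult_headl // fsetIC negbK.
apply: eq_chains => P C sPC; rewrite /positive; congr (_ && _); last by case: b.
by rewrite /good fsetIC /agree eq_sym; congr [&& _, _, _ & ~~ _]; rewrite eq_sym.
Qed.

Lemma bump_squeeze_set i P : i \in P ->
  P = i |` (bump i @` [fset squeeze [fset i] u | u in P `\ i]).
Proof.
move=> iP; apply/fsetP => u; rewrite !inE; case: eqP => [->|/eqP ui]; first by rewrite iP.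
apply/idP/imfsetP => /= [uP|[v /= /imfsetP[w /=]]].
  exists (squeeze [fset i] u); last by rewrite bump_squeeze.
  by apply/imfsetP; exists u => //=; rewrite !inE ui.
by rewrite !inE => /andP[wi wP] -> ->; rewrite bump_squeeze.
Qed.

(** Unique factorisation: the morphisms out of tgt e are the second parts of the
    morphisms that start with e. *)
Lemma sum_tail e (G : mor F -> 'F_2) :
  \sum_(s' <- out (tgt e)) G s' =
  \sum_(s <- out (src e) | (lab e `<=` lab s) && (head (lab e) s == e))
    G (tail (lab e) s).
Proof.
rewrite -[RHS]big_filter -[RHS](big_map (tail (lab e)) xpredT G).
apply/perm_big/uniq_perm; first exact: out_uniq.
  rewrite map_inj_in_uniq ?filter_uniq ?out_uniq // => s t.
  rewrite !mem_filter => /andP[/andP[s1 /eqP s2] _] /andP[/andP[t1 /eqP t2] _].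
  by apply: fact_inj => //; rewrite s2 t2.
move=> s'; rewrite mem_out; apply/eqP/mapP => [s'e|[s]].
  have [s [s1 s2 s3]] := fact_ex (esym s'e); exists s => //.
  by rewrite mem_filter mem_out s1 s2 eqxx /= -[in X in _ == src X]s2 head_src.
rewrite mem_filter => /andP[/andP[s1 /eqP s2] _] ->.
by rewrite tail_src // s2.
Qed.

Lemma card_tail P s : P `<=` lab s -> (#|` lab (tail P s)| + #|` P| = #|` lab s|)%N.
Proof.
move=> Ps; have := dim_tgt (tail P s); have := dim_tgt (head P s).
by rewrite tail_tgt // tail_src // head_lab // head_src // -(dim_tgt s); lia.
Qed.

(** To take a face of the target of s' is to remove one more vertex: transposing,
    each s contributes to its first parts that leave out one vertex. *)
Lemma sum_cobound (H : mor F -> 'F_2) (phi : ob F -> 'F_2) x :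
  \sum_(s' <- out x) H s' * cobound phi (tgt s') =
  \sum_(s <- out x) (\sum_(v <- lab s) H (head (lab s `\ v) s)) * phi (tgt s).
Proof.
transitivity (\sum_(s' <- out x) \sum_(s <- out x |
   [&& lab s' `<=` lab s, head (lab s') s == s' & #|` lab s| == #|` lab s'|.+1])
   H s' * phi (tgt s)).
  apply: eq_big_seq => s'; rewrite mem_out => /eqP s'x.
  rewrite -big_distrr /=; congr (_ * _).
  rewrite /cobound big_mkcond /= sum_tail s'x -big_mkcondr /=; apply: eq_big => s.
    rewrite -andbA; case: (boolP (lab s' `<=` lab s)) => //= ss; congr (_ && _).
    by rewrite -(card_tail ss) -[_.+1 in RHS]add1n eqn_add2r.
  by move=> /andP[/andP[ss _] _]; rewrite tail_tgt.
rewrite (exchange_big_dep xpredT) //=; apply: eq_big_seq => s; rewrite mem_out => /eqP sx.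
rewrite -big_distrl /=; congr (_ * _).
rewrite -[LHS]big_filter -[RHS](big_map (fun v : nat => head (lab s `\ v) s) xpredT H).
apply/perm_big/uniq_perm; first by rewrite filter_uniq // out_uniq.
  rewrite map_inj_in_uniq ?fset_uniq // => v w vs ws e.
  have : lab s `\ v = lab s `\ w.
    by rewrite -(head_lab (fsubD1set _ _ : lab s `\ v `<=` _)) e head_lab // fsubD1set.
  by move/fsetP/(_ v); rewrite !inE eqxx vs andbT; case: eqP.
move=> s'; rewrite mem_filter mem_out; apply/andP/mapP => [[/and3P[ss /eqP hs /eqP c]
  _]|[v vs ->]].
  have : #|` lab s `\` lab s'| == 1%N by rewrite cardfsDS // c subSnn.
  move=> /cardfs1P[v hv]; exists v.
    have : v \in lab s `\` lab s' by rewrite hv !inE.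
    by rewrite inE => /andP[].
  rewrite -{1}hs; congr head; rewrite -hv fsetDDr fsetDv fset0U.
  by apply/esym/fsetIidPr.
have sv : lab s `\ v `<=` lab s by apply: fsubD1set.
rewrite head_src // head_lab // sx eqxx; split=> //.
by rewrite sv ?eqxx (cardfsD1 v (lab s)) vs /=.
Qed.

(** A pair of morphisms out of a face of x is a pair out of x whose labels share
    the vertex of that face and which agree there. *)
Lemma sum_link (H : mor F -> mor F -> 'F_2) x :
  \sum_(e <- out x | #|` lab e| == 1%N)
    \sum_(s' <- out (tgt e)) \sum_(t' <- out (tgt e)) H s' t' =
  \sum_(s <- out x) \sum_(t <- out x)
    \sum_(i <- lab s `&` lab t | agree s t [fset i])
       H (tail [fset i] s) (tail [fset i] t).
Proof.
pose over e s := (lab e `<=` lab s) && (head (lab e) s == e).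
transitivity (\sum_(e <- out x | #|` lab e| == 1%N)
    \sum_(s <- out x | over e s) \sum_(t <- out x | over e t)
      H (tail (lab e) s) (tail (lab e) t)).
  rewrite big_seq_cond [RHS]big_seq_cond; apply: eq_bigr => e.
  rewrite mem_out => /andP[/eqP ex _]; rewrite sum_tail ex.
  by apply: eq_bigr => s _; rewrite sum_tail ex.
rewrite (exchange_big_dep xpredT) //=; apply: eq_big_seq => s.
rewrite mem_out => /eqP sx.
rewrite (exchange_big_dep xpredT) //=; apply: eq_big_seq => t.
rewrite mem_out => /eqP tx.
rewrite -[LHS]big_filter -[RHS]big_filter.
rewrite (eq_big_seq (fun i : nat => H (tail (lab (head [fset i] s)) s)
    (tail (lab (head [fset i] s)) t))); last first.
  move=> i; rewrite mem_filter !inE => /and3P[_ is_ _].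
  by rewrite head_lab // fsub1set.
rewrite -[RHS](big_map (fun i : nat => head [fset i] s) xpredT
  (fun e => H (tail (lab e) s) (tail (lab e) t))).
apply/perm_big/uniq_perm; first by rewrite filter_uniq // out_uniq.
  rewrite map_inj_in_uniq ?filter_uniq ?fset_uniq // => i j.
  rewrite !mem_filter !inE => /and3P[_ i_s _] /and3P[_ js _] e.
  have : [fset i] = [fset j].
    have is_ : [fset i] `<=` lab s by rewrite fsub1set.
    by rewrite -(head_lab is_) e head_lab // fsub1set.
  by move/fsetP/(_ i); rewrite !inE eqxx; case: eqP.
move=> e; rewrite mem_filter mem_out; apply/andP/mapP => [[]|[i]].
  case/andP => /andP[/cardfs1P[i ei] /andP[]]; rewrite ei fsub1set => is_ /eqP es.
  case/andP; rewrite ei fsub1set => it /eqP et _; exists i => //.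
  by rewrite mem_filter /agree es et eqxx !inE is_ it.
rewrite mem_filter !inE => /and3P[/eqP st i_s it] ->.
have is_ : [fset i] `<=` lab s by rewrite fsub1set.
rewrite /over head_src // sx head_lab // !fsub1set i_s it st cardfs1 !eqxx.
by [].
Qed.

Section Link.
Variables (s t : mor F) (i : nat) (b : bool).
Hypotheses (src_st : src s = src t) (i_s : i \in lab s) (i_t : i \in lab t).
Hypothesis agree_i : agree s t [fset i].

Let ls := tail [fset i] s.
Let lt' := tail [fset i] t.
Let lift P := i |` bump i @` P.

Lemma lab_link u : i \in lab u -> lab u = lift (lab (tail [fset i] u)).
Proof.
move=> iu; rewrite tail_lab ?fsub1set //; exact: bump_squeeze_set.
Qed.

Lemma squeeze_lift P : [fset squeeze [fset i] u | u in lift P `\` [fset i]] = P.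
Proof.
apply/fsetP => v; apply/imfsetP/idP => /= [[u]|vP].
  rewrite /lift !inE; case: eqP => //= _ /imfsetP[w /= wP ->] ->.
  by rewrite squeeze_bump.
exists (bump i v); last by rewrite squeeze_bump.
by rewrite in_fsetD mem_bump vP andbT in_fset1 eq_sym neq_bump.
Qed.

Lemma liftS P Q : P `<=` Q -> lift P `<=` lift Q.
Proof. move=> /fsubsetP PQ; apply: fsetUS; apply/fsubsetP => _ /imfsetP[y /= /PQ yQ ->].
by apply/imfsetP; exists y. Qed.

Lemma lift_sub u P : i \in lab u -> P `<=` lab (tail [fset i] u) -> lift P `<=` lab u.
Proof. by move=> iu /liftS; rewrite -lab_link. Qed.

Lemma head_link u P : i \in lab u -> P `<=` lab (tail [fset i] u) ->
  head P (tail [fset i] u) = tail [fset i] (head (lift P) u).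
Proof.
move=> iu Pu; rewrite (tail_head (Q := lift P)) ?squeeze_lift //; last exact: lift_sub.
exact: fsubsetUl.
Qed.

Lemma agree_link P : P `<=` lab ls `&` lab lt' ->
  agree ls lt' P = agree s t (lift P).
Proof.
rewrite fsubsetI => /andP[Ps Pt]; rewrite /agree !head_link //.
have [sL tL] := (lift_sub i_s Ps, lift_sub i_t Pt).
have iL : [fset i] `<=` lift P by apply: fsubsetUl.
apply/eqP/eqP => [e|-> //]; apply: (@fact_inj _ [fset i]); rewrite ?head_lab //.
by rewrite !head_head //; exact/eqP.
Qed.

Lemma mid_link u P C : i \in lab u -> P `|` C `<=` lab (tail [fset i] u) ->
  mid P C (tail [fset i] u) = mid (lift P) (bump i @` C) u.
Proof.
move=> iu PCu; rewrite /mid head_link //.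
have -> : lift P `|` bump i @` C = lift (P `|` C) by rewrite /lift imfsetU fsetUA.
rewrite -{1}(squeeze_lift P) tail_tail //.
  exact: fsubsetUl.
by rewrite head_lab ?lift_sub //; apply: liftS; apply: fsubsetUl.
Qed.

(** The count of chains for the second parts of s and t after a common vertex i
    is the count over the link of i, after inserting i again. *)
Lemma mult_link :
  mult b ls lt' = chains (fun P C => positive b s t (i |` P) C) ((lab s `&` lab t) `\ i).
Proof.
have -> : (lab s `&` lab t) `\ i = bump i @` (lab ls `&` lab lt').
  apply/fsetP => u; rewrite in_fsetD1 in_fsetI.
  have [->|ui] /= := eqVneq u i.
    by apply/esym/imfsetP => -[v /= _ /eqP]; rewrite (negbTE (neq_bump _ _)).
  rewrite -(bump_squeeze ui) (lab_link i_s) (lab_link i_t) !mem_bump.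
  by rewrite mem_imfset ?in_fsetI //=; apply: bump_inj.
apply/esym/chains_image => [|P C PC]; first exact: bump_inj.
move: (PC); rewrite fsubsetI => /andP[PCs PCt].
have PPC : P `<=` P `|` C by apply: fsubsetUl.
rewrite -/(lift P) /positive -!mid_link // /good; congr (_ && _).
have -> : lift P `|` bump i @` C = lift (P `|` C) by rewrite /lift imfsetU fsetUA.
rewrite PC !agree_link ?(fsubset_trans PPC) //.
rewrite fsubsetI !lift_sub //=; congr (_ && _).
apply/fdisjointP/fdisjointP => h u.
  move=> uP; have := h (bump i u); rewrite mem_bump mem_imfset /=; last exact: bump_inj.
  exact.
rewrite in_fsetU in_fset1 => /orP[/eqP ->|/imfsetP[v /= vP ->]].
  by apply/imfsetP => -[w /= _ /eqP]; rewrite (negbTE (neq_bump _ _)).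
rewrite mem_imfset /=; [exact: h | exact: bump_inj].
Qed.

End Link.

(** The coboundary formula for the coefficients.  Removing an unrepeated vertex
    keeps the set of repeated entries, and the terms add up by
    admissible_remove; removing a repeated one from one of the labels, or from
    both, gives the right-hand side of chains_complement. *)
Lemma coef_boundary k s t : src s = src t ->
  \sum_(v <- lab s) coef k (head (lab s `\ v) s) t +
  \sum_(v <- lab t) coef k s (head (lab t `\ v) t) +
  \sum_(i <- lab s `&` lab t | agree s t [fset i])
    coef k (tail [fset i] s) (tail [fset i] t) =
  coef (k - 1) s t + coef (k - 1) t s.
Proof.
move=> st; set A := lab s; set B := lab t; set D := A `&` B.
pose right_size := ((#|` A| + #|` B|)%:Z + k == (dim (src s))%:Z).
pose b := odd (dim (src s) + #|` A| + #|` B|).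
pose adm A B : 'F_2 := (admissible A B)%:R.
(* Each of the three kinds of removal changes dim + #|A| + #|B| by an odd number,
     hence the ~~ b below. *)
have cl v : v \in A -> coef k (head (A `\ v) s) t =
    right_size%:R * (adm (A `\ v) B * mult (~~ b) (head (A `\ v) s) t).
  move=> vA; have sA : A `\ v `<=` lab s by apply: fsubD1set.
  rewrite /coef head_lab // head_src //.
  have cA : (#|` A| = #|` A `\ v|.+1)%N by rewrite (cardfsD1 v A) vA.
  have -> : ((#|` A `\ v| + #|` lab t|)%:Z + k + 1 == (dim (src s))%:Z) = right_size.
    by rewrite /right_size cA -/B; lia.
  have -> : odd (dim (src s) + #|` A `\ v| + #|` lab t|) = ~~ b.
    by rewrite /b cA -/B addnS addSn /= negbK.
  exact: F2_if_and.
have cr v : v \in B -> coef k s (head (B `\ v) t) =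
    right_size%:R * (adm A (B `\ v) * mult (~~ b) s (head (B `\ v) t)).
  move=> vB; have sB : B `\ v `<=` lab t by apply: fsubD1set.
  rewrite /coef head_lab //.
  have cB : (#|` B| = #|` B `\ v|.+1)%N by rewrite (cardfsD1 v B) vB.
  have -> : ((#|` lab s| + #|` B `\ v|)%:Z + k + 1 == (dim (src s))%:Z) = right_size.
    by rewrite /right_size cB -/A; lia.
  have -> : odd (dim (src s) + #|` lab s| + #|` B `\ v|) = ~~ b.
    by rewrite /b cB -/A addnS /= negbK.
  exact: F2_if_and.
have ci i : i \in D -> agree s t [fset i] -> coef k (tail [fset i] s) (tail [fset i] t) =
    right_size%:R * (adm A B * chains (fun P C => positive (~~ b) s t (i |` P) C) (D `\
      i)).
  rewrite inE => /andP[iA iB] sti; rewrite /coef.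
  have [is_ it] : [fset i] `<=` lab s /\ [fset i] `<=` lab t by rewrite !fsub1set.
  have := card_tail is_; have := card_tail it; rewrite -/A -/B cardfs1 => cB cA.
  have dA : dim (src s) = (dim (src (tail [fset i] s))).+1.
    by rewrite tail_src // -(head_src is_) -dim_tgt head_lab // cardfs1 addn1.
  rewrite (_ : _ == _ = right_size); last first.
    by rewrite /right_size -cA -cB dA; lia.
  rewrite (_ : odd _ = ~~ b); last first.
    by rewrite /b -cA -cB dA !(addn1, addnS, addSn) /= !negbK.
  rewrite mult_link // -/D /adm.
  have -> : admissible (lab (tail [fset i] s)) (lab (tail [fset i] t)) = admissible A B.
    by rewrite -(admissible_bump i) -!lab_link.
  exact: F2_if_and.
have c1 : coef (k - 1) s t = right_size%:R * (adm A B * mult b s t).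
  rewrite /coef -/A -/B -/b.
  have -> : ((#|` A| + #|` B|)%:Z + (k - 1) + 1 == (dim (src s))%:Z) = right_size.
    by rewrite /right_size; lia.
  exact: F2_if_and.
have c2 : coef (k - 1) t s = right_size%:R * (adm B A * mult (~~ b) s t).
  rewrite /coef -/A -/B -st.
  have -> : ((#|` B| + #|` A|)%:Z + (k - 1) + 1 == (dim (src s))%:Z) = right_size.
    by rewrite /right_size; lia.
  have -> : odd (dim (src s) + #|` B| + #|` A|) = b by rewrite /b addnAC.
  rewrite mult_swap.
  exact: F2_if_and.
rewrite c1 c2 -mulrDr (eq_big_seq _ cl) (eq_big_seq _ cr) -!big_distrr /=.
pose p := positive (~~ b) s t.
pose L i := chains (fun P C => p (i |` P) C) (D `\ i).
have -> : \sum_(i <- D | agree s t [fset i]) coef k (tail [fset i] s) (tail [fset i] t) =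
    right_size%:R * (adm A B * \sum_(i <- D) (agree s t [fset i])%:R * L i).
  rewrite big_mkcond !mulr_sumr; apply: eq_big_seq => i iD.
  by case: ifP => [/(ci _ iD) ->|_]; rewrite ?mul1r ?mul0r ?mulr0.
rewrite -!mulrDr; congr (_ * _).
have splitA (X Y : {fset nat}) (G : nat -> 'F_2) :
    \sum_(v <- X) G v = \sum_(v <- X `\` Y) G v + \sum_(v <- X `&` Y) G v.
  rewrite (bigID (fun v => v \notin Y)) /=; congr (_ + _);
  by apply/esym/big_fset_cond => v; rewrite !inE ?negbK // andbC.
have S1 : \sum_(v <- A) adm (A `\ v) B * mult (~~ b) (head (A `\ v) s) t =
    (\sum_(v <- A `\` B) adm (A `\ v) B) * chains p D +
    \sum_(v <- D) adm (A `\ v) B * chains p (D `\ v).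
  rewrite (splitA A B) mulr_suml; congr (_ + _); apply: eq_big_seq => v;
    rewrite inE => /andP[v1 v2];
    rewrite mult_headl ?fsubD1set //; congr (_ * chains _ _).
    apply/fsetP => u; rewrite !inE; case: eqP => // ->.
    by rewrite -/B (negbTE v1) !andbF.
  apply/fsetP => u; by rewrite /D !inE andbA.
have S2 : \sum_(v <- B) adm A (B `\ v) * mult (~~ b) s (head (B `\ v) t) =
    (\sum_(v <- B `\` A) adm A (B `\ v)) * chains p D +
    \sum_(v <- D) adm A (B `\ v) * chains p (D `\ v).
  rewrite (splitA B A) mulr_suml [in X in _ + X]fsetIC.
  congr (_ + _); apply: eq_big_seq => v; rewrite inE => /andP[v1 v2];
    rewrite mult_headr ?fsubD1set //; congr (_ * chains _ _).
    apply/fsetP => u; rewrite !inE; case: eqP => // ->.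
    by rewrite -/A (negbTE v1).
  by apply/fsetP => u; rewrite /D !inE andbCA.
have star : chains p D + mult b s t =
    \sum_(w <- D) (chains p (D `\ w) + (agree s t [fset w])%:R * L w).
  apply: (@chains_complement (agree s t) D p (positive b s t)).
  - exact: agree0.
  - by move=> P Q; apply: agree_down.
  - exact: good_of_positive.
  - by move=> P C; rewrite -[b in LHS]negbK positiveN.
have eS : \sum_(v <- D) adm (A `\ v) B * chains p (D `\ v) +
    \sum_(v <- D) adm A (B `\ v) * chains p (D `\ v) =
    adm A B * \sum_(v <- D) chains p (D `\ v).
  rewrite -big_split mulr_sumr; apply: eq_big_seq => v; rewrite inE => /andP[vA vB] /=.
  by rewrite -mulrDl admissible_remove_common.
rewrite S1 S2 addrACA -mulrDl admissible_remove eS -addrA -mulrDr -big_split /= -star.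
rewrite mulrDr mulrDl addrACA -/(adm A B) -/(adm B A) -/p.
by rewrite F2_addxx add0r addrC.
Qed.

(** The coefficients of coef_boundary, weighted by the values of phi and chi. *)
Theorem cobound_product k (phi chi : ob F -> 'F_2) x :
  cobound (product k phi chi) x =
  product k (cobound phi) chi x + product k phi (cobound chi) x +
  product (k - 1) phi chi x + product (k - 1) chi phi x.
Proof.
have e1 : product k (cobound phi) chi x = \sum_(s <- out x) \sum_(t <- out x)
    (\sum_(v <- lab s) coef k (head (lab s `\ v) s) t) * phi (tgt s) * chi (tgt t).
  rewrite /product exchange_big [RHS]exchange_big /=; apply: eq_bigr => t _.
  by rewrite -!mulr_suml sum_cobound.
have e2 : product k phi (cobound chi) x = \sum_(s <- out x) \sum_(t <- out x)
    (\sum_(v <- lab t) coef k s (head (lab t `\ v) t)) * phi (tgt s) * chi (tgt t).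
  apply: eq_bigr => s _; under eq_bigr do rewrite mulrAC.
  rewrite -mulr_suml mulrC; under [RHS]eq_bigr do rewrite mulrAC.
  by rewrite sum_cobound -mulr_suml mulrC.
have e3 : cobound (product k phi chi) x = \sum_(s <- out x) \sum_(t <- out x)
    (\sum_(i <- lab s `&` lab t | agree s t [fset i])
      coef k (tail [fset i] s) (tail [fset i] t)) * phi (tgt s) * chi (tgt t).
  rewrite /cobound /product.
  rewrite (sum_link (fun s t => coef k s t * phi (tgt s) * chi (tgt t))).
  apply: eq_bigr => s _; apply: eq_bigr => t _; rewrite !mulr_suml.
  rewrite big_seq_cond [RHS]big_seq_cond; apply: eq_bigr => i.
  by rewrite inE => /andP[/andP[i_s it] _]; rewrite !tail_tgt ?fsub1set.
have e4 : product (k - 1) chi phi x = \sum_(s <- out x) \sum_(t <- out x)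
    coef (k - 1) t s * phi (tgt s) * chi (tgt t).
  rewrite /product exchange_big; apply: eq_bigr => s _; apply: eq_bigr => t _.
  exact: mulrAC.
rewrite e1 e2 e3 e4.
have sumD (G H : mor F -> mor F -> 'F_2) :
    \sum_(s <- out x) \sum_(t <- out x) G s t * phi (tgt s) * chi (tgt t) +
    \sum_(s <- out x) \sum_(t <- out x) H s t * phi (tgt s) * chi (tgt t) =
    \sum_(s <- out x) \sum_(t <- out x) (G s t + H s t) * phi (tgt s) * chi (tgt t).
  rewrite -big_split; apply: eq_bigr => s _ /=; rewrite -big_split /=.
  by apply: eq_bigr => t _; rewrite !mulrDl.
rewrite !sumD; apply: eq_big_seq => s; rewrite mem_out => /eqP sx.
apply: eq_big_seq => t; rewrite mem_out => /eqP tx; congr (_ * _ * _).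
by rewrite -[RHS]addrA -coef_boundary ?sx ?tx // addrA F2_addxx add0r.
Qed.

End Formula.

(** * Subsets of an interval as finite sets of numbers *)

Section FaceSets.
Variable n : nat.
Implicit Types (A B : {set 'I_n}) (P : {fset nat}).

(** Sets of vertices of simplices of different dimensions become comparable once
    the bounds on the vertices are forgotten. *)
Definition nset A : {fset nat} := [fset val i | i in A].

Definition ordset P : {set 'I_n} := [set i | val i \in P]%SET.

Lemma mem_nset A (i : 'I_n) : (val i \in nset A) = (i \in A).
Proof. by rewrite mem_imfset //; apply: val_inj. Qed.

Lemma nset_bound A u : u \in nset A -> (u < n)%N.
Proof. by case/imfsetP => i _ ->; exact: ltn_ord. Qed.

Lemma ordset_nset A : ordset (nset A) = A.
Proof. by apply/setP => i; rewrite inE mem_nset. Qed.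

Lemma nset_ordset P : (forall u, u \in P -> (u < n)%N) -> nset (ordset P) = P.
Proof.
move=> h; apply/fsetP => u; apply/imfsetP/idP => [[i /=]|uP];
  first by rewrite inE => ? ->.
by exists (Ordinal (h _ uP)) => //=; rewrite inE.
Qed.

Lemma nset_inj : injective nset.
Proof. by move=> A B e; rewrite -(ordset_nset A) e ordset_nset. Qed.

Lemma nset_eqP A P : (forall i : 'I_n, (val i \in P) = (i \in A)) ->
  (forall u, u \in P -> (u < n)%N) -> nset A = P.
Proof.
move=> h hP; rewrite -(nset_ordset hP); congr nset; apply/setP => i.
by rewrite inE h.
Qed.

Lemma nsetU A B : nset (A :|: B)%SET = nset A `|` nset B.
Proof.
apply: nset_eqP => [i|u]; first by rewrite !inE !mem_nset.
by rewrite inE => /orP[] /nset_bound.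
Qed.

Lemma nsetI A B : nset (A :&: B)%SET = nset A `&` nset B.
Proof.
apply: nset_eqP => [i|u]; first by rewrite !inE !mem_nset.
by rewrite inE => /andP[/nset_bound].
Qed.

Lemma nsetD A B : nset (A :\: B)%SET = nset A `\` nset B.
Proof.
apply: nset_eqP => [i|u]; first by rewrite !inE !mem_nset.
by rewrite inE => /andP[_ /nset_bound].
Qed.

Lemma nsetS A B : (nset A `<=` nset B) = (A \subset B).
Proof.
apply/fsubsetP/fintype.subsetP => [h i|h u /imfsetP[i /= iA ->]].
  by rewrite -!mem_nset => /h.
by rewrite mem_nset h.
Qed.

Lemma nset_disjoint A B : fdisjoint (nset A) (nset B) = [disjoint A & B]%bool.
Proof.
rewrite /fdisjoint -nsetI -setI_eq0 -(inj_eq nset_inj).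
congr (_ == _); apply/fsetP => u; rewrite inE; apply/esym/imfsetP => -[i /=].
by rewrite inE.
Qed.

Lemma nset0 : nset finset.set0 = fset0.
Proof. by apply: nset_eqP => [i|u]; rewrite !inE. Qed.

Lemma nset1 (i : 'I_n) : nset [set i]%SET = [fset val i].
Proof. by apply: nset_eqP => [j|u]; rewrite !inE //= => /eqP ->. Qed.

Lemma card_nset A : #|` nset A| = #|A|.
Proof.
rewrite card_imfset /=; last exact: val_inj.
by rewrite cardE; apply/perm_size/uniq_perm; rewrite ?enum_uniq ?enum_finmem_uniq.
Qed.

Lemma nset_notin_n A : n \notin nset A.
Proof. by apply/negP => /nset_bound; rewrite ltnn. Qed.

End FaceSets.

(** What is left below u once V is removed is the gap below u; unlike squeeze,
    gap satisfies a simple recursion. *)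
Lemma squeeze_gap V u : squeeze V u = gap V u.
Proof.
rewrite /squeeze /gap; apply/eqP; rewrite -(eqn_add2r #|`[fset v in V | (v < u)%N]|).
have -> : #|`[fset v in V | (v < u)%N]| = count (mem V) (iota 0 u).
  rewrite -size_filter; apply/perm_size/uniq_perm; rewrite ?fset_uniq //.
    by rewrite filter_uniq // iota_uniq.
  by move=> v; rewrite mem_filter mem_iota !inE.
rewrite [X in _ == X]addnC (count_predC (mem V)) size_iota subnK //.
by rewrite -[X in (_ <= X)%N](size_iota 0 u) count_size.
Qed.

Lemma gap_mono V u w : (u <= w)%N -> (gap V u <= gap V w)%N.
Proof.
move=> /subnKC <-; elim: (w - u)%N => [|d IH]; first by rewrite addn0.
by rewrite addnS gapS (leq_trans IH) ?leq_addr.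
Qed.

Lemma gap_lt V u w : u \notin V -> (u < w)%N -> (gap V u < gap V w)%N.
Proof.
by move=> uV uw; apply: leq_trans (gap_mono V uw); rewrite gapS uV addn1.
Qed.

Lemma gap_inj V u w : u \notin V -> w \notin V -> gap V u = gap V w -> u = w.
Proof.
by move=> uV wV e; case: (ltngtP u w) => // [/(gap_lt uV)|/(gap_lt wV)]; rewrite e ltnn.
Qed.

Lemma mem_gap_image V A u : u \notin V -> fdisjoint V A ->
  (gap V u \in gap V @` A) = (u \in A).
Proof.
move=> uV /fdisjointP VA; apply/imfsetP/idP => [[w /= wA]|uA]; last by exists u.
by move/gap_inj => -> //; apply/negP => /VA; rewrite wA.
Qed.

(** This is psi_(psi_V(A)) o psi_V = psi_(V + A). *)
Lemma gap_gap V A u : fdisjoint V A ->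
  gap (gap V @` A) (gap V u) = gap (V `|` A) u.
Proof.
move=> VA; elim: u => [|u IH] //; rewrite [in RHS]gapS -IH [gap V u.+1]gapS.
have [uV|uV] := boolP (u \in V); first by rewrite inE uV !addn0.
by rewrite addn1 gapS mem_gap_image // inE (negbTE uV).
Qed.

Lemma gap_total (n k : nat) (V : face n k) : gap (nset V) n = k.
Proof.
have : (count (mem (nset V)) (iota 0 n) + gap (nset V) n)%N = n.
  by rewrite /gap (count_predC (mem (nset V))) size_iota.
have -> : count (mem (nset V)) (iota 0 n) = #|V|.
  rewrite -card_nset -size_filter; apply/perm_size/uniq_perm; rewrite ?fset_uniq //.
    by rewrite filter_uniq // iota_uniq.
  move=> v; rewrite mem_filter mem_iota /= add0n.
  by case: (boolP (v \in nset V)) => //= /nset_bound ->.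
have : (#|V| + k)%N = n by case: V => V /= /eqP.
by lia.
Qed.

Lemma squeeze_image (V A : {fset nat}) : [fset squeeze V u | u in A] = gap V @` A.
Proof.
by apply/fsetP => u; apply/imfsetP/imfsetP => -[w /= wA ->]; exists w => //=;
  rewrite squeeze_gap.
Qed.

Lemma nset_psi n k (V : face n k) (A : {set 'I_n}) : [disjoint V & A]%bool ->
  nset (psi k V A) = gap (nset V) @` nset A.
Proof.
move=> VA; have sq (u : 'I_n) : (u - #|[set v in V | (v < u)%N]%SET|)%N = gap (nset V) u.
  rewrite -squeeze_gap /squeeze -card_nset; congr (_ - #|` _|)%N.
  by apply: nset_eqP => [i|w]; rewrite !inE ?mem_nset // => /andP[/nset_bound].
apply: nset_eqP => [j|u /imfsetP[v /= /imfsetP[i /= iA ->] ->]]; last first.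
  rewrite -[X in (_ < X)%N](gap_total V); apply: gap_lt (ltn_ord i).
  by rewrite mem_nset; apply/negP => iV; move/pred0P: VA => /(_ i) /=; rewrite iV iA.
apply/imfsetP/idP => [[u /= /imfsetP[i /= iA ->] e]|].
  by rewrite inE; apply/existsP; exists i; rewrite iA /= sq e.
rewrite inE => /existsP[i /andP[iA /eqP e]]; exists (val i); first by rewrite mem_nset.
by rewrite -sq.
Qed.

(** With gap_inj, the renumbering is a bijection from the vertices outside V. *)
Lemma gap_onto V n j : (j < gap V n)%N -> exists u, [/\ u \notin V, (u < n)%N & gap V u
  = j].
Proof.
elim: n => // n IH; rewrite gapS; case: (boolP (n \in V)) => nV.
  by rewrite addn0 => /IH[u [uV un <-]]; exists u; rewrite ltnS ltnW.
rewrite addn1 ltnS leq_eqVlt => /orP[/eqP ->|/IH[u [uV un <-]]]; first by exists n.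
by exists u; rewrite ltnS ltnW.
Qed.

(** * Cutting faces *)

Lemma face_card n k (U : face n k) : (#|U| + k)%N = n.
Proof. by case: U => U /= /eqP. Qed.

Lemma face_inj n k (U U' : face n k) : nset U = nset U' -> U = U'.
Proof.
by case: U => U hU; case: U' => U' hU' /= /nset_inj e; subst U'; congr Face;
  exact: bool_irrelevance.
Qed.

Lemma face_levelE n k k' (U : face n k) (U' : face n k') : nset U = nset U' -> k = k'.
Proof. by move/nset_inj => e; have := face_card U; have := face_card U'; rewrite e;
  lia. Qed.

Lemma cutsP n k1 k2 (U : face n k2) (V1 : face n k1) V2 (W : face k1 k2) :
  cuts U V1 V2 W <->
  [/\ fdisjoint (nset V1) (nset V2), nset U = nset V1 `|` nset V2 &
      nset W = gap (nset V1) @` nset V2].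
Proof.
rewrite /cuts nset_disjoint; split=> [/and3P[d /eqP u /eqP w]|[d u w]].
  by rewrite -u -w nsetU nset_psi.
apply/and3P; split=> //; apply/eqP/nset_inj; first by rewrite nsetU.
by rewrite nset_psi.
Qed.

Lemma cuts_det n k1 k2 (U : face n k2) (V1 : face n k1) V2 V2' (W W' : face k1 k2) :
  cuts U V1 V2 W -> cuts U V1 V2' W' -> V2 = V2' /\ W = W'.
Proof.
move=> /cutsP[d u w] /cutsP[d' u' w'].
have e : V2 = V2'.
  apply: nset_inj; move: u; rewrite u' => /fsetP e; apply/fsetP => x; have := e x.
  rewrite !inE; case: (boolP (x \in nset V1)) => //= xV _.
  by rewrite (negbTE (fdisjointP d _ xV)) (negbTE (fdisjointP d' _ xV)).
by split=> //; apply: face_inj; rewrite w w' e.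
Qed.

Lemma cuts_merge_det n k1 k2 (U U' : face n k2) (V1 : face n k1) V2 V2' (W : face k1 k2) :
  cuts U V1 V2 W -> cuts U' V1 V2' W -> V2 = V2' /\ U = U'.
Proof.
move=> /cutsP[d u w] /cutsP[d' u' w'].
have e : V2 = V2'.
  apply: nset_inj; apply/fsetP => x.
  have [xV|xV] := boolP (x \in nset V1).
    by rewrite (negbTE (fdisjointP d _ xV)) (negbTE (fdisjointP d' _ xV)).
  by rewrite -(mem_gap_image xV d) -(mem_gap_image xV d') -w -w'.
by split=> //; apply: face_inj; rewrite u u' e.
Qed.

Lemma cut_ex n k2 (U : face n k2) P : P `<=` nset U ->
  exists k1 (V1 : face n k1) V2 (W : face k1 k2), cuts U V1 V2 W /\ nset V1 = P.
Proof.
move=> PU; have eP : nset (ordset n P) = P.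
  by apply: nset_ordset => u /(fsubsetP PU)/nset_bound.
have s : set_face (ordset n P) \subset U by rewrite -nsetS eP.
exists (n - #|ordset n P|)%N, (set_face (ordset n P)).
by exists (U :\: ordset n P)%SET, (cut_face s); split=> //; exact: cuts_cut_face.
Qed.

Lemma merge_ex n k1 k2 (V1 : face n k1) (W : face k1 k2) :
  exists (U : face n k2) V2, cuts U V1 V2 W.
Proof.
pose V2 := [set i : 'I_n | (val i \notin nset V1) && (gap (nset V1) i \in nset W)]%SET.
have d : fdisjoint (nset V1) (nset V2).
  apply/fdisjointP => u uV; apply/imfsetP => -[i /=]; rewrite inE => /andP[iV _] e.
  by move: iV; rewrite -[X in X \notin _]e uV.
have w : nset W = gap (nset V1) @` nset V2.
  apply/fsetP => j; apply/idP/imfsetP => [jW|[u /= /imfsetP[i /=]]].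
    have := nset_bound jW; rewrite -{1}(gap_total V1) => /gap_onto[u [uV un e]].
    exists u => //; apply/imfsetP; exists (Ordinal un) => //=.
    by rewrite inE /= uV e.
  by rewrite inE => /andP[_ h] -> ->.
have card : (#|V1 :|: V2| + k2 == n)%N.
  rewrite -card_nset nsetU cardfsU (eqP d) ?cardfs0 ?subn0.
  have -> : #|` nset V2| = #|W|.
    rewrite -card_nset w [RHS]card_in_imfset //= => x y /imfsetP[i /=].
    rewrite inE => /andP[iV _] -> /imfsetP[j /=]; rewrite inE => /andP[jV _] ->.
    exact: gap_inj.
  rewrite card_nset; have := face_card V1; have := face_card W; lia.
exists (Face card), V2; apply/cutsP; split=> //.
by rewrite /= nsetU.
Qed.

(** Provides the missing face in the hypotheses of mu_assoc. *)
Lemma cuts_assoc n k1 k2 k3 (U : face n k3) (V1 : face n k1) (V12 : face n k2)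
    V2 V3 (W2 : face k1 k2) (W3 : face k2 k3) :
  cuts U V12 V3 W3 -> cuts V12 V1 V2 W2 ->
  exists W23 : face k1 k3,
    cuts U V1 (V2 :|: V3)%SET W23 /\ cuts W23 W2 (psi k1 V1 V3) W3.
Proof.
move=> h h'; have /cutsP[d u w] := h; have /cutsP[d' u' w'] := h'.
have s1 : V1 \subset U by rewrite -nsetS u u' -fsetUA fsubsetUl.
have := cuts_cut_face s1; set W23 := cut_face s1 => h1.
have /cutsP[d1 u1 w1] := h1.
have d13 : fdisjoint (nset V1) (nset V3) by move: d; rewrite u' fdisjointUX => /andP[].
have d23 : fdisjoint (nset V2) (nset V3) by move: d; rewrite u' fdisjointUX => /andP[].
have e : (U :\: V1 = V2 :|: V3)%SET.
  apply: nset_inj; rewrite nsetD nsetU u u' -fsetUA fsetDUl fsetDv fset0U.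
  apply/fsetDidPl; rewrite fdisjoint_sym fdisjointXU.
  by rewrite d' d13.
rewrite e in h1 d1 u1 w1; exists W23; split=> //; apply/cutsP.
have d13' : [disjoint V1 & V3]%bool by rewrite -nset_disjoint.
have eP : nset (psi k1 V1 V3) = gap (nset V1) @` nset V3 by rewrite nset_psi.
have inj12 x : x \in nset V2 `|` nset V3 -> x \notin nset V1.
  by apply: contraTN => xV; rewrite -nsetU; exact: (fdisjointP d1).
split.
- rewrite w' eP; apply/fdisjointP => _ /imfsetP[x /= xV ->].
  rewrite mem_gap_image ?inj12 ?inE ?xV //; exact: (fdisjointP d23).
- by rewrite w1 w' eP nsetU imfsetU.
rewrite w eP u' w'; apply/fsetP => x; apply/imfsetP/imfsetP => /= -[y yV ->].
  by exists (gap (nset V1) y); [apply/imfsetP; exists y | rewrite gap_gap].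
by case/imfsetP: yV => z /= zV ->; exists z => //; rewrite gap_gap.
Qed.

(** * Elements of a family of spans *)

Lemma existT_inj (T : Type) (Q : T -> Type) i (u v : Q i) :
  existT Q i u = existT Q i v -> u = v.
Proof.
move=> e; pose c (w : {i : T & Q i}) (h : projT1 w = i) := ecast i (Q i) h (projT2 w).
have cE w w' h h' : w = w' -> c w h = c w' h'.
  by move=> ew; subst w'; congr c; exact: Prop_irrelevance.
exact: (cE (existT Q i u) (existT Q i v) (erefl i) (erefl i) e).
Qed.

Section Elements.
Variables (A B : nat -> choiceType).
Variable Sp : forall n k, face n k -> Defs.span (A n) (B k).

(** All the elements of all the spans of the family in one type, so that elements
    of spans given by different but equal faces can be equal. *)
Inductive elt := Elt n k (U : face n k) of Sp U.

Definition elt_level (e : elt) : nat := let: Elt n k U s := e in n.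
Definition elt_src (e : elt) : {n : nat & A n} :=
  let: Elt n k U s := e in Tagged A (source s).
Definition elt_tgt (e : elt) : {n : nat & B n} :=
  let: Elt n k U s := e in Tagged B (target s).
Definition elt_lab (e : elt) : {fset nat} := let: Elt n k U s := e in nset U.

HB.instance Definition _ := gen_eqMixin elt.

(** Elimination of an equality between elements without any transport. *)
Lemma Elt_subst (Q : forall n k (U : face n k), Sp U -> Prop) n k (U : face n k) (s : Sp
  U)
    n' k' (U' : face n' k') (s' : Sp U') :
  Elt s = Elt s' -> Q n k U s -> Q n' k' U' s'.
Proof.
pose R e := let: Elt n k U s := e in Q n k U s.
by move=> e; rewrite -/(R (Elt s)) -/(R (Elt s')) e.
Qed.

Lemma Elt_face n k (U : face n k) (s : Sp U) n' k' (U' : face n' k') (s' : Sp U') :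
  Elt s = Elt s' -> [/\ n = n', k = k' & nset U = nset U'].
Proof.
by move=> e; apply: (Elt_subst
  (Q := fun n'' k'' U'' _ => [/\ n = n'', k = k'' & nset U = nset U'']) e).
Qed.

Lemma Elt_retype n k (U : face n k) e :
  elt_level e = n -> elt_lab e = nset U -> exists t : Sp U, e = Elt t.
Proof.
case: e => n' k' U' s' /= en eU; subst n'.
have ek := face_levelE eU; subst k'; have e := face_inj eU; subst U'.
by exists s'.
Qed.

Lemma Elt_inj n k (U : face n k) (s s' : Sp U) : Elt s = Elt s' -> s = s'.
Proof.
pose pack e : {n : nat & {k : nat & {U : face n k & Sp U}}} :=
  let: Elt n k U s := e in existT _ n (existT _ k (existT _ U s)).
move=> e; have /= e1 := congr1 pack e.
exact: (existT_inj (existT_inj (existT_inj e1))).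
Qed.

(** The level n - #|U| in the type of set_face U is the only possible one. *)
Lemma face_set_face (Q : forall n k, face n k -> Prop) :
  (forall n (U : {set 'I_n}), Q _ _ (set_face U)) -> forall n k (U : face n k), Q _ _ U.
Proof.
move=> h n k U; have e : k = (n - #|U|)%N by have := face_card U; lia.
case: U e => U hU /= e; subst k.
by have -> : Face hU = set_face U by apply: face_inj.
Qed.

Lemma mem_fibre n k (U : face n k) x (s : Sp U) :
  (s \in fset_set (fibre (Sp U) x)) = (source s == x).
Proof.
rewrite in_fset_set; last exact: fibre_finite.
by apply/idP/eqP; rewrite inE.
Qed.

Definition elt_out (x : {n : nat & A n}) : seq elt :=
  [seq Elt s | U <- enum {set 'I_(tag x)},
               s <- fset_set (fibre (Sp (set_face U)) (tagged x))].

Lemma elt_out_uniq x : uniq (elt_out x).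
Proof.
apply: allpairs_uniq_dep => [|U _|]; rewrite ?enum_uniq //.
move=> [U s] [V t] _ _ /= e.
have eUV : U = V by apply: nset_inj; exact: (congr1 elt_lab e).
by subst V; congr existT; exact: Elt_inj.
Qed.

Lemma mem_elt_out x e : (e \in elt_out x) = (elt_src e == x).
Proof.
case: x => n x; apply/allpairsPdep/eqP => [[U [s [_ hs ->]]]|].
  by move: hs; rewrite mem_fibre /= => /eqP ->.
case: e => n' k U s /= e; have en : n' = n by exact: (congr1 tag e).
subst n'; have sx : source s = x := existT_inj e.
move: n k U x s sx {e}; apply: face_set_face => n U x s sx.
by exists U, s; split; rewrite ?mem_enum //= mem_fibre sx.
Qed.

End Elements.

(** * Factorisations of the elements of a Burnside object *)

Section Legs.
Variables (X Y Z : choiceType) (Q' : Defs.span Y Z) (Q : Defs.span X Y).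
Implicit Types p q : span_comp Q' Q.

Lemma legs_match p : target (fst_leg p) = source (snd_leg p).
Proof. exact: eqP (valP p). Qed.

Lemma legs_inj p q : fst_leg p = fst_leg q -> snd_leg p = snd_leg q -> p = q.
Proof.
by move=> e1 e2; apply: val_inj; move: e1 e2; rewrite /fst_leg /snd_leg;
  case: (val p) (val q) => [a b] [a' b'] /= -> ->.
Qed.

Lemma legs_ex (a : Q) (b : Q') : target a = source b ->
  exists p, fst_leg p = a /\ snd_leg p = b.
Proof. by move=> /eqP e; exists (exist _ (a, b) e). Qed.
End Legs.

Section IsoFacts.
Variables (X Y : choiceType) (Q Q' : Defs.span X Y) (g : span_iso Q Q').

Lemma iso_inj : injective g.
Proof. by case: g => h bh ? ?; exact: bij_inj. Qed.

Lemma iso_onto e' : exists e, g e = e'.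
Proof. by case: g => h [h' ? c] ? ? /=; exists (h' e'). Qed.

Lemma iso_source e : source (g e) = source e.
Proof. by case: g => h ? s ?; exact: s. Qed.

Lemma iso_target e : target (g e) = target e.
Proof. by case: g => h ? ? t; exact: t. Qed.
End IsoFacts.

Section Splits.
Variable X : burnside_sset.
Implicit Types (e u v : elt (bd X)) (P Q : {fset nat}).

(** A relation rather than two functions: it holds for all the equivalent forms
    of the same face, and no proof of inclusion has to be carried. *)
Definition splits P e u v : Prop := let: Elt n k2 U s := e in
  exists k1 (V1 : face n k1) V2 (W : face k1 k2) (h : cuts U V1 V2 W),
    [/\ P = nset V1, u = Elt (fst_leg (mu h s)) & v = Elt (snd_leg (mu h s))].

Lemma mu_source n k1 k2 (U : face n k2) (V1 : face n k1) V2 (W : face k1 k2)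
    (h : cuts U V1 V2 W) (s : bd X U) : source (fst_leg (mu h s)) = source s.
Proof. exact: (iso_source (mu h)). Qed.

Lemma mu_target n k1 k2 (U : face n k2) (V1 : face n k1) V2 (W : face k1 k2)
    (h : cuts U V1 V2 W) (s : bd X U) : target (snd_leg (mu h s)) = target s.
Proof. exact: (iso_target (mu h)). Qed.

Lemma mu_inj n k1 k2 (U : face n k2) (V1 : face n k1) V2 (W : face k1 k2)
    (h : cuts U V1 V2 W) (s t : bd X U) :
  fst_leg (mu h s) = fst_leg (mu h t) -> snd_leg (mu h s) = snd_leg (mu h t) -> s = t.
Proof. by move=> e1 e2; apply: (iso_inj (g := mu h)); exact: legs_inj. Qed.

Lemma mu_ex n k1 k2 (U : face n k2) (V1 : face n k1) V2 (W : face k1 k2)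
    (h : cuts U V1 V2 W) (a : bd X V1) (b : bd X W) : target a = source b ->
  exists s, fst_leg (mu h s) = a /\ snd_leg (mu h s) = b.
Proof.
by move=> /legs_ex[p [<- <-]]; have [s <-] := iso_onto (mu h) p; exists s.
Qed.

Lemma splits_ex P e : P `<=` elt_lab e -> exists u v, splits P e u v.
Proof.
case: e => n k U s /= /cut_ex[k1 [V1 [V2 [W [h <-]]]]].
by exists (Elt (fst_leg (mu h s))), (Elt (snd_leg (mu h s))), k1, V1, V2, W, h.
Qed.

Lemma splits_det P e u v u' v' : splits P e u v -> splits P e u' v' -> u = u' /\ v = v'.
Proof.
case: e => n k U s [k1 [V1 [V2 [W [h [-> -> ->]]]]]].
move=> [k1' [V1' [V2' [W' [h' [eV -> ->]]]]]].
have ek := face_levelE eV; subst k1'; have e := face_inj eV; subst V1'.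
have [e2 eW] := cuts_det h h'; subst V2' W'.
by rewrite (bool_irrelevance h h').
Qed.

Lemma splitsP P e u v : splits P e u v ->
  [/\ P `<=` elt_lab e, elt_lab u = P, elt_src u = elt_src e,
      elt_tgt u = elt_src v & elt_tgt v = elt_tgt e].
Proof.
case: e => n k U s [k1 [V1 [V2 [W [h [-> -> ->]]]]]] /=.
have /cutsP[_ -> _] := h.
by rewrite fsubsetUl mu_source mu_target legs_match.
Qed.

Lemma splits_lab P e u v : splits P e u v -> elt_lab v = gap P @` (elt_lab e `\` P).
Proof.
case: e => n k U s [k1 [V1 [V2 [W [h [-> _ ->]]]]]] /=.
have /cutsP[d -> ->] := h.
rewrite fsetDUl fsetDv fset0U.
by have -> : nset V2 `\` nset V1 = nset V2 by apply/fsetDidPl; rewrite fdisjoint_sym.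
Qed.

Lemma splits_merge u v : elt_tgt u = elt_src v -> exists e, splits (elt_lab u) e u v.
Proof.
case: u => n k1 V1 a; case: v => k1' k2 W b /= e.
have ek : k1 = k1' by exact: (congr1 tag e).
subst k1'; have ab : target a = source b := existT_inj e.
have [U [V2 h]] := merge_ex V1 W.
have [s [<- <-]] := mu_ex h ab.
by exists (Elt s), k1, V1, V2, W, h.
Qed.

Lemma splits_inj P e e' u v : splits P e u v -> splits P e' u v -> e = e'.
Proof.
case: e => n k U s [k1 [V1 [V2 [W [h [-> -> ->]]]]]].
case: e' => n' k' U' s' [k1' [V1' [V2' [W' [h' [_ eu ev]]]]]].
have [en ek1 eV] := Elt_face eu; subst n' k1'; have e1 := face_inj eV; subst V1'.
have [_ ek eW] := Elt_face ev; subst k'; have e1 := face_inj eW; subst W'.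
have [e2 eU] := cuts_merge_det h h'; subst V2' U'.
rewrite (bool_irrelevance h' h) in eu ev.
by congr Elt; apply: (mu_inj (h := h)); exact: Elt_inj.
Qed.

(** The associativity of mu, once the faces are forgotten. *)
Lemma splits_assoc P Q e u2 v2 u1 w : splits Q e u2 v2 -> splits P u2 u1 w ->
  exists v1, splits P e u1 v1 /\ splits (gap P @` (Q `\` P)) v1 w v2.
Proof.
case: e => n k3 U s [k2 [V12 [V3 [W3 [h [-> -> ->]]]]]].
move=> [k1 [V1 [V2 [W2 [h' [-> -> ->]]]]]].
have [W23 [h1 h2]] := cuts_assoc h h'.
have [m1 m2 m3] := mu_assoc h1 h2 h h' s.
exists (Elt (snd_leg (mu h1 s))); split.
  by exists k1, V1, (V2 :|: V3)%SET, W23, h1; rewrite m1.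
exists k2, W2, (psi k1 V1 V3), W3, h2; rewrite m2 m3; split=> //.
have /cutsP[d -> ->] := h'.
rewrite fsetDUl fsetDv fset0U.
by have -> : nset V2 `\` nset V1 = nset V2 by apply/fsetDidPl; rewrite fdisjoint_sym.
Qed.

Lemma elt_dim e : (tag (elt_tgt e) + #|` elt_lab e| = tag (elt_src e))%N.
Proof. by case: e => n k U s /=; rewrite card_nset addnC face_card. Qed.

Lemma elt_lab0 e e' : elt_src e = elt_src e' -> elt_lab e = fset0 -> elt_lab e' = fset0 ->
  e = e'.
Proof.
case: e => n k U s; case: e' => n' k' U' s' /= e.
have en : n = n' by exact: (congr1 tag e).
subst n'; have ss := existT_inj e => {e} U0 U'0.
have ek : k = n by have := face_card U; rewrite -card_nset U0 cardfs0.
have ek' : k' = n by have := face_card U'; rewrite -card_nset U'0 cardfs0.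
subst k k'; have eU : U = face0 n by apply: face_inj; rewrite U0 nset0.
have eU' : U' = face0 n by apply: face_inj; rewrite U'0 nset0.
subst U U'; have [g] := bd_empty X n; congr Elt.
have [[a ga] [b gb]] := (iso_onto g s, iso_onto g s').
have ab : a = b by have /= <- := iso_source g a; have /= <- := iso_source g b;
  rewrite ga gb.
by rewrite -ga -gb ab.
Qed.

End Splits.

(** * The mapping cone *)

Section Cone.
Variables (X Y : burnside_sset) (f : burnside_map X Y).
Variables (oX : ordering X) (oY : ordering Y).

(** The faces that contain the apex of the simplex of the cone over x. *)
Definition fbd n k (U : face n k) : Defs.span (simp X n) (simp Y k) :=
  span_comp (map_span f k) (bd X U).

(** Faces of simplices of Y, faces of simplices of X avoiding the apex, and faces
    of simplices of X containing it. *)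
Inductive cmor :=
  | MY of elt (bd Y)
  | MX of elt (bd X)
  | MF of elt fbd.

HB.instance Definition _ := gen_eqMixin cmor.

Lemma MY_inj : injective MY. Proof. by move=> a b []. Qed.
Lemma MX_inj : injective MX. Proof. by move=> a b []. Qed.
Lemma MF_inj : injective MF. Proof. by move=> a b []. Qed.

Definition cob : eqType := (simplex Y + simplex X)%type.

Definition cdim (x : cob) : nat :=
  match x with inl y => tag y | inr x => (tag x).+1 end.

Definition csrc (m : cmor) : cob :=
  match m with
  | MY e => inl (elt_src e) | MX e => inr (elt_src e) | MF e => inr (elt_src e)
  end.

Definition ctgt (m : cmor) : cob :=
  match m with
  | MY e => inl (elt_tgt e) | MX e => inr (elt_tgt e) | MF e => inl (elt_tgt e)
  end.

Definition clab (m : cmor) : {fset nat} :=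
  match m with
  | MY e => elt_lab e | MX e => elt_lab e | MF e => elt_level e |` elt_lab e
  end.

Definition cout (x : cob) : seq cmor :=
  match x with
  | inl y => map MY (elt_out (bd Y) y)
  | inr x => map MX (elt_out (bd X) x) ++ map MF (elt_out fbd x)
  end.

(** An element (s, a) containing the apex is cut at P by cutting s into v1 and w.
    If P avoids the apex, then (w, a) is left.  Otherwise (w, a) has to be
    carried across f, to (b, w'), so that the first part is (v1, b) and w' is
    left, a face in Y. *)
Definition csplits (P : {fset nat}) (m u v : cmor) : Prop :=
  match m with
  | MY e => exists u' v', [/\ splits P e u' v', u = MY u' & v = MY v']
  | MX e => exists u' v', [/\ splits P e u' v', u = MX u' & v = MX v']
  | MF (Elt n k2 U x) =>
      exists k1 (V1 : face n k1) V2 (W : face k1 k2) (h : cuts U V1 V2 W)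
        (y : fbd W),
      [/\ fst_leg y = snd_leg (mu h (fst_leg x)), snd_leg y = snd_leg x &
       [/\ P = nset V1, u = MX (Elt (fst_leg (mu h (fst_leg x)))) & v = MF (Elt y)] \/
       exists z : fbd V1,
        [/\ fst_leg z = fst_leg (mu h (fst_leg x)),
            snd_leg z = fst_leg (map_bd f W y) &
            [/\ P = n |` nset V1, u = MF (Elt z) &
                v = MY (Elt (snd_leg (map_bd f W y)))]]]
  end.

Lemma nsetU1_inj n (A B : {set 'I_n}) : n |` nset A = n |` nset B -> nset A = nset B.
Proof.
move/fsetP => e; apply/fsetP => u; have := e u; rewrite !inE; case: eqP => // -> _.
by rewrite !(negbTE (nset_notin_n _)).
Qed.

Lemma nset_neq_U1 n (A B : {set 'I_n}) : nset A <> n |` nset B.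
Proof. by move/fsetP/(_ n); rewrite !inE eqxx (negbTE (nset_notin_n _)). Qed.

(** The apex stays last: removing V1 renumbers it from n to k1. *)
Lemma gap_apex0 n k1 k2 (U : face n k2) (V1 : face n k1) V2 (W : face k1 k2) :
  cuts U V1 V2 W -> gap (nset V1) @` ((n |` nset U) `\` nset V1) = k1 |` nset W.
Proof.
move=> /cutsP[d -> ->].
have -> : (n |` (nset V1 `|` nset V2)) `\` nset V1 = n |` nset V2.
  apply/fsetP => u; rewrite !inE.
  have [->|_] /= := eqVneq u n; first by rewrite (negbTE (nset_notin_n _)).
  by case: (boolP (u \in nset V1)) => //= uV; rewrite (negbTE (fdisjointP d _ uV)).
by rewrite imfsetU imfset_fset1 gap_total.
Qed.

(** Removing the apex does not renumber the vertices below it. *)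
Lemma gap_apex1 n k1 k2 (U : face n k2) (V1 : face n k1) V2 (W : face k1 k2) :
  cuts U V1 V2 W -> gap (n |` nset V1) @` ((n |` nset U) `\` (n |` nset V1)) = nset W.
Proof.
move=> /cutsP[d -> ->].
have -> : (n |` (nset V1 `|` nset V2)) `\` (n |` nset V1) = nset V2.
  apply/fsetP => u; rewrite !inE.
  have [->|_] /= := eqVneq u n; first by rewrite (negbTE (nset_notin_n _)).
  by case: (boolP (u \in nset V1)) => //= uV; rewrite (negbTE (fdisjointP d _ uV)).
apply: eq_in_imfset => // u uV; apply: eq_gap => v vu.
by rewrite !inE ltn_eqF // (ltn_trans vu) // (nset_bound uV).
Qed.

Lemma fbd_sourceE n k (U : face n k) (x : fbd U) : source x = source (fst_leg x).
Proof. by []. Qed.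

Lemma fbd_targetE n k (U : face n k) (x : fbd U) : target x = target (snd_leg x).
Proof. by []. Qed.

Lemma fbd_part n k1 k2 (U : face n k2) (V1 : face n k1) V2 (W : face k1 k2)
  (h : cuts U V1 V2 W) (x : fbd U) : exists y : fbd W,
  fst_leg y = snd_leg (mu h (fst_leg x)) /\ snd_leg y = snd_leg x.
Proof. by apply: legs_ex; rewrite mu_target legs_match. Qed.

Lemma fbd_push n k1 k2 (U : face n k2) (V1 : face n k1) V2 (W : face k1 k2)
    (h : cuts U V1 V2 W) (x : fbd U) (y : fbd W) :
  fst_leg y = snd_leg (mu h (fst_leg x)) -> exists z : fbd V1,
  fst_leg z = fst_leg (mu h (fst_leg x)) /\ snd_leg z = fst_leg (map_bd f W y).
Proof.
move=> ey; apply: legs_ex; rewrite legs_match -ey.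
exact: esym (iso_source (map_bd f W) y).
Qed.

Lemma csplits_ex P m : P `<=` clab m -> exists u v, csplits P m u v.
Proof.
case: m => [e|e|[n k U x]] /=.
- by move=> /splits_ex[u [v h]]; exists (MY u), (MY v), u, v.
- by move=> /splits_ex[u [v h]]; exists (MX u), (MX v), u, v.
move=> /fsubsetP PU.
have : P `\ n `<=` nset U.
  by apply/fsubsetP => u; rewrite !inE => /andP[un /PU]; rewrite !inE (negbTE un).
move=> /cut_ex[k1 [V1 [V2 [W [h eV]]]]].
have [y [ey1 ey2]] := fbd_part h x.
have [nP|nP] := boolP (n \in P); last first.
  exists (MX (Elt (fst_leg (mu h (fst_leg x))))), (MF (Elt y)).
  exists k1, V1, V2, W, h, y; split=> //; left; split=> //.
  by rewrite eV mem_fsetD1.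
have [z [ez1 ez2]] := fbd_push ey1.
exists (MF (Elt z)), (MY (Elt (snd_leg (map_bd f W y)))).
exists k1, V1, V2, W, h, y; split=> //; right; exists z; split=> //; split=> //.
by rewrite eV fsetD1K.
Qed.

Lemma csplits_det P m u v u' v' :
  csplits P m u v -> csplits P m u' v' -> u = u' /\ v = v'.
Proof.
case: m => [e|e|[n k U x]] /=.
- move=> [a [b [h -> ->]]] [a' [b' [h' -> ->]]].
  by have [-> ->] := splits_det h h'.
- move=> [a [b [h -> ->]]] [a' [b' [h' -> ->]]].
  by have [-> ->] := splits_det h h'.
move=> [k1 [V1 [V2 [W [h [y [ey1 ey2 c]]]]]]].
move=> [k1' [V1' [V2' [W' [h' [y' [ey1' ey2' c']]]]]]].
have eV : nset V1 = nset V1'.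
  case: c c' => [[-> _ _]|[z [_ _ [-> _ _]]]] [[e _ _]|[z' [_ _ [e _ _]]]] //.
  - by case: (nset_neq_U1 e).
  - by case: (nset_neq_U1 (esym e)).
  exact: nsetU1_inj.
have ek := face_levelE eV; subst k1'; have e := face_inj eV; subst V1'.
have [e2 eW] := cuts_det h h'; subst V2' W'.
rewrite (bool_irrelevance h' h) in ey1' c' *.
have ey : y = y' by apply: legs_inj; rewrite ?ey1 ?ey1' ?ey2 ?ey2'.
subst y'.
case: c c' => [[-> -> ->]|[z [ez1 ez2 [-> -> ->]]]] [[e -> ->]|[z' [ez1' ez2' [e ->
  ->]]]] //.
- by case: (nset_neq_U1 e).
- by case: (nset_neq_U1 (esym e)).
have -> // : z = z'.
by apply: legs_inj; rewrite ?ez1 ?ez1' ?ez2 ?ez2'.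
Qed.

Lemma csplitsP P m u v : csplits P m u v ->
  [/\ P `<=` clab m, clab u = P, csrc u = csrc m,
      ctgt u = csrc v & ctgt v = ctgt m].
Proof.
case: m => [e|e|[n k U x]].
- by move=> [a [b [/splitsP[h1 h2 h3 h4 h5] -> ->]]]; rewrite /= h3 h4 h5.
- by move=> [a [b [/splitsP[h1 h2 h3 h4 h5] -> ->]]]; rewrite /= h3 h4 h5.
move=> [k1 [V1 [V2 [W [h [y [ey1 ey2 c]]]]]]].
have /cutsP[d eU eW] := h.
case: c => [[-> -> ->]|[z [ez1 ez2 [-> -> ->]]]]; split=> //.
- by rewrite /= eU fsetUCA fsubsetUl.
- by rewrite /csrc /elt_src fbd_sourceE mu_source.
- by rewrite /csrc /ctgt /elt_src /elt_tgt fbd_sourceE ey1 legs_match.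
- by rewrite /ctgt /elt_tgt !fbd_targetE ey2.
- by rewrite /= eU fsetUA fsubsetUl.
- by rewrite /csrc /elt_src !fbd_sourceE ez1 mu_source.
- by rewrite /csrc /ctgt /elt_src /elt_tgt fbd_targetE ez2 legs_match.
rewrite /ctgt /elt_tgt fbd_targetE -ey2; congr (inl (Tagged _ _)).
exact: (iso_target (map_bd f W) y).
Qed.

Lemma csplits_lab P m u v : csplits P m u v -> clab v = gap P @` (clab m `\` P).
Proof.
case: m => [e|e|[n k U x]].
- by move=> [a [b [/splits_lab h _ ->]]].
- by move=> [a [b [/splits_lab h _ ->]]].
move=> [k1 [V1 [V2 [W [h [y [ey1 ey2 c]]]]]]].
case: c => [[-> _ ->]|[z [ez1 ez2 [-> _ ->]]]] /=.
  by rewrite (gap_apex0 h).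
by rewrite (gap_apex1 h).
Qed.

Lemma csplits_merge u v : ctgt u = csrc v -> exists m, csplits (clab u) m u v.
Proof.
case: u v => [u|u|[n k1 V1 z]] [v|v|[k1' k2 W y]] //= => [[]|[]|[] e|[]].
- by move=> /splits_merge[e h]; exists (MY e), u, v.
- by move=> /splits_merge[e h]; exists (MX e), u, v.
- case: u e => n k V1 a /= e; have ek : k = k1' by exact: (congr1 tag e).
  subst k1'; have ab : target a = source (fst_leg y) := existT_inj e.
  have [U [V2 h]] := merge_ex V1 W; have [s [s1 s2]] := mu_ex h ab.
  have [x [x1 x2]] : exists x : fbd U, fst_leg x = s /\ snd_leg x = snd_leg y.
    by apply: legs_ex; rewrite -(mu_target h) s2 legs_match.
  exists (MF (Elt x)), k, V1, V2, W, h, y; rewrite x1 x2 s1 s2.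
  by split=> //; left.
case: v => k1' k2 W b e; have ek : k1 = k1' by exact: (congr1 tag e).
subst k1'; have ab : target (snd_leg z) = source b := existT_inj e.
have [p [p1 p2]] := legs_ex ab; have [y ey] := iso_onto (map_bd f W) p.
have zy : target (fst_leg z) = source (fst_leg y).
  rewrite legs_match -p1 -ey.
  exact: (iso_source (map_bd f W) y).
have [U [V2 h]] := merge_ex V1 W; have [s [s1 s2]] := mu_ex h zy.
have [x [x1 x2]] : exists x : fbd U, fst_leg x = s /\ snd_leg x = snd_leg y.
  by apply: legs_ex; rewrite -(mu_target h) s2 legs_match.
exists (MF (Elt x)), k1, V1, V2, W, h, y; rewrite x1 x2 s1 s2.
by split=> //; right; exists z; rewrite ey p1 p2.
Qed.

Lemma csplits_inj P m m' u v : csplits P m u v -> csplits P m' u v -> m = m'.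
Proof.
case: m => [e|e|[n k U x]].
- move=> [a [b [h -> ->]]]; case: m' => [e'|e'|[n' k' U' x']].
  + by move=> [a' [b' [h' [ea] [eb]]]]; subst a' b'; congr MY; exact: splits_inj h h'.
  + by move=> [a' [b' [h' //]]].
  by move=> [? [? [? [? [? [? [_ _ [[]//|[? [_ _ [] //]]]]]]]]]].
- move=> [a [b [h -> ->]]]; case: m' => [e'|e'|[n' k' U' x']].
  + by move=> [a' [b' [h' //]]].
  + by move=> [a' [b' [h' [ea] [eb]]]]; subst a' b'; congr MX; exact: splits_inj h h'.
  by move=> [? [? [? [? [? [? [_ _ [[]//|[? [_ _ [] //]]]]]]]]]].
move=> [k1 [V1 [V2 [W [h [y [ey1 ey2 c]]]]]]].
case: m' => [e'|e'|[n' k' U' x']].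
- by move=> [a' [b' [h' eu ev]]]; case: c => [[]|[? [_ _ []]]]; rewrite eu ev.
- by move=> [a' [b' [h' eu ev]]]; case: c => [[]|[? [_ _ []]]]; rewrite eu ev.
move=> [k1' [V1' [V2' [W' [h' [y' [ey1' ey2' c']]]]]]].
case: c => [[eP eu ev]|[z [ez1 ez2 [eP eu ev]]]].
  case: c' => [[eP' eu' ev']|[z' [_ _ [_ eu' _]]]]; last by rewrite eu in eu'.
  have e1 := MX_inj (etrans (esym eu) eu'); have e2 := MF_inj (etrans (esym ev) ev').
  have [en ek1 eV] := Elt_face e1; subst n' k1'; have e3 := face_inj eV; subst V1'.
  have [_ ek eW] := Elt_face e2; subst k'; have e4 := face_inj eW; subst W'.
  have [e5 eU] := cuts_merge_det h h'; subst V2' U'.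
  rewrite (bool_irrelevance h' h) in e1 ey1'.
  have e6 := Elt_inj e2; subst y'; congr (MF (Elt _)); apply: legs_inj.
    by apply: (mu_inj (h := h)); [exact: Elt_inj | rewrite -ey1 ey1'].
  by rewrite -ey2 ey2'.
case: c' => [[_ eu' _]|[z' [ez1' ez2' [eP' eu' ev']]]]; first by rewrite eu in eu'.
have e1 := MF_inj (etrans (esym eu) eu'); have e2 := MY_inj (etrans (esym ev) ev').
have [en ek1 eV] := Elt_face e1; subst n' k1'; have e3 := face_inj eV; subst V1'.
have [_ ek eW] := Elt_face e2; subst k'; have e4 := face_inj eW; subst W'.
have [e5 eU] := cuts_merge_det h h'; subst V2' U'.
rewrite (bool_irrelevance h' h) in ez1' ey1'.
have e6 := Elt_inj e1; subst z'.
have ey : y = y'.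
  apply: (iso_inj (g := map_bd f W)); apply: legs_inj; first by rewrite -ez2 ez2'.
  exact: Elt_inj e2.
subst y'; congr (MF (Elt _)); apply: legs_inj; last by rewrite -ey2 ey2'.
by apply: (mu_inj (h := h)); [rewrite -ez1 ez1' | rewrite -ey1 ey1'].
Qed.

(** When the apex is in neither set or only in Q, this is the associativity of
    mu; when it is in both, it is moreover the compatibility of f with mu. *)
Lemma csplits_assoc P Q m u2 v2 u1 w : csplits Q m u2 v2 -> csplits P u2 u1 w ->
  exists v1, csplits P m u1 v1 /\ csplits (gap P @` (Q `\` P)) v1 w v2.
Proof.
case: m => [e|e|[n k3 U x]].
- move=> [a [b [h -> ->]]] [a' [b' [h' -> ->]]].
  have [v1 [h1 h2]] := splits_assoc h h'; exists (MY v1).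
  by split; [exists a', v1 | exists b', b].
- move=> [a [b [h -> ->]]] [a' [b' [h' -> ->]]].
  have [v1 [h1 h2]] := splits_assoc h h'; exists (MX v1).
  by split; [exists a', v1 | exists b', b].
move=> [k2 [V12 [V3 [W3 [h [y [ey1 ey2 c]]]]]]].
case: c => [[-> -> ->]|[z [ez1 ez2 [-> -> ->]]]].
  move=> [a [b [[k1 [V1 [V2 [W2 [h' [-> -> ->]]]]]] -> ->]]].
  have [W23 [h1 h2]] := cuts_assoc h h'.
  have [m1 m2 m3] := mu_assoc h1 h2 h h' (fst_leg x).
  have [y' [ey1' ey2']] := fbd_part h1 x.
  exists (MF (Elt y')); split.
    by exists k1, V1, (V2 :|: V3)%SET, W23, h1, y'; split=> //; left; rewrite m1.
  exists k2, W2, (psi k1 V1 V3), W3, h2, y; rewrite ey1' m3 ey2' m2; split=> //.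
  left; split=> //.
  have /cutsP[d -> ->] := h'; rewrite fsetDUl fsetDv fset0U.
  by have -> : nset V2 `\` nset V1 = nset V2 by apply/fsetDidPl; rewrite fdisjoint_sym.
move=> [k1 [V1 [V2 [W2 [h' [y1 [ey11 ey12 c]]]]]]].
have [W23 [h1 h2]] := cuts_assoc h h'.
have [m1 m2 m3] := mu_assoc h1 h2 h h' (fst_leg x).
have [y' [ey1' ey2']] := fbd_part h1 x.
have e1 : fst_leg y = snd_leg (mu h2 (fst_leg y')) by rewrite ey1 ey1' m3.
have e2 : fst_leg y1 = fst_leg (mu h2 (fst_leg y')) by rewrite ey11 ez1 ey1' m2.
case: c => [[-> -> ->]|[z1 [ez11 ez12 [-> -> ->]]]].
  exists (MF (Elt y')); split.
    by exists k1, V1, (V2 :|: V3)%SET, W23, h1, y'; split=> //; left; rewrite m1 ez1.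
  exists k2, W2, (psi k1 V1 V3), W3, h2, y; rewrite e1 ey2' ey2; split=> //.
  by right; exists y1; split=> //; [rewrite ey12 ez2 | rewrite (gap_apex0 h')].
have [q1 q2 q3] := map_mu e1 (etrans ey2 (esym ey2')) e2 (etrans ey12 ez2).
exists (MY (Elt (snd_leg (map_bd f W23 y')))); split.
  exists k1, V1, (V2 :|: V3)%SET, W23, h1, y'; split=> //; right; exists z1.
  by split=> //; [rewrite ez11 ez1 m1 | rewrite ez12 q1].
exists (Elt (snd_leg (map_bd f W2 y1))), (Elt (snd_leg (map_bd f W3 y))); split=> //.
exists k2, W2, (psi k1 V1 V3), W3, h2; rewrite q2 q3 (gap_apex1 h'); split=> //.
Qed.

Lemma cdim_tgt m : (cdim (ctgt m) + #|` clab m| = cdim (csrc m))%N.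
Proof.
case: m => [e|e|[n k U x]]; rewrite /= -?elt_dim //.
by rewrite cardfsU1 nset_notin_n card_nset /= add1n addnS addnC face_card.
Qed.

Lemma clab0_eq m m' : csrc m = csrc m' -> clab m = fset0 -> clab m' = fset0 -> m = m'.
Proof.
have nF (e : elt fbd) : elt_level e |` elt_lab e <> fset0.
  by move/fsetP/(_ (elt_level e)); rewrite !inE eqxx.
case: m m' => [e|e|e] [e'|e'|e'] //= => [[]|[]|[] _ _ /nF|[] _ /nF|[] _ /nF] //.
- by move=> ? ? ?; congr MY; apply: elt_lab0.
- by move=> ? ? ?; congr MX; apply: elt_lab0.
Qed.

Lemma cout_uniq x : uniq (cout x).
Proof.
case: x => x /=; first by rewrite map_inj_uniq ?elt_out_uniq //; exact: MY_inj.
rewrite cat_uniq !map_inj_uniq ?elt_out_uniq ?andbT //=; [|exact: MF_inj|exact: MX_inj].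
by apply/hasPn => _ /mapP[a _ ->]; apply/mapP => -[].
Qed.

Lemma mem_cout x m : (m \in cout x) = (csrc m == x).
Proof.
case: x => x /=.
  apply/mapP/eqP => [[e /=]|].
    by rewrite mem_elt_out => /eqP <- ->.
  by case: m => //= e [<-]; exists e => //; rewrite mem_elt_out.
rewrite mem_cat; apply/orP/eqP => [[/mapP|/mapP] [e]|].
- by rewrite mem_elt_out => /eqP <- ->.
- by rewrite mem_elt_out => /eqP <- ->.
case: m => //= e [<-]; [left|right]; apply/mapP; exists e => //;
  by rewrite mem_elt_out.
Qed.

Definition elt_lt (Z : burnside_sset) (o : ordering Z) (e e' : elt (bd Z)) : Prop :=
  let: Elt n k U s := e in exists2 t : bd Z U, e' = Elt t & ord_lt o s t.

Arguments elt_lt : simpl never.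

Lemma elt_ltE (Z : burnside_sset) (o : ordering Z) n k (U : face n k) (s t : bd Z U) :
  elt_lt o (Elt s) (Elt t) <-> ord_lt o s t.
Proof. by split=> [[t' /Elt_inj <-]|] //; exists t. Qed.

(** The order of X is reversed, because simplices of X have one dimension more
    in the cone, which exchanges the positive and the negative pairs.  Faces
    through the apex are ordered by an arbitrary enumeration. *)
Definition clt (m m' : cmor) : bool :=
  match m, m' with
  | MY e, MY e' => `[< elt_lt oY e e' >]
  | MX e, MX e' => `[< elt_lt oX e' e >]
  | MF e, MF e' => (index e (elt_out fbd (elt_src e)) < index e' (elt_out fbd (elt_src
    e')))%N
  | _, _ => false
  end.

Lemma elt_lt_total (Z : burnside_sset) (o : ordering Z) (e e' : elt (bd Z)) :
  elt_src e = elt_src e' -> elt_lab e = elt_lab e' -> e <> e' ->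
  `[< elt_lt o e e' >] = ~~ `[< elt_lt o e' e >].
Proof.
case: e => n k U s es el ne.
have [t et] : exists t : bd Z U, e' = Elt t.
  apply: Elt_retype (esym el).
  by case: e' es {el ne} => n' k' U' s' /= /(congr1 tag).
subst e'; have st : s <> t by move=> e; apply: ne; rewrite e.
rewrite -asbool_neg; apply: asbool_equiv_eq; rewrite !elt_ltE.
split=> [[le _] [le' _]|h]; first exact: st (ord_anti le le').
by case: (ord_total o s t) => // le; split=> //; case: h; split=> // /esym.
Qed.

Lemma lab_apex (e : elt (bd X)) (e' : elt fbd) :
  elt_lab e = elt_level e' |` elt_lab e' -> elt_src e <> elt_src e'.
Proof.
case: e e' => n k U s [n' k' U' s'] /= eU /(congr1 tag) /= en; subst n'.
exact: (nset_neq_U1 eU).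
Qed.

Lemma clt_total m m' : csrc m = csrc m' -> clab m = clab m' -> m != m' ->
  clt m m' = ~~ clt m' m.
Proof.
case: m m' => [e|e|e] [e'|e'|e'] //.
- by move=> [es] el /eqP ne; apply: elt_lt_total => // ee; apply: ne; rewrite ee.
- by move=> [es] el /eqP ne; apply: elt_lt_total => // ee; apply: ne; rewrite ee.
- by move=> [es] /lab_apex; rewrite es.
- by move=> [es] /esym/lab_apex; rewrite es.
move=> [es] el ne; rewrite /clt es -leqNgt [in RHS]leq_eqVlt; case: eqP => //= ei;
  case/eqP: ne.
congr MF; have he : e \in elt_out fbd (elt_src e') by rewrite mem_elt_out es.
by rewrite -(nth_index e he) ei nth_index // mem_elt_out.
Qed.

(** The parts are chosen; by csplits_det the choice is forced. *)
Definition chead (P : {fset nat}) (m : cmor) : cmor :=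
  if pselect (exists uv, csplits P m uv.1 uv.2) is left h then (sval (cid h)).1 else m.

Definition ctail (P : {fset nat}) (m : cmor) : cmor :=
  if pselect (exists uv, csplits P m uv.1 uv.2) is left h then (sval (cid h)).2 else m.

Lemma csplitsE P m u v : csplits P m u v -> chead P m = u /\ ctail P m = v.
Proof.
move=> h; rewrite /chead /ctail; case: pselect => [ex|[]]; last by exists (u, v).
by case: (cid ex) => -[u' v'] /= h'; apply: csplits_det h' h.
Qed.

Lemma csplits_head_tail P m : P `<=` clab m -> csplits P m (chead P m) (ctail P m).
Proof. by move=> /csplits_ex[u [v h]]; have [-> ->] := csplitsE h. Qed.

Lemma chead_src P m : P `<=` clab m -> csrc (chead P m) = csrc m.
Proof. by move=> /csplits_head_tail/csplitsP[]. Qed.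

Lemma chead_lab P m : P `<=` clab m -> clab (chead P m) = P.
Proof. by move=> /csplits_head_tail/csplitsP[]. Qed.

Lemma ctail_src P m : P `<=` clab m -> csrc (ctail P m) = ctgt (chead P m).
Proof. by move=> /csplits_head_tail/csplitsP[]. Qed.

Lemma ctail_tgt P m : P `<=` clab m -> ctgt (ctail P m) = ctgt m.
Proof. by move=> /csplits_head_tail/csplitsP[]. Qed.

Lemma ctail_lab P m : P `<=` clab m ->
  clab (ctail P m) = [fset squeeze P u | u in clab m `\` P].
Proof. by move=> /csplits_head_tail/csplits_lab ->; rewrite squeeze_image. Qed.

Lemma cfact_inj P m m' : P `<=` clab m -> P `<=` clab m' ->
  chead P m = chead P m' -> ctail P m = ctail P m' -> m = m'.
Proof.
move=> /csplits_head_tail h /csplits_head_tail h' e1 e2.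
by rewrite e1 e2 in h; exact: csplits_inj h h'.
Qed.

Lemma cfact_ex u v : ctgt u = csrc v -> exists m,
  [/\ clab u `<=` clab m, chead (clab u) m = u & ctail (clab u) m = v].
Proof.
move=> /csplits_merge[m h]; exists m.
by have [-> ->] := csplitsE h; have [] := csplitsP h.
Qed.

Lemma cfact_assoc P Q m : P `<=` Q -> Q `<=` clab m ->
  [/\ chead P (chead Q m) = chead P m,
      ctail P (chead Q m) = chead [fset squeeze P u | u in Q `\` P] (ctail P m) &
      ctail [fset squeeze P u | u in Q `\` P] (ctail P m) = ctail Q m].
Proof.
move=> PQ Qm; have h := csplits_head_tail Qm.
have PQ' : P `<=` clab (chead Q m) by rewrite chead_lab.
have h' := csplits_head_tail PQ'.
have [v1 [/csplitsE[-> ->] h1]] := csplits_assoc h h'.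
by rewrite squeeze_image; have [-> ->] := csplitsE h1.
Qed.

Definition cone : ufcat := @UfCat cob cmor cdim csrc ctgt clab cout chead ctail clt
  cout_uniq mem_cout cdim_tgt chead_src chead_lab ctail_src ctail_tgt ctail_lab
  cfact_inj cfact_ex
  (fun P Q m PQ Qm => let: And3 h _ _ := cfact_assoc PQ Qm in h)
  (fun P Q m PQ Qm => let: And3 _ h _ := cfact_assoc PQ Qm in h)
  (fun P Q m PQ Qm => let: And3 _ _ h := cfact_assoc PQ Qm in h)
  clab0_eq clt_total.

End Cone.

(** * Counting chains as tuples *)

Section TupleCount.
Variables (n : nat) (D : {set 'I_n}).
Variables (E : {fset nat} -> bool) (p : {fset nat} -> {fset nat} -> bool).
Hypothesis E0 : E fset0.
Hypothesis p_good : forall P C, p P C -> good E (nset D) P C.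

Let T := ({set 'I_n} * {set 'I_n})%type.
Let q (W : T) := p (nset W.1) (nset W.2).

Lemma big_tuple_cons r (F : r.+1.-tuple T -> 'F_2) :
  \sum_c F c = \sum_W \sum_(c : r.-tuple T) F (cons_tuple W c).
Proof.
rewrite pair_big /= (reindex (fun Wc : T * r.-tuple T => cons_tuple Wc.1 Wc.2)) //=.
exists (fun c : r.+1.-tuple T => (thead c, behead_tuple c)) => [[W c] _|c _] /=.
  by congr (_, _); apply/val_inj.
by rewrite [in RHS](tuple_eta c); apply/val_inj.
Qed.

Lemma walks_good j P C : walks p p (nset D) j P C != 0 -> p P C.
Proof. by case: j => [|j] /=; case: (p P C); rewrite ?mul0r ?eqxx. Qed.

(** Each step adds an element of D, which bounds the number of steps; this is why
    a chain of #|D| pairs can only start at a singleton. *)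
Lemma walks_card j P C : walks p p (nset D) j P C != 0 -> (#|` C| + j <= #|D|)%N.
Proof.
elim: j P C => [|j IH] P C nz.
  have /and4P[_ s _ _] := p_good (walks_good nz).
  rewrite addn0 -card_nset; apply: fsubset_leq_card.
  by apply: fsubset_trans s; apply: fsubsetUr.
have [/eqP z|] := boolP (has (fun v => walks p p (nset D) j (P `\ v) (v |` C) != 0)
   (nset D `\` C)); last first.
  move=> /hasPn z; case/eqP: nz; rewrite /= /moves big1_seq ?mulr0 // => v /andP[_ /z].
  by rewrite negbK => /eqP.
move: z => /eqP/hasP[v]; rewrite inE => /andP[vC _] /IH.
by rewrite cardfsU1 vC add1n addSnnS.
Qed.

Lemma sum_prec j (W : T) :
  \sum_(W' | pair_prec W W') walks p p (nset D) j (nset W'.1) (nset W'.2) =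
  moves (nset D) (walks p p (nset D) j) (nset W.1) (nset W.2).
Proof.
pose h (w : 'I_n) : T := ((W.1 :\ w)%SET, (w |: W.2)%SET).
have -> : \sum_(W' | pair_prec W W') walks p p (nset D) j (nset W'.1) (nset W'.2) =
    \sum_(W' in [set h w | w in ~: W.2]%SET) walks p p (nset D) j (nset W'.1) (nset W'.2).
  apply: eq_bigl => -[W1 W2]; apply/existsP/finset.imsetP => /= -[w].
    by move=> /and3P[wW /eqP /= -> /eqP ->]; exists w => //; rewrite inE.
  by rewrite inE => wW [-> ->]; exists w; rewrite wW !eqxx.
rewrite big_imset /=; last first.
  move=> v w; rewrite !inE => vW wW [_ /setP/(_ v)]; rewrite !inE eqxx (negbTE vW) !orbF.
  by case: eqP.
have fsh w : nset (W.1 :\ w)%SET = nset W.1 `\ val w /\ nset (w |: W.2)%SET = val w |`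
  nset W.2.
  by rewrite nsetD nsetU nset1.
rewrite /moves.
transitivity (\sum_(w in (D :\: W.2)%SET)
    walks p p (nset D) j (nset W.1 `\ val w) (val w |` nset W.2)).
  rewrite big_mkcond [RHS]big_mkcond; apply: eq_bigr => w _ /=.
  have [-> ->] := fsh w; rewrite !inE; case: (w \in W.2) => //=.
  case: (boolP (w \in D)) => // wD; apply/eqP; apply: contraNT wD => /walks_good/p_good.
  case/and4P => _ /fsubsetP/(_ (val w)); rewrite !inE eqxx orbT => /(_ isT).
  by rewrite mem_nset.
rewrite -nsetD -big_enum /=.
rewrite -(big_map val xpredT (fun v => walks p p (nset D) j (nset W.1 `\ v) (v |` nset
  W.2))).
apply/perm_big/uniq_perm => [||v].
- by rewrite map_inj_uniq ?enum_uniq //; exact: val_inj.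
- exact: fset_uniq.
apply/mapP/imfsetP => -[w wD ->]; exists w => //; move: wD; by rewrite mem_enum.
Qed.

Lemma sum_paths j (W : T) :
  \sum_(c : j.-tuple T) (all q (W :: c) && path (@pair_prec n) W c)%:R =
  walks p p (nset D) j (nset W.1) (nset W.2).
Proof.
elim: j W => [|j IH] W.
  rewrite (bigD1 [tuple]) //= big1 ?addr0 ?andbT // => c; by case/eqP; exact: tuple0.
rewrite big_tuple_cons /= -sum_prec mulr_sumr [RHS]big_mkcond /=.
apply: eq_bigr => W' _; case: ifP => WW'; last first.
  by apply: big1 => c _; rewrite andbF.
rewrite -IH mulr_sumr; apply: eq_bigr => c _.
rewrite -/(q W); case: (q W); by rewrite /= ?mul1r ?mul0r.
Qed.

Lemma card_chains :
  #|[set c : #|D|.-tuple T | all q c && sorted (@pair_prec n) c]%SET|%:R =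
  chains p (nset D) :> 'F_2.
Proof.
rewrite -sum1_card natr_sum big_mkcond /=.
have -> : \sum_(c : #|D|.-tuple T)
    (if c \in [set c : #|D|.-tuple T | all q c && sorted (@pair_prec n) c]%SET then 1%:R
      else 0) =
    \sum_(c : #|D|.-tuple T) (all q c && sorted (@pair_prec n) c)%:R :> 'F_2.
  by apply: eq_bigr => c _; rewrite inE; case: (_ && _).
rewrite /chains card_nset; case eD : #|D| => [|r].
  by rewrite (bigD1 [tuple]) //= big1 ?addr0 // => c; case/eqP; exact: tuple0.
rewrite big_tuple_cons.
transitivity (\sum_(W : T) walks p p (nset D) r (nset W.1) (nset W.2)).
  by apply: eq_bigr => W _; rewrite -sum_paths.
rewrite /starts.
have -> : \sum_(P <- fpowerset (nset D)) \sum_(w <- nset D) walks p p (nset D) r P [fset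
  w] =
    \sum_(Aw in finset.setX (powerset D) D)
      walks p p (nset D) r (nset Aw.1) (nset [set Aw.2]%SET).
  rewrite (eq_bigl (fun Aw : {set 'I_n} * 'I_n => (Aw.1 \in powerset D) && (Aw.2 \in
    D))); last first.
    by move=> [A w]; rewrite finset.in_setX.
  rewrite -(pair_big (mem (powerset D)) (mem D)
    (fun A w => walks p p (nset D) r (nset A) (nset [set w]%SET))) /=.
  rewrite -big_enum -(big_map (@nset n) xpredT
    (fun P => \sum_(w in D) walks p p (nset D) r P (nset [set w]%SET))) /=.
  transitivity (\sum_(P <- fpowerset (nset D)) \sum_(w in D) walks p p (nset D) r P
    (nset [set w]%SET)).
    apply: eq_bigr => P _; rewrite -big_enum.
    rewrite (eq_bigr (fun w => walks p p (nset D) r P [fset val w]));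
      last by move=> w _; rewrite nset1.
    rewrite -(big_map val xpredT (fun w => walks p p (nset D) r P [fset w])).
    apply/perm_big/uniq_perm => [||v]; first exact: fset_uniq.
      by rewrite map_inj_uniq ?enum_uniq //; exact: val_inj.
    by apply/imfsetP/mapP => -[w wD ->]; exists w => //; move: wD; rewrite mem_enum.
  apply/perm_big/uniq_perm => [||P]; first exact: fset_uniq.
    by rewrite map_inj_uniq ?enum_uniq //; exact: nset_inj.
  rewrite fpowersetE; apply/idP/mapP => [sP|[A]].
    have eP : nset (ordset n P) = P by apply: nset_ordset => u /(fsubsetP sP)/nset_bound.
    by exists (ordset n P) => //; rewrite mem_enum powersetE -nsetS eP.
  by rewrite mem_enum powersetE => AD ->; rewrite nsetS.
rewrite [LHS](bigID (fun W : T => (W.1 \subset D) && (W.2 \subset D) && (#|W.2| ==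
  1%N))) /=.
rewrite [X in _ + X]big1 ?addr0; last first.
  move=> W nW; apply/eqP; apply: contraNT nW => nz.
  have /and4P[_ s EP nE] := p_good (walks_good nz).
  have := walks_card nz; rewrite eD card_nset.
  move: s; rewrite fsubUset !nsetS => /andP[-> ->] /= le.
  rewrite eqn_leq; apply/andP; split; first by lia.
  rewrite lt0n cards_eq0; apply: contra nE => /eqP ->.
  by rewrite nset0 fsetU0.
pose h (Aw : {set 'I_n} * 'I_n) : T := (Aw.1, [set Aw.2]%SET).
rewrite -(big_imset (h := h) (fun W => walks p p (nset D) r (nset W.1) (nset W.2))) /=;
  last first.
  by move=> [A v] [B w] _ _ [-> /finset.set1_inj ->].
apply: eq_bigl => -[A B]; apply/andP/finset.imsetP => /= [[/andP[AD BD] /cards1P[w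
  eB]]|[[A' w]]].
  exists (A, w); last by rewrite eB.
  by rewrite finset.in_setX powersetE AD /=; move: BD; rewrite eB finset.sub1set.
by rewrite finset.in_setX powersetE /= => /andP[AD wD] [-> ->];
  rewrite AD finset.sub1set wD cards1.
Qed.

End TupleCount.

(** * Multiplicities of pairs of elements *)

(** An ordered object that sits in a category with unique factorisations, with
    its order (c = true) or with the reversed one (c = false), the latter when
    the dimensions are shifted by one. *)
Section Embedding.
Variables (F : ufcat) (Z : burnside_sset) (o : ordering Z) (c : bool).
Variable emb : elt (bd Z) -> mor F.
Hypothesis emb_inj : injective emb.
Hypothesis emb_lab : forall e, lab (emb e) = elt_lab e.
Hypothesis emb_src : forall e e', elt_src e = elt_src e' -> src (emb e) = src (emb e').
Hypothesis emb_splits : forall P e u v, splits P e u v ->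
  head P (emb e) = emb u /\ tail P (emb e) = emb v.
Hypothesis emb_lt : forall e e',
  lt (emb e) (emb e') = `[< if c then elt_lt o e e' else elt_lt o e' e >].

Lemma lam1_splits n k k1 (U : face n k) (V1 : face n k1) (h : V1 \subset U) (s : bd Z U) :
  splits (nset V1) (Elt s) (Elt (lam1 h s)) (Elt (snd_leg (mu (cuts_cut_face h) s))).
Proof. by exists k1, V1, (U :\: V1)%SET, (cut_face h), (cuts_cut_face h). Qed.

Section Pair.
Variables (n kU kV : nat) (U : face n kU) (V : face n kV) (s : bd Z U) (t : bd Z V).
Hypothesis src_st : source s = source t.

(** The two notions of goodness are not literally the same: one compares the
    middle parts, the other one the elements cut at the union of the two sets.
    Injectivity of mu shows that they are equivalent when the first parts
    agree. *)
Lemma positive_emb (W : {set 'I_n} * {set 'I_n}) :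
  positive_good o s t W <->
  positive (odd (n + #|U| + #|V|) == c) (emb (Elt s)) (emb (Elt t)) (nset W.1) (nset W.2).
Proof.
rewrite /positive /good !emb_lab /= -nsetU -nsetI nsetS finset.subsetI nset_disjoint.
set b := odd _.
have [hU|nU] := orP (orbN ((W.1 :|: W.2)%SET \subset U)); last first.
  by rewrite (negbTE nU) andbF; split=> // -[h]; rewrite h in nU.
have [hV|nV] := orP (orbN ((W.1 :|: W.2)%SET \subset V)); last first.
  by rewrite (negbTE nV) !andbF; split=> // -[hU' [h]]; rewrite h in nV.
rewrite hU hV /=.
set Wp := set_face W.1; set Wb := set_face (W.1 :|: W.2)%SET.
pose hW : Wp \subset Wb := finset.subsetUl W.1 W.2.
have {}hU : Wb \subset U := hU; have {}hV : Wb \subset V := hV.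
have [hs1 hs2] := emb_splits (lam1_splits (V1 := Wb) hU s).
have [ht1 ht2] := emb_splits (lam1_splits (V1 := Wb) hV t).
have [ps1 _] := emb_splits (lam1_splits (V1 := Wp) (fintype.subset_trans hW hU) s).
have [pt1 _] := emb_splits (lam1_splits (V1 := Wp) (fintype.subset_trans hW hV) t).
have [qs1 qs2] := emb_splits (lam1_splits (V1 := Wp) hW (lam1 (V1 := Wb) hU s)).
have [qt1 qt2] := emb_splits (lam1_splits (V1 := Wp) hW (lam1 (V1 := Wb) hV t)).
rewrite -[snd_leg _]/(lam2 hW hU s) in qs2.
rewrite -[snd_leg _]/(lam2 hW hV t) in qt2.
have [sp sb] : nset W.1 `<=` nset (W.1 :|: W.2)%SET /\ nset (W.1 :|: W.2)%SET `<=` lab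
  (emb (Elt s)).
  by rewrite emb_lab !nsetS finset.subsetUl.
have tb : nset (W.1 :|: W.2)%SET `<=` lab (emb (Elt t)) by rewrite emb_lab !nsetS.
have cs : fst_leg (mu (cuts_cut_face hW) (lam1 hU s)) = lam1 (fintype.subset_trans hW
  hU) s.
  apply/Elt_inj/emb_inj; rewrite -ps1 -[in RHS](head_head sp sb) hs1.
  exact: esym qs1.
have ct : fst_leg (mu (cuts_cut_face hW) (lam1 hV t)) = lam1 (fintype.subset_trans hW
  hV) t.
  apply/Elt_inj/emb_inj; rewrite -pt1 -[in RHS](head_head sp tb) ht1.
  exact: esym qt1.
rewrite /agree /mid -nsetU ps1 pt1 hs1 ht1 qs2 qt2 !(inj_eq emb_inj) !emb_lt.
have eqE k' (U' : face n k') (u v : bd Z U') : (Elt u == Elt v) = `[< u = v >].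
  by apply/eqP/asboolP => [/Elt_inj|->].
rewrite !eqE; split=> [[hU' [hV' []]]|].
  rewrite (bool_irrelevance hU' hU) (bool_irrelevance hV' hV) => dW e1 ne pos.
  rewrite dW /=; apply/andP; split; last first.
    by move: pos; rewrite -/b; case: (b); case: (c) => /= h; apply/asboolP/elt_ltE.
  apply/andP; split; first by apply/asboolP.
  apply/asboolPn => e; apply: ne.
  exact: (congr1 (fun z => snd_leg (mu (cuts_cut_face hW) z)) e).
case/andP => /and3P[dW /asboolP e1 /asboolPn ne] pos; exists hU, hV; split=> //.
  move=> e2; apply: ne; apply: (mu_inj (h := cuts_cut_face hW)) => //.
  by rewrite cs ct.
by move: pos; rewrite -/b; case: (b); case: (c) => /= /asboolP /elt_ltE.
Qed.

Lemma mult_emb :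
  mult (odd (n + #|U| + #|V|) == c) (emb (Elt s)) (emb (Elt t)) =
  (#|positive_chains o s t|)%:R.
Proof.
rewrite /mult !emb_lab /= -nsetI.
rewrite -(@card_chains _ _ (agree (emb (Elt s)) (emb (Elt t)))).
- congr (_%:R); apply: eq_card => w; rewrite !inE; congr (_ && _).
  apply/all_tnthP/asboolP => h i; first exact/positive_emb.
  by have /positive_emb := h i.
- by apply: agree0; apply: emb_src => /=; rewrite src_st.
by move=> P C /good_of_positive; rewrite !emb_lab /= -nsetI.
Qed.

End Pair.
End Embedding.

(** * Sequences with repetitions and admissible pairs *)

Section RepSeq.
Variable m : nat.
Implicit Types (U : seq 'I_m) (A B : {set 'I_m}).

Lemma rep_count U u : is_rep_seq U ->
  count_mem u U = ((u \in rep_minus U) + (u \in rep_plus U))%N.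
Proof.
move=> /andP[_ /forallP/(_ u)]; rewrite !inE.
by case: (count_mem u U) => [|[|[|k]]] //= _; case: odd.
Qed.

(** The entries up to u and the gap below u make up the u + 1 vertices up to u. *)
Lemma rep_index_odd U u : is_rep_seq U -> u \in U ->
  odd (rep_index U u) = ~~ odd (gap (nset (rep_minus U) `|` nset (rep_plus U)) u).
Proof.
move=> hU uU; set S := _ `|` _.
have mS (v : 'I_m) : (val v \in S) = (v \in U).
  rewrite /S inE !mem_nset -has_pred1 has_count rep_count //.
  by case: (_ \in _); case: (_ \in _).
rewrite /rep_index.
have -> : #|[set v in U | (v <= u)%N]%SET| = count (mem S) (iota 0 u.+1).
  rewrite -card_nset -size_filter; apply/perm_size/uniq_perm; rewrite ?fset_uniq //.
    by rewrite filter_uniq // iota_uniq.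
  move=> v; rewrite mem_filter mem_iota /= add0n ltnS; apply/imfsetP/andP.
    by case=> w /=; rewrite inE => /andP[wU wu] ->; rewrite mS.
  case=> vS vu; have vm : (v < m)%N by apply: leq_ltn_trans vu (ltn_ord u).
  exists (Ordinal vm) => //=; rewrite inE /= vu andbT.
  by rewrite -mS.
have := count_predC (mem S) (iota 0 u.+1); rewrite size_iota.
rewrite -[count (predC _) _]/(gap S u.+1) gapS mS uU addn0 => e.
move: (count (mem S) _) e => c /(congr1 odd); rewrite !oddD /=.
by case: (odd u); case: (odd c); case: (odd (gap S u)).
Qed.

Lemma rep_admissible U : is_rep_seq U -> admissible (nset (rep_minus U)) (nset (rep_plus
  U)).
Proof.
move=> hU; apply/allP => v; rewrite /symdiff inE => vS.
have [u vu] : exists u : 'I_m, v = u.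
  have vm : (v < m)%N by case/orP: vS; rewrite inE => /andP[_ /nset_bound].
  by exists (Ordinal vm).
subst v; move: vS; rewrite /in_place !inE !mem_nset.
have uU : (u \in U) = (0 < (u \in rep_minus U) + (u \in rep_plus U))%N.
  by rewrite -rep_count // -has_count has_pred1.
move: uU; have c1 := rep_count u hU; have i1 := @rep_index_odd U u hU; move: c1 i1;
  rewrite !inE.
case: (count_mem u U) => [|[|[|k]]] //= ; case: (odd (rep_index U u)) => //= _ h uU _;
  by rewrite -h ?uU.
Qed.

Lemma rep_size U : is_rep_seq U -> (#|rep_minus U| + #|rep_plus U|)%N = size U.
Proof.
move=> hU; rewrite -[RHS]sum1_size.
rewrite -!sum1_card big_mkcond [X in (_ + X)%N]big_mkcond -big_split /=.
transitivity (\sum_(u : 'I_m) count_mem u U)%N.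
  by apply: eq_bigr => u _; rewrite rep_count //; do 2!case: ifP => _.
rewrite (eq_bigr (fun u => \sum_(v <- U | v == u) 1)%N); last by move=> u _;
  rewrite sum1_count.
rewrite (exchange_big_dep xpredT) //=; apply: eq_bigr => v _.
by rewrite (big_pred1 v) // => u; rewrite eq_sym.
Qed.

Lemma rep_inj U U' : is_rep_seq U -> is_rep_seq U' ->
  rep_minus U = rep_minus U' -> rep_plus U = rep_plus U' -> U = U'.
Proof.
move=> hU hU' em ep; apply: (inj_map val_inj).
case/andP: (hU) (hU') => sU _ /andP[sU' _].
apply: (sorted_eq leq_trans anti_leq sU sU'); apply: perm_map.
by apply/allP => u _ /=; rewrite !rep_count // em ep.
Qed.

Lemma rep_ex A B : admissible (nset A) (nset B) ->
  exists U, [/\ is_rep_seq U, rep_minus U = A & rep_plus U = B].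
Proof.
move=> /allP adm; pose U := sort (relpre val leq) (enum A ++ enum B).
have cU u : count_mem u U = ((u \in A) + (u \in B))%N.
  have /permP -> : perm_eq U (enum A ++ enum B) by rewrite perm_sort.
  by rewrite count_cat !count_uniq_mem ?enum_uniq // !mem_enum.
have hU : is_rep_seq U.
  apply/andP; split; last first.
    by apply/forallP => u; rewrite cU; case: (_ \in _); case: (_ \in _).
  by rewrite sorted_map; apply: sort_sorted => u v /=; exact: leq_total.
have eS : nset (rep_minus U) `|` nset (rep_plus U) = nset A `|` nset B.
  rewrite -!nsetU; congr nset; apply/setP => u; rewrite !finset.in_setU.
  have := rep_count u hU; rewrite cU.
  by case: (u \in A); case: (u \in B); case: (_ \in _); case: (_ \in _).
have idx u : u \in U -> odd (rep_index U u) = ~~ odd (gap (nset A `|` nset B) u).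
  by move=> uU; rewrite rep_index_odd // eS.
have admu (u : 'I_m) : (u \in A) != (u \in B) -> odd (rep_index U u) = (u \in A).
  move=> uAB; rewrite idx; last first.
    by rewrite -has_pred1 has_count cU; move: uAB; case: (_ \in _); case: (_ \in _).
  have /eqP : in_place (nset A) (nset B) u.
    apply: adm; rewrite /symdiff !inE !mem_nset.
    by move: uAB; case: (_ \in _); case: (_ \in _).
  by rewrite mem_nset.
exists U; split=> //; apply/setP => u; rewrite inE cU.
  by have := @admu u; case: (u \in A); case: (u \in B) => //= ->.
by have := @admu u; case: (u \in A); case: (u \in B) => //= ->.
Qed.

Lemma sum_rep (q : nat) (Phi : {set 'I_m} -> {set 'I_m} -> 'F_2) :
  \sum_(U : q.-tuple 'I_m | is_rep_seq U) Phi (rep_minus U) (rep_plus U) =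
  \sum_A \sum_B (if admissible (nset A) (nset B) && (#|A| + #|B| == q)%N
                  then Phi A B else 0).
Proof.
rewrite pair_big /= -big_mkcond /= -big_filter -[RHS]big_filter.
rewrite -(big_map (fun U : q.-tuple 'I_m => (rep_minus U, rep_plus U)) xpredT
  (fun AB => Phi AB.1 AB.2)).
apply/perm_big/uniq_perm; rewrite ?filter_uniq ?index_enum_uniq //.
  rewrite map_inj_in_uniq ?filter_uniq ?index_enum_uniq // => U U'.
  rewrite !mem_filter => /andP[hU _] /andP[hU' _] [em ep].
  by apply: val_inj; exact: rep_inj.
move=> [A B]; rewrite mem_filter mem_index_enum andbT /=.
apply/mapP/andP => [[U]|[adm /eqP sz]].
  rewrite mem_filter => /andP[hU _] [-> ->].
  by rewrite rep_admissible // rep_size // size_tuple.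
have [U [hU eA eB]] := rep_ex adm.
have szU : size U == q by rewrite -rep_size // eA eB sz.
exists (Tuple szU); last by rewrite /= eA eB.
by rewrite mem_filter mem_index_enum hU.
Qed.

End RepSeq.

(** * The products as sums over pairs of elements *)

(** The coefficients N s t are left free because they are taken from the cone. *)
Lemma cupE (Z : burnside_sset) (o : ordering Z) (k : int) (p q r : nat)
    (a : cochain 'F_2 Z p) (b : cochain 'F_2 Z q) (x : simp Z r)
    (N : elt (bd Z) -> elt (bd Z) -> 'F_2) :
  (forall n kU kV (U : face n kU) (V : face n kV) (s : bd Z U) (t : bd Z V),
     source s = source t -> N (Elt s) (Elt t) = (#|positive_chains o s t|)%:R) ->
  cup o k r a b x =
  \sum_(s <- elt_out (bd Z) (Tagged (simp Z) x)) \sum_(t <- elt_out (bd Z) (Tagged (simp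
    Z) x))
    (if admissible (elt_lab s) (elt_lab t) &&
        ((#|` elt_lab s| + #|` elt_lab t|)%:Z + k + 1 == r%:Z)
     then N s t else 0) * extend a (elt_tgt s) * extend b (elt_tgt t).
Proof.
move=> hN; rewrite /cup /nabla.
pose phi (y : simplex Z * simplex Z) := extend a y.1 * extend b y.2.
pose Phi (A B : {set 'I_r}) : 'F_2 :=
  \sum_(s <- fset_set (fibre (bd Z (set_face A)) x))
  \sum_(t <- fset_set (fibre (bd Z (set_face B)) x))
    N (Elt s) (Elt t) * extend a (elt_tgt (Elt s)) * extend b (elt_tgt (Elt t)).
have -> : \sum_(s <- elt_out (bd Z) (Tagged (simp Z) x)) \sum_(t <- elt_out (bd Z)
  (Tagged (simp Z) x))
    (if admissible (elt_lab s) (elt_lab t) &&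
        ((#|` elt_lab s| + #|` elt_lab t|)%:Z + k + 1 == r%:Z)
     then N s t else 0) * extend a (elt_tgt s) * extend b (elt_tgt t) =
    \sum_A \sum_B (if admissible (nset A) (nset B) && ((#|A| + #|B|)%:Z + k + 1 == r%:Z)
      then Phi A B else 0).
  rewrite /elt_out big_allpairs_dep /= big_enum /=; apply: eq_bigr => A _.
  under eq_bigr do rewrite big_allpairs_dep /= big_enum /=.
  rewrite exchange_big /=; apply: eq_bigr => B _; rewrite !card_nset.
  case: ifP => _ //; rewrite big1 // => s _; rewrite big1 // => t _.
  by rewrite !mul0r.
case e : (r%:Z - 1 - k) => [d|d]; last first.
  rewrite /eval fglift0; apply/esym/big1 => A _; apply: big1 => B _.
  by case: eqP => [h|_]; rewrite ?andbF //; move: e h; lia.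
rewrite /eval (big_morph _ (fgliftD _) (fglift0 _)).
transitivity (\sum_(U : d.-tuple 'I_r | is_rep_seq U) Phi (rep_minus U) (rep_plus U)).
  apply: eq_bigr => U _; rewrite fsbig_finite; last first.
    by apply: finite_setX; exact: fibre_finite.
  rewrite (big_morph _ (fgliftD _) (fglift0 _)) /Phi.
  set A := rep_minus U; set B := rep_plus U.
  have mA s : (s \in fset_set (fibre (bd Z (set_face A)) x)) = (source s == x).
    exact: mem_fibre.
  have mB t : (t \in fset_set (fibre (bd Z (set_face B)) x)) = (source t == x).
    exact: mem_fibre.
  transitivity (\sum_(st <- [seq (s, t) | s <- fset_set (fibre (bd Z (set_face A)) x),
                                         t <- fset_set (fibre (bd Z (set_face B)) x)])
      N (Elt st.1) (Elt st.2) * extend a (elt_tgt (Elt st.1)) * extend b (elt_tgt (Elt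
        st.2))); last first.
    by rewrite big_allpairs_dep.
  transitivity (\sum_(st <- fset_set (fibre (bd Z (set_face A)) x `*` fibre (bd Z
    (set_face B)) x)%classic)
      N (Elt st.1) (Elt st.2) * extend a (elt_tgt (Elt st.1)) * extend b (elt_tgt (Elt
        st.2))).
    apply: eq_big_seq => -[s t] /=; rewrite in_fset_set; last first.
      by apply: finite_setX; exact: fibre_finite.
    rewrite inE /= => -[sx tx]; rewrite fgliftZ fglift1 /= -mulrA; congr (_ * _).
    by rewrite hN // sx tx.
  apply/perm_big/uniq_perm; first exact: fset_uniq.
    by apply: allpairs_uniq_dep => [|s _|[s t] [s' t'] _ _ [-> ->]] //; exact: fset_uniq.
  move=> [s t]; rewrite -[LHS]/((s, t) \in fset_set _) in_fset_set; last first.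
    by apply: finite_setX; exact: fibre_finite.
  apply/idP/allpairsPdep; first rewrite inE /= => -[sx tx].
    by exists s, t; split; rewrite ?mA ?mB ?sx ?tx.
  by case=> s' [t' []]; rewrite mA mB => /eqP sx /eqP tx [-> ->]; rewrite inE.
rewrite sum_rep; apply: eq_bigr => A _; apply: eq_bigr => B _.
have -> // : ((#|A| + #|B|)%:Z + k + 1 == r%:Z) = (#|A| + #|B| == d)%N.
by move: e; lia.
Qed.

(** * Evaluating the products of the cone *)

Lemma extend_tagged (Z : burnside_sset) m (a : cochain 'F_2 Z m) (x : simp Z m) :
  extend a (Tagged (simp Z) x) = a x.
Proof. by rewrite /extend untagE. Qed.

Lemma sum_faces (Z : burnside_sset) (phi : simplex Z -> 'F_2) r (x : simp Z r.+1) :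
  \sum_(e <- elt_out (bd Z) (Tagged (simp Z) x) | #|` elt_lab e| == 1%N) phi (elt_tgt e) =
  coboundary (fun y => phi (Tagged (simp Z) y) : 'F_2) x.
Proof.
rewrite coboundaryE.
transitivity (\sum_(e <- [seq Elt (Sp := bd Z) s | i <- enum 'I_r.+1,
     s <- fset_set (fibre (bd Z (face1 i)) x)]) phi (elt_tgt e)); last first.
  rewrite big_allpairs_dep /= big_enum /=; apply: eq_bigr => i _.
  have -> : (-1) ^+ i = 1 :> 'F_2.
    by rewrite (_ : -1 = 1 :> 'F_2) ?expr1n //; exact/val_inj.
  by rewrite mul1r starE.
rewrite -[LHS]big_filter; apply/perm_big/uniq_perm.
- by rewrite filter_uniq // elt_out_uniq.
- apply: allpairs_uniq_dep => [|i _|[i s] [j t] _ _ /= e]; rewrite ?enum_uniq //.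
  have ij : i = j.
    have := congr1 (@elt_lab _ _ _) e; rewrite /= !nset1 => /fsetP/(_ (val i)).
    by rewrite !inE eqxx; case: eqP => // /val_inj.
  by subst j; congr existT; exact: Elt_inj.
move=> e; rewrite mem_filter mem_elt_out.
apply/andP/allpairsPdep => [[/cardfs1P[u eu] /eqP ex]|[i [s [_ hs ->]]]]; last first.
  move: hs; rewrite mem_fibre /= => /eqP ->.
  by rewrite nset1 cardfs1 !eqxx.
have lv : elt_level e = r.+1 by case: e ex {eu} => n k U s /= /(congr1 tag).
have ur : (u < r.+1)%N.
  have : u \in elt_lab e by rewrite eu inE.
  by rewrite -lv; case: e {eu ex lv} => n k U s /= /nset_bound.
have [s es] : exists s : bd Z (face1 (Ordinal ur)), e = Elt s.
  by apply: Elt_retype; rewrite ?eu ?nset1.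
exists (Ordinal ur), s; split=> //; first by rewrite mem_enum.
rewrite mem_fibre; apply/eqP.
by move: ex; rewrite es => ex; exact: (existT_inj ex).
Qed.

Lemma sum_faces0 (Z : burnside_sset) (phi : simplex Z -> 'F_2) (x : simp Z 0) :
  \sum_(e <- elt_out (bd Z) (Tagged (simp Z) x) | #|` elt_lab e| == 1%N) phi (elt_tgt e)
    = 0.
Proof.
apply: big1_seq => e /andP[/eqP c]; rewrite mem_elt_out => /eqP ex.
by have := elt_dim e; rewrite ex c /= addn1.
Qed.

Lemma nset_face0 n : nset (face0 n) = fset0.
Proof. exact: nset0. Qed.

Lemma star_id (Z : choiceType) (a : Z -> 'F_2) z : star (span_id Z) a z = a z.
Proof.
rewrite starE (_ : fibre (span_id Z) z = [set z]%classic); last first.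
  by apply/predeqP => e; rewrite /fibre /=.
by rewrite fset_set1 big_seq_fset1.
Qed.

Lemma extend_level (Z : burnside_sset) m (a : cochain 'F_2 Z m) n (x : simp Z n) :
  n != m -> extend a (Tagged (simp Z) x) = 0.
Proof. by move=> nm; rewrite /extend untag_dflt. Qed.

Lemma sum_faces_extend (Z : burnside_sset) m (a : cochain 'F_2 Z m) (z : simplex Z) :
  \sum_(e <- elt_out (bd Z) z | #|` elt_lab e| == 1%N) extend a (elt_tgt e) =
  extend (coboundary a) z.
Proof.
case: z => -[x|n x]; first by rewrite sum_faces0 extend_level.
rewrite -[existT _ _ _]/(Tagged (simp Z) x) sum_faces; have [e|nm] := eqVneq n m.
  subst n; rewrite extend_tagged; congr (coboundary _ _); apply/funext => y.
  exact: extend_tagged.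
rewrite extend_level // coboundaryE big1 // => i _; rewrite starE big1 ?mulr0 // => s _.
exact: extend_level.
Qed.

Section ConeProducts.
Variables (X Y : burnside_sset) (f : burnside_map X Y).
Variables (oX : ordering X) (oY : ordering Y).
Let F := cone f oX oY.

(** The only face whose vertex set is the apex alone: bd over the empty face is
    the identity span, so what remains is f. *)
Lemma sum_apex (phi : simplex Y -> 'F_2) r (x : simp X r) :
  \sum_(e <- elt_out (fbd f) (Tagged (simp X) x) | #|` elt_level e |` elt_lab e| == 1%N)
     phi (elt_tgt e) =
  pullback f (fun y => phi (Tagged (simp Y) y) : 'F_2) x.
Proof.
rewrite /pullback eval_span_lin -[RHS]star_id.
have [g] := bd_empty X r; rewrite (star_iso _ _ g) -star_comp starE.
transitivity (\sum_(e <- map (@Elt _ _ (fbd f) r r (face0 r))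
   (fset_set (fibre (fbd f (face0 r)) x))) phi (elt_tgt e)); last by rewrite big_map.
rewrite -[LHS]big_filter; apply/perm_big/uniq_perm.
- by rewrite filter_uniq // elt_out_uniq.
- rewrite map_inj_uniq; [exact: fset_uniq | exact: Elt_inj].
move=> e; rewrite mem_filter mem_elt_out.
apply/andP/mapP => [[c /eqP ex]|[s]]; last first.
  rewrite mem_fibre /= => /eqP sx ->.
  by rewrite /= nset_face0 fsetU0 cardfs1 /= -sx.
have lv : elt_level e = r by case: e ex {c} => n k U s /= /(congr1 tag).
have le : elt_lab e = nset (face0 r).
  rewrite nset_face0; move: c; rewrite cardfsU1.
  have -> /= : elt_level e \notin elt_lab e by case: e {ex lv} => n k U s;
    exact: nset_notin_n.
  by rewrite add1n eqSS cardfs_eq0 => /eqP.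
have [s es] := Elt_retype lv le.
exists s => //; rewrite mem_fibre; apply/eqP.
by move: ex; rewrite es => ex; exact: (existT_inj ex).
Qed.

Definition onY m (a : cochain 'F_2 Y m) : ob F -> 'F_2 :=
  fun z => match z with inl y => extend a y | inr _ => 0 end.
Definition onX m (a : cochain 'F_2 X m) : ob F -> 'F_2 :=
  fun z => match z with inl _ => 0 | inr x => extend a x end.

Lemma cobound_inl (phi : ob F -> 'F_2) (y : simplex Y) :
  cobound phi (inl y) = \sum_(e <- elt_out (bd Y) y | #|` elt_lab e| == 1%N) phi (inl
    (elt_tgt e)).
Proof. by rewrite /cobound /= big_map. Qed.

Lemma cobound_inr (phi : ob F -> 'F_2) (x : simplex X) :
  cobound phi (inr x) =
  \sum_(e <- elt_out (bd X) x | #|` elt_lab e| == 1%N) phi (inr (elt_tgt e)) +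
  \sum_(e <- elt_out (fbd f) x | #|` elt_level e |` elt_lab e| == 1%N) phi (inl (elt_tgt
    e)).
Proof. by rewrite /cobound /= big_cat !big_map. Qed.

(** The boundary of a simplex of X in the cone has one face in Y, through f.  So a
    cocycle of Y extended by zero has its pullback as coboundary. *)
Lemma cobound_onY m (a : cochain 'F_2 Y m) z :
  cobound (onY a) z = onY (coboundary a) z + onX (pullback f a) z.
Proof.
case: z => [y|[n x]]; first by rewrite cobound_inl /= addr0 sum_faces_extend.
rewrite cobound_inr /= big1 // !add0r -[existT _ _ _]/(Tagged (simp X) x) sum_apex.
have [e|nm] := eqVneq n m.
  subst n; rewrite extend_tagged; congr (pullback _ _ _); apply/funext => y.
  exact: extend_tagged.
rewrite extend_level // /pullback eval_span_lin starE big1 // => s _.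
exact: extend_level.
Qed.

Lemma cobound_onX m (a : cochain 'F_2 X m) z : cobound (onX a) z = onX (coboundary a) z.
Proof.
case: z => [y|x]; first by rewrite cobound_inl /= big1.
by rewrite cobound_inr /= [X in _ + X]big1 // addr0 sum_faces_extend.
Qed.

Lemma MY_splits P e u v : splits P e u v ->
  @head F P (MY f e) = MY f u /\ @tail F P (MY f e) = MY f v.
Proof. by move=> h; apply: csplitsE; exists u, v. Qed.

Lemma MX_splits P e u v : splits P e u v ->
  @head F P (MX f e) = MX f u /\ @tail F P (MX f e) = MX f v.
Proof. by move=> h; apply: csplitsE; exists u, v. Qed.

Lemma product_inl (k : int) p q r (a : cochain 'F_2 Y p) (b : cochain 'F_2 Y q)
    (phi chi : ob F -> 'F_2) (y : simp Y r) :
  (forall z, phi (inl z) = extend a z) -> (forall z, chi (inl z) = extend b z) ->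
  product k phi chi (inl (Tagged (simp Y) y)) = cup oY k r a b y.
Proof.
move=> hphi hchi; rewrite (@cupE _ _ _ _ _ _ _ _ _ (fun s t => @mult F
  (odd (tag (elt_src s) + #|` elt_lab s| + #|` elt_lab t|)) (MY f s) (MY f t)));
    last first.
  move=> n kU kV U V s t st; rewrite /= !card_nset.
  rewrite -(mult_emb (F := F) (c := true) (emb := MY f)) //; first by case: odd.
  - exact: MY_inj.
  - by move=> e e' /= ->.
  - exact: MY_splits.
rewrite /product /= big_map; apply: eq_big_seq => s; rewrite mem_elt_out => /eqP sy.
rewrite big_map; apply: eq_bigr => t _ /=.
by rewrite hphi hchi /coef /= sy.
Qed.

(** Only the faces avoiding the apex contribute.  They are those of X, in a
    simplex of one dimension more, hence the shift of k. *)
Lemma product_inr (k : int) p q r (a : cochain 'F_2 X p) (b : cochain 'F_2 X q)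
    (x : simp X r) :
  product (k + 1) (onX a) (onX b) (inr (Tagged (simp X) x)) = cup oX k r a b x.
Proof.
rewrite (@cupE _ _ _ _ _ _ _ _ _ (fun s t => @mult F
  (odd (tag (elt_src s) + #|` elt_lab s| + #|` elt_lab t|).+1) (MX f s) (MX f t)));
    last first.
  move=> n kU kV U V s t st; rewrite /= !card_nset.
  rewrite -(mult_emb (F := F) (c := false) (emb := MX f)) //; first by case: odd.
  - exact: MX_inj.
  - by move=> e e' /= ->.
  - exact: MX_splits.
rewrite /product /= big_cat /= [X in _ + X]big_map [X in _ + X]big1 ?addr0; last first.
  by move=> s _; apply: big1 => t _; rewrite /= mulr0 mul0r.
rewrite big_map; apply: eq_big_seq => s; rewrite mem_elt_out => /eqP sx.
rewrite big_cat /= !big_map [X in _ + X]big1 ?addr0; last first.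
  by move=> t _; rewrite /= mulr0.
(* The level of x in the cone is r + 1. *)
have shift (w : nat) : (w%:Z + (k + 1) + 1 == r.+1%:Z) = (w%:Z + k + 1 == r%:Z).
  by apply/eqP/eqP; lia.
by apply: eq_bigr => t _ /=; rewrite /coef /= sx /= shift.
Qed.

End ConeProducts.

(** * The identity map *)

Section IdentityMap.
Variable X : burnside_sset.

Definition id_swap n k (U : face n k)
    (p : span_comp (span_id (simp X k)) (bd X U)) :
    span_comp (bd X U) (span_id (simp X n)) :=
  exist (fun q : simp X n * bd X U => q.1 == source q.2)
    (source (fst_leg p), fst_leg p) (eqxx _).

Lemma id_swap_bij n k (U : face n k) : bijective (@id_swap n k U).
Proof.
pose back (q : span_comp (bd X U) (span_id (simp X n))) :
    span_comp (span_id (simp X k)) (bd X U) :=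
  exist (fun p : bd X U * simp X k => target p.1 == p.2)
    (snd_leg q, target (snd_leg q)) (eqxx _).
exists back => p; apply: legs_inj => //=.
- exact: legs_match p.
- exact: esym (legs_match p).
Qed.

Definition id_bd n k (U : face n k) :=
  SpanIso (@id_swap_bij n k U) (fun p => erefl) (fun p => legs_match p).

Lemma id_map_empty n (x : span_comp (span_id (simp X n)) (bd X (face0 n))) :
  fst_leg (id_bd (face0 n) x) = snd_leg x.
Proof.
rewrite -[RHS]/(source (snd_leg x)) -legs_match.
have [g] := bd_empty X n; have [a ea] := iso_onto g (fst_leg x).
rewrite -[LHS]/(source (fst_leg x)) -ea.
exact: etrans (iso_source g a) (esym (iso_target g a)).
Qed.

Lemma id_map_mu n k1 k2 (U : face n k2) (V1 : face n k1) (V2 : {set 'I_n})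
    (W : face k1 k2) (h : cuts U V1 V2 W)
    (x : span_comp (span_id (simp X k2)) (bd X U))
    (y : span_comp (span_id (simp X k2)) (bd X W))
    (z : span_comp (span_id (simp X k1)) (bd X V1)) :
  fst_leg y = snd_leg (mu h (fst_leg x)) -> snd_leg y = snd_leg x ->
  fst_leg z = fst_leg (mu h (fst_leg x)) ->
  snd_leg z = fst_leg (id_bd W y) ->
  [/\ fst_leg (id_bd U x) = fst_leg (id_bd V1 z),
      fst_leg (mu h (snd_leg (id_bd U x))) = snd_leg (id_bd V1 z) &
      snd_leg (mu h (snd_leg (id_bd U x))) = snd_leg (id_bd W y)].
Proof.
move=> ey _ ez _; split=> //.
by rewrite -[LHS]/(source (fst_leg x)) -[RHS]/(source (fst_leg z)) ez mu_source.
Qed.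

Definition id_map : burnside_map X X :=
  @BurnsideMap X X (fun n => span_id (simp X n)) id_bd id_map_empty id_map_mu.

Lemma pullback_id m (a : cochain 'F_2 X m) : pullback id_map a = a.
Proof. by apply/funext => x; rewrite /pullback eval_span_lin star_id. Qed.

End IdentityMap.

(** * The products on cochains *)

Section Products.
Variables (X : burnside_sset) (o : ordering X).

Lemma evalD (T : choiceType) (a b : T -> 'F_2) c :
  eval (fun x => a x + b x) c = eval a c + eval b c.
Proof.
rewrite /eval !fgliftE -big_split; apply: eq_bigr => x _ /=.
exact: mulrDr.
Qed.

Lemma extendD m (a b : cochain 'F_2 X m) z : extend (a + b) z = extend a z + extend b z.
Proof.
case: z => n x; rewrite -[existT _ _ _]/(Tagged (simp X) x).
have [e|nm] := eqVneq n m; last by rewrite !extend_level // addr0.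
by subst n; rewrite !extend_tagged.
Qed.

Lemma extend0 m z : extend (0 : cochain 'F_2 X m) z = 0.
Proof.
case: z => n x; rewrite -[existT _ _ _]/(Tagged (simp X) x).
have [e|nm] := eqVneq n m; last by rewrite extend_level.
by subst n; rewrite extend_tagged.
Qed.

Lemma cupDl k p q r (a a' : cochain 'F_2 X p) (b : cochain 'F_2 X q) :
  cup o k r (a + a') b = cup o k r a b + cup o k r a' b.
Proof.
apply/funext => x; rewrite -[RHS]/(cup o k r a b x + cup o k r a' b x) /cup -evalD.
by congr eval; apply/funext => z; rewrite extendD mulrDl.
Qed.

Lemma cupDr k p q r (a : cochain 'F_2 X p) (b b' : cochain 'F_2 X q) :
  cup o k r a (b + b') = cup o k r a b + cup o k r a b'.
Proof.
apply/funext => x; rewrite -[RHS]/(cup o k r a b x + cup o k r a b' x) /cup -evalD.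
by congr eval; apply/funext => z; rewrite extendD mulrDr.
Qed.

Lemma eval0 (T : choiceType) c : eval (fun _ : T => 0 : 'F_2) c = 0.
Proof. by rewrite /eval fgliftE big1 // => x _; rewrite scaler0. Qed.

Lemma cup0l k p q r (b : cochain 'F_2 X q) : cup o k r (0 : cochain 'F_2 X p) b = 0.
Proof.
apply/funext => x; rewrite -[RHS](eval0 (nabla o k x)) /cup; congr eval.
by apply/funext => z; rewrite extend0 mul0r.
Qed.

Lemma cup0r k p q r (a : cochain 'F_2 X p) : cup o k r a (0 : cochain 'F_2 X q) = 0.
Proof.
apply/funext => x; rewrite -[RHS](eval0 (nabla o k x)) /cup; congr eval.
by apply/funext => z; rewrite extend0 mulr0.
Qed.

(** The case of the cone in which the target of f is the object at hand: the
    simplices of the target only have faces in the target. *)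
Theorem coboundary_cup k p q r (a : cochain 'F_2 X p) (b : cochain 'F_2 X q) :
  coboundary (cup o k r a b) =
  cup o k r.+1 (coboundary a) b + cup o k r.+1 a (coboundary b) +
  cup o (k - 1) r.+1 a b + cup o (k - 1) r.+1 b a.
Proof.
apply/funext => x; pose f := id_map X.
pose phi : ob (cone f o o) -> 'F_2 := onY a.
pose chi : ob (cone f o o) -> 'F_2 := onY b.
have dphi z : cobound phi (inl z) = extend (coboundary a) z by rewrite cobound_onY /=
  addr0.
have dchi z : cobound chi (inl z) = extend (coboundary b) z by rewrite cobound_onY /=
  addr0.
have := cobound_product k phi chi (inl (Tagged (simp X) x)).
rewrite cobound_inl (sum_faces (fun y => product k phi chi (inl y))).
rewrite (@product_inl _ _ _ _ _ _ _ _ _ (coboundary a) b) //.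
rewrite (@product_inl _ _ _ _ _ _ _ _ _ a (coboundary b)) //.
rewrite (@product_inl _ _ _ _ _ _ _ _ _ a b) // (@product_inl _ _ _ _ _ _ _ _ _ b a) //
  => e.
refine (etrans _ e).
by congr (coboundary _ _); apply/funext => y;
  rewrite (@product_inl _ _ _ _ _ _ _ _ _ a b).
Qed.

Lemma cochain_addxx m (a : cochain 'F_2 X m) : a + a = 0.
Proof. by apply/funext => x; exact: F2_addxx. Qed.

Lemma cochain_opp m (a : cochain 'F_2 X m) : - a = a.
Proof. by apply/eqP; rewrite eq_sym -addr_eq0 cochain_addxx. Qed.

Lemma is_coboundary0 m : is_coboundary (0 : cochain 'F_2 X m).
Proof.
case: m => [|m] //=; exists 0.
by rewrite -(subrr (0 : cochain 'F_2 X m)) coboundaryB subrr.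
Qed.

Lemma coboundaryD m (a b : cochain 'F_2 X m) :
  coboundary (a + b) = coboundary a + coboundary b.
Proof. by rewrite -[b in LHS]cochain_opp coboundaryB cochain_opp. Qed.

Lemma steenrod_cocycle i m (a : cocycle 'F_2 X m) :
  steenrod_cochain o i (val a) \in cocycles.
Proof.
apply/eqP; rewrite /steenrod_cochain coboundary_cup.
have /eqP -> : val a \in cocycles := valP a.
by rewrite cup0l cup0r !add0r cochain_addxx.
Qed.

Definition steenrod_cocycle_of i m (a : cocycle 'F_2 X m) := Cocycle (steenrod_cocycle i
  a).

(** With a = a' + c and c = db, the difference is
    a' cup_k c + c cup_k a' + c cup_k c.  The first two terms are the coboundary
    of a' cup_(k+1) c, and the last one is that of
    b cup_k c + b cup_(k-1) b. *)
Lemma steenrod_class i m (a a' : cocycle 'F_2 X m) :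
  is_coboundary (val a - val a') ->
  is_coboundary (steenrod_cochain o i (val a) - steenrod_cochain o i (val a')).
Proof.
have /eqP da' : val a' \in cocycles := valP a'.
have /eqP da : val a \in cocycles := valP a.
move: (val a) (val a') da da' => {}a {}a'.
case: m a a' => [|m] a a' da da' /=.
  by move=> /subr0_eq ->; rewrite subrr; exact: is_coboundary0.
case=> b eb; set c := coboundary b in eb.
have ea : a = a' + c by rewrite -eb addrC subrK.
have dc : coboundary c = 0 by rewrite -eb coboundaryB da da' subrr.
rewrite /steenrod_cochain ea cupDl !cupDr; set k := (_ - i%:Z).
rewrite -[X in X - _]addrA [X in X - _]addrC addrK.
(* These are the three cochains named above; m is here the level of b. *)
exists (cup o (k + 1) (m + i) a' c + cup o k (m + i) b c + cup o (k - 1) (m + i) b b).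
rewrite !coboundaryD !coboundary_cup da' dc !cup0l !cup0r -/c !(add0r, addr0) addrK.
have cancel (P Q S T U V : cochain 'F_2 X (m + i).+1) :
    P + Q + (S + T + U) + (U + T + V + V) = P + (Q + S).
  rewrite -[U + T + V + V]addrA cochain_addxx addr0 -[S + T + U]addrA -[LHS]addrA.
  by rewrite -[S + (T + U) + _]addrA [U + T]addrC cochain_addxx addr0 -addrA.
by rewrite cancel.
Qed.

Lemma sq_class i m (a : cocycle 'F_2 X m) :
  sq o i (cohom_class a) = cohom_class (steenrod_cocycle_of i a).
Proof.
rewrite /sq; set a' := repr _.
have -> : insubd 0 (steenrod_cochain o i (val a')) = steenrod_cocycle_of i a'.
  by apply: val_inj; rewrite val_insubd steenrod_cocycle.
apply/cohom_class_eq; apply: steenrod_class; apply/cohom_class_eq.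
by rewrite /cohom_class reprK.
Qed.

End Products.

(** * Naturality *)

(** In the cone, xi = a cup_k a + a cup_(k+1) da has coboundary da cup_(k+1) da.
    On the simplices of X this says that the difference is the coboundary of xi
    restricted to X. *)
Lemma steenrod_pullback (X Y : burnside_sset) (f : burnside_map X Y)
    (oX : ordering X) (oY : ordering Y) i m (a : cochain 'F_2 Y m) :
  coboundary a = 0 ->
  is_coboundary (pullback f (steenrod_cochain oY i a) -
                 steenrod_cochain oX i (pullback f a)).
Proof.
move=> da; pose F := cone f oX oY; rewrite /steenrod_cochain.
set k := (_ - i%:Z); set r := (m + i)%N.
pose phi : ob F -> 'F_2 := onY a.
(* The cochain whose restriction to X is the primitive. *)
pose xi z := product k phi phi z + product (k + 1) phi (cobound phi) z.
have dphi : cobound phi = onX (pullback f a).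
  apply/funext => z; rewrite cobound_onY da; case: z => [y|x] /=.
    by rewrite extend0 addr0.
  by rewrite add0r.
have ddphi z : cobound (cobound phi) z = 0.
  rewrite dphi cobound_onX -pullback_coboundary da.
  have -> : pullback f (0 : cochain 'F_2 Y m.+1) = 0.
    by rewrite -(subrr (0 : cochain 'F_2 Y m.+1)) pullbackB subrr.
  by case: z => [y|x] //=; rewrite extend0.
have product0 (psi chi : ob F -> 'F_2) z : (forall y, chi y = 0) -> product (k + 1) psi
  chi z = 0.
  by move=> h; apply: big1 => s _; apply: big1 => t _; rewrite h mulr0.
(* The terms with phi and its coboundary occur twice, those with phi alone too. *)
have dxi z : cobound xi z = product (k + 1) (cobound phi) (cobound phi) z.
  have -> : cobound xi z = cobound (product k phi phi) z + cobound (product (k + 1) phi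
    (cobound phi)) z.
    by rewrite /cobound -big_split.
  rewrite !cobound_product (product0 phi (cobound (cobound phi))) // addr0 addrK.
  rewrite -[X in X + _]addrA F2_addxx addr0.
  set u := product k (cobound phi) phi z; set v := product k phi (cobound phi) z;
    set w := product _ _ _ z.
  by rewrite addrC -!addrA [X in _ + (_ + X)]addrA F2_addxx add0r F2_addxx addr0.
have xiY y : xi (inl (Tagged (simp Y) y)) = cup oY k r a a y.
  rewrite /xi (@product_inl _ _ _ _ _ _ _ _ _ a a) // [X in _ + X](_ : _ = 0) ?addr0 //.
  rewrite /product /= big_map big1 // => s _; rewrite big_map big1 // => t _.
  by rewrite dphi mulr0.
have e (x : simp X r) : cobound xi (inr (Tagged (simp X) x)) =
    cup oX k r (pullback f a) (pullback f a) x.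
  by rewrite dxi dphi product_inr.
have eY x : pullback f (fun y : simp Y r => xi (inl (Tagged (simp Y) y)) : 'F_2) x =
    pullback f (cup oY k r a a) x.
  by congr (pullback _ _ _); apply/funext => y; exact: xiY.
clear xiY; clearbody r; case: r e eY => [|r] e eY /=.
  apply/funext => x.
  rewrite -[LHS]/(pullback f (cup oY k 0 a a) x - cup oX k 0 (pullback f a) (pullback f
    a) x).
  rewrite -e cobound_inr (sum_faces0 (fun x => xi (inr x))) add0r.
  by rewrite (sum_apex f (fun y => xi (inl y))) eY subrr.
exists (fun x => xi (inr (Tagged (simp X) x))); apply/funext => x.
rewrite -[LHS]/(pullback f (cup oY k r.+1 a a) x - cup oX k r.+1 (pullback f a)
  (pullback f a) x).
rewrite -e cobound_inr (sum_apex f (fun y => xi (inl y))) eY.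
rewrite (sum_faces (fun x => xi (inr x))).
set u := coboundary _ x; set v := pullback _ _ _.
rewrite opprD addrCA subrr addr0.
by apply/eqP; rewrite eq_sym -addr_eq0 F2_addxx.
Qed.

Theorem theorem2 :
  (* sq^i : H^n(X) -> H^{n+i}(X) is given by sq^i [a] = [a cup_{n-i} a] *)
  (forall (X : burnside_sset) (oX : ordering X) (i m : nat)
      (a : cocycle 'F_2 X m),
    exists2 b : cocycle 'F_2 X (m + i)%N,
      cocycle_val b = steenrod_cochain oX i (cocycle_val a) &
      sq oX i (cohom_class a) = cohom_class b) /\
  (* naturality: f^* sq^i = sq^i f^* *)
  (forall (X Y : burnside_sset) (f : burnside_map X Y)
      (oX : ordering X) (oY : ordering Y) (i m : nat)
      (c : cohomology 'F_2 Y m),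
    cohom_pullback f (sq oY i c) = sq oX i (cohom_pullback f c)) /\
  (* independence of the order *)
  (forall (X : burnside_sset) (oX oX' : ordering X) (i m : nat)
      (c : cohomology 'F_2 X m),
    sq oX i c = sq oX' i c).
Proof.
have naturality X Y (f : burnside_map X Y) oX oY i m (c : cohomology 'F_2 Y m) :
    cohom_pullback f (sq oY i c) = sq oX i (cohom_pullback f c).
  rewrite -[c]reprK; set a := repr c; rewrite -[(\pi_ _ a)%qT]/(cohom_class a).
  rewrite sq_class !cohom_pullbackE sq_class; apply/cohom_class_eq => /=.
  by apply: steenrod_pullback; apply/eqP; exact: (valP a).
split; last split.
- by move=> X oX i m a; exists (steenrod_cocycle_of oX i a); [|exact: sq_class].
- exact: naturality.
move=> X oX oX' i m c.
have pull_id n (c' : cohomology 'F_2 X n) : cohom_pullback (id_map X) c' = c'.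
  rewrite -[c']reprK -[(\pi_ _ _)%qT]/(cohom_class (repr c')) cohom_pullbackE.
  by congr cohom_class; apply: val_inj; exact: pullback_id.
by rewrite -[LHS]pull_id (naturality _ _ _ oX') pull_id.
Qed.
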